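(* Let $\{\mathbb K_h\}_h$ be a family of exact curved triangulations of $\Omega$ satisfying the affine semi-regularity assumption (with constant $\gamma_0$) and the uniform control of the curved correction (with constants $C_\Psi^{(1)},C_\Psi^{(2)}$), as defined in the context. Then there exists a constant $C^I_{L^2}$, independent of $h$, of $K$ and of the anisotropic shape of the affine core $T_K$, but depending on the uniform bounds for $\Psi_K$ and $\Psi_K^{-1}$, such that for every $K\in\mathbb K_h$ with affine core $T_K$ and every $v\in H^2(K)$, $$\|v-I_L^1v\|_{L^2(K)}\le C^I_{L^2}\sum_{i=1}^{2}\sum_{j=1}^{2}h_{K,i}h_{K,j}\left(\|D^2v[\tau_{K,i},\tau_{K,j}]\|_{L^2(K)}+\|\nabla_xv\cdot b_{K,ij}\|_{L^2(K)}\right),$$ where $I_L^1$ is the exact-curved linear Lagrange interpolation operator on $K$.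
   Context: Reference element: $\widehat T\subset\mathbb R^2$ is the closed triangle with vertices $\hat p_1=(0,0)^\top$, $\hat p_2=(1,0)^\top$, $\hat p_3=(0,1)^\top$. Affine core: a non-degenerate closed triangle $T_K\subset\mathbb R^2$ with vertices $p_1,p_2,p_3$ labelled so that $\overline{p_2p_3}$ is the longest edge. Set $h_{T_K}=|p_2-p_3|$, $h_{K,1}=|p_1-p_2|$, $h_{K,2}=|p_1-p_3|$, with the labelling chosen so that $h_{K,2}\le h_{K,1}$. $\Phi_{T_K}:\widehat T\to T_K$ is the affine bijection with $\Phi_{T_K}(\hat p_i)=p_i$, $i=1,2,3$. Unit vectors: $r_1=(p_2-p_1)/|p_2-p_1|$, $r_2=(p_3-p_1)/|p_3-p_1|$. Exact curved triangle: $K=\Psi_K(T_K)$, where $\Psi_K:U_{T_K}\to\Psi_K(U_{T_K})$ is a $C^2$-diffeomorphism on an open neighbourhood $U_{T_K}$ of $T_K$ with $\det D\Psi_K(y)>0$ for all $y\in T_K$. The element map is $F_K=\Psi_K\circ\Phi_{T_K}:\widehat T\to K$. Vertices and edges of $K$ are the images under $\Psi_K$ of those of $T_K$. Exact curved triangulation of a bounded domain $\Omega\subset\mathbb R^2$ with piecewise smooth boundary: a finite family $\mathbb K_h$ of exact curved triangles, each with fixed affine core and element map, such that $\overline\Omega=\bigcup_{K\in\mathbb K_h}K$; distinct elements have disjoint interiors; the intersection of two distinct elements is empty, a common vertex, or a common curved edge (represented by the same geometric curve from both sides); and $\partial\Omega$ is the union of the edges not shared by two distinct elements. The mesh size is $h=\max_{K\in\mathbb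 K_h}h_{T_K}$. Affine semi-regularity: with $|T_K|_2$ the area of $T_K$ and $H_{T_K}=\frac{h_{K,1}h_{K,2}}{|T_K|_2}h_{T_K}$, there is $\gamma_0>0$ independent of $h$ with $H_{T_K}/h_{T_K}\le\gamma_0$ for all $K\in\mathbb K_h$. Uniform control of the curved correction: there are $C_\Psi^{(1)},C_\Psi^{(2)}>0$ independent of $K$ (and of $h$) with $\|D\Psi_K\|_{L^\infty(T_K)}+\|D\Psi_K^{-1}\|_{L^\infty(K)}\le C_\Psi^{(1)}$ and $\|D^2\Psi_K\|_{L^\infty(T_K)}+\|D^2\Psi_K^{-1}\|_{L^\infty(K)}\le C_\Psi^{(2)}$. Transported directions and curvature vector fields on $K$: $\tau_{K,i}(x)=D\Psi_K(\Psi_K^{-1}(x))r_i$ and $b_{K,ij}(x)=D^2\Psi_K(\Psi_K^{-1}(x))[r_i,r_j]\in\mathbb R^2$ for $i,j=1,2$. Also $D^2v[a,b]=\sum_{\ell,m=1}^2\frac{\partial^2v}{\partial x_\ell\partial x_m}a_\ell b_m$. Interpolation: let $I^1_{\widehat T}:C^0(\widehat T)\to\mathbb P^1(\widehat T)$ be the affine interpolation at the three vertices of $\widehat T$. For $v\in C^0(K)$, $I_L^1v=(I^1_{\widehat T}(v\circ F_K))\circ F_K^{-1}$. It is applied to $v\in H^2(K)$ through the continuous representative of $v$. *)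

(* Defs.v *)
(* The library norm on R * R is the max-norm, hence the separate Euclidean
   norm [enorm] below. *)
From HB Require Import structures.
From mathcomp Require Import all_boot all_order all_algebra.
From mathcomp Require Import all_classical all_reals all_analysis.

Set Implicit Arguments.
Unset Strict Implicit.
Unset Printing Implicit Defensive.

Import Order.TTheory GRing.Theory Num.Theory.
Import numFieldNormedType.Exports.

Local Open Scope classical_set_scope.
Local Open Scope ring_scope.

Notation plane R := (R * R)%type.

Section Plane.
Context {R : realType}.

Definition coord (l : 'I_2) (x : plane R) : R := if l == ord0 then x.1 else x.2.

Definition basis_vec (l : 'I_2) : plane R := ((l == ord0)%:R, (l != ord0)%:R).

Definition enorm (x : plane R) : R := Num.sqrt (x.1 ^+ 2 + x.2 ^+ 2).

Definition dot (x y : plane R) : R := x.1 * y.1 + x.2 * y.2.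

Definition det2 (x y : plane R) : R := x.1 * y.2 - x.2 * y.1.

Definition segment (p q : plane R) : set (plane R) :=
  [set x | exists2 t : R, 0 <= t <= 1 & x = (1 - t) *: p + t *: q].

Definition triangle (p q r : plane R) : set (plane R) :=
  [set x | exists a b c : R, [/\ 0 <= a, 0 <= b, 0 <= c, a + b + c = 1 &
                                x = a *: p + b *: q + c *: r]].

Definition frontier (A : set (plane R)) : set (plane R) :=
  closure A `\` interior A.

Definition mu2 : {measure set (measurableTypeR R * measurableTypeR R) -> \bar R} :=
  (@lebesgue_measure R \x @lebesgue_measure R)%E.

(* L^p norm on A of a function which may be defined beyond A. *)
Definition Lp_norm (p : \bar R) (A : set (plane R)) (f : plane R -> R) : \bar R :=
  Lnorm mu2 p (EFin \o (f \_ A)).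

Definition L2_on (A : set (plane R)) : set (plane R -> R) :=
  [set f | (f \_ A : measurableTypeR R * measurableTypeR R -> R)
             \in Lfun mu2 2%:E].

Definition partial (V : normedModType R) (l : 'I_2) (f : plane R -> V)
  : plane R -> V := fun x => 'D_(basis_vec l) f x.

Fixpoint Ck_on (V : normedModType R) (k : nat) (U : set (plane R))
    (f : plane R -> V) : Prop :=
  match k with
  | 0 => forall x, U x -> {for x, continuous f}
  | k'.+1 => (forall x, U x -> differentiable f x) /\
             (forall l, Ck_on k' U (partial l f))
  end.

(* Df(x)[a] and D^2f(x)[a,b] for a plane-valued f. *)
Definition D1 (f : plane R -> plane R) (x a : plane R) : plane R :=
  \sum_(l < 2) coord l a *: partial l f x.

Definition D2 (f : plane R -> plane R) (x a b : plane R) : plane R :=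
  \sum_(l < 2) \sum_(m < 2) (coord l a * coord m b) *: partial l (partial m f) x.

Definition jacobian_det (f : plane R -> plane R) (x : plane R) : R :=
  det2 (partial ord0 f x) (partial ord_max f x).

(* Pointwise Frobenius norms of the tensors Df and D^2f. *)
Definition D1_norm (f : plane R -> plane R) (x : plane R) : R :=
  Num.sqrt (\sum_(l < 2) enorm (partial l f x) ^+ 2).

Definition D2_norm (f : plane R -> plane R) (x : plane R) : R :=
  Num.sqrt (\sum_(l < 2) \sum_(m < 2) enorm (partial l (partial m f) x) ^+ 2).

(* C^oo functions whose support is a compact subset of the interior of A. *)
Definition test_function (A : set (plane R)) (phi : plane R -> R^o) : Prop :=
  (forall k, Ck_on k setT phi) /\
  exists S : set (plane R),
    [/\ compact S, S `<=` interior A & forall x, ~ S x -> phi x = 0].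

Definition is_weak_partial (A : set (plane R)) (l : 'I_2) (v g : plane R -> R)
  : Prop :=
  forall phi : plane R -> R^o, test_function A phi ->
    \int[mu2]_(x in A) (v x * partial l phi x) =
    - \int[mu2]_(x in A) (g x * phi x).

(* v belongs to H^2(A), with weak first derivatives g l and weak second
   derivatives H l m. *)
Definition in_H2 (A : set (plane R)) (v : plane R -> R)
    (g : 'I_2 -> plane R -> R) (H : 'I_2 -> 'I_2 -> plane R -> R) : Prop :=
  [/\ L2_on A v,
      forall l, L2_on A (g l) /\ is_weak_partial A l v (g l) &
      forall l m, L2_on A (H l m) /\ is_weak_partial A m (g l) (H l m)].

Definition is_continuous_rep (A : set (plane R)) (v w : plane R -> R) : Prop :=
  {within A, continuous w} /\ {ae mu2, forall x, A x -> w x = v x}.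

(* Hilbert choice of a continuous representative; the default v is returned only
   if there is none. *)
Definition continuous_rep (A : set (plane R)) (v : plane R -> R)
  : plane R -> R := xget v [set w | is_continuous_rep A v w].

Definition bounded_domain (Omega : set (plane R)) : Prop :=
  [/\ Omega !=set0, open Omega, connected Omega & bounded_set Omega].

Definition regular_arc (c : R -> plane R) : Prop :=
  [/\ forall t, derivable c t 1, continuous (derive1 c),
      forall t, 0 <= t <= 1 -> derive1 c t != 0 &
      forall s t, 0 <= s <= 1 -> 0 <= t <= 1 -> c s = c t -> s = t].

(* The boundary is a finite union of regular simple C^1 arcs, two of which meet
   at endpoints only; an arc on [0, 1] is taken with a C^1 extension to R. *)
Definition piecewise_smooth_boundary (Omega : set (plane R)) : Prop :=
  exists (n : nat) (c : 'I_n -> R -> plane R),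
    [/\ forall i, regular_arc (c i),
        forall i j s t, i != j -> 0 <= s <= 1 -> 0 <= t <= 1 ->
          c i s = c j t -> (s = 0 \/ s = 1) /\ (t = 0 \/ t = 1) &
        frontier Omega = \bigcup_i (c i @` [set t | 0 <= t <= 1])].

End Plane.

Section CurvedTriangle.
Context {R : realType}.

Record affine_core := AffineCore {
  p1 : plane R;
  p2 : plane R;
  p3 : plane R;
  core_nondegenerate : det2 (p2 - p1) (p3 - p1) != 0;
  core_longest12 : enorm (p1 - p2) <= enorm (p2 - p3);
  core_longest13 : enorm (p1 - p3) <= enorm (p2 - p3);
  core_ordered : enorm (p1 - p3) <= enorm (p1 - p2) }.

Definition core_set (T : affine_core) : set (plane R) :=
  triangle (p1 T) (p2 T) (p3 T).

Definition h_core (T : affine_core) : R := enorm (p2 T - p3 T).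

(* The indices 1, 2 of h_{K,i} and r_i are the elements 0, 1 of 'I_2. *)
Definition h_dir (T : affine_core) (i : 'I_2) : R :=
  if i == ord0 then enorm (p1 T - p2 T) else enorm (p1 T - p3 T).

Definition r_dir (T : affine_core) (i : 'I_2) : plane R :=
  if i == ord0 then (enorm (p2 T - p1 T))^-1 *: (p2 T - p1 T)
  else (enorm (p3 T - p1 T))^-1 *: (p3 T - p1 T).

Definition area (A : set (plane R)) : R := fine (mu2 A).

Definition H_core (T : affine_core) : R :=
  h_dir T ord0 * h_dir T ord_max / area (core_set T) * h_core T.

Definition ref_triangle : set (plane R) := triangle (0, 0) (1, 0) (0, 1).

Definition affine_map (T : affine_core) (x : plane R) : plane R :=
  p1 T + x.1 *: (p2 T - p1 T) + x.2 *: (p3 T - p1 T).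

Definition C2_diffeo (U : set (plane R)) (f : plane R -> plane R) : Prop :=
  [/\ open U, open (f @` U), {in U &, injective f}, Ck_on 2 U f &
      Ck_on 2 (f @` U) (pinv U f)].

Record curved_triangle := CurvedTriangle {
  core : affine_core;
  nbhd : set (plane R);
  psi : plane R -> plane R;
  core_sub_nbhd : core_set core `<=` nbhd;
  psi_diffeo : C2_diffeo nbhd psi;
  psi_det_gt0 : forall y, core_set core y -> 0 < jacobian_det psi y }.

Definition elt_set (K : curved_triangle) : set (plane R) :=
  psi K @` core_set (core K).

Definition psi_inv (K : curved_triangle) : plane R -> plane R :=
  pinv (nbhd K) (psi K).

Definition elt_map (K : curved_triangle) : plane R -> plane R :=
  psi K \o affine_map (core K).

Definition elt_map_inv (K : curved_triangle) : plane R -> plane R :=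
  pinv ref_triangle (elt_map K).

Definition vertices (K : curved_triangle) : set (plane R) :=
  psi K @` [set p1 (core K); p2 (core K); p3 (core K)].

Definition edges (K : curved_triangle) : set (set (plane R)) :=
  [set psi K @` segment (p1 (core K)) (p2 (core K));
       psi K @` segment (p2 (core K)) (p3 (core K));
       psi K @` segment (p1 (core K)) (p3 (core K))].

Definition tau (K : curved_triangle) (i : 'I_2) (x : plane R) : plane R :=
  D1 (psi K) (psi_inv K x) (r_dir (core K) i).

Definition bfield (K : curved_triangle) (i j : 'I_2) (x : plane R) : plane R :=
  D2 (psi K) (psi_inv K x) (r_dir (core K) i) (r_dir (core K) j).

(* Affine function agreeing with w at the vertices of the reference triangle. *)
Definition ref_interp (w : plane R -> R) (x : plane R) : R :=
  w (0, 0) * (1 - x.1 - x.2) + w (1, 0) * x.1 + w (0, 1) * x.2.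

Definition lagrange_C0 (K : curved_triangle) (v : plane R -> R) : plane R -> R :=
  ref_interp (v \o elt_map K) \o elt_map_inv K.

(* Interpolant of an H^2 class, through its continuous representative. *)
Definition lagrange_interp (K : curved_triangle) (v : plane R -> R)
  : plane R -> R := lagrange_C0 K (continuous_rep (elt_set K) v).

Definition semi_regular (gamma0 : R) (K : curved_triangle) : Prop :=
  H_core (core K) / h_core (core K) <= gamma0.

Definition curvature_control (C1 C2 : R) (K : curved_triangle) : Prop :=
  (Lp_norm +oo (core_set (core K)) (D1_norm (psi K)) +
     Lp_norm +oo (elt_set K) (D1_norm (psi_inv K)) <= C1%:E)%E /\
  (Lp_norm +oo (core_set (core K)) (D2_norm (psi K)) +
     Lp_norm +oo (elt_set K) (D2_norm (psi_inv K)) <= C2%:E)%E.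

Definition conforming (K L : curved_triangle) : Prop :=
  [\/ elt_set K `&` elt_set L = set0,
      exists x, [/\ vertices K x, vertices L x &
                    elt_set K `&` elt_set L = [set x]] |
      exists E, [/\ edges K E, edges L E & elt_set K `&` elt_set L = E]].

Record triangulation (Omega : set (plane R)) := Triangulation {
  nb_elts : nat;
  elt : 'I_nb_elts -> curved_triangle;
  elt_cover : closure Omega = \bigcup_i elt_set (elt i);
  elt_disjoint : forall i j, i != j ->
    interior (elt_set (elt i)) `&` interior (elt_set (elt j)) = set0;
  elt_conforming : forall i j, i != j -> conforming (elt i) (elt j);
  elt_frontier : frontier Omega =
    \bigcup_(E in [set E | exists i, edges (elt i) E /\
                     forall j, j != i -> ~ edges (elt j) E]) E }.

(* D^2 v[a,b] and grad v . b for a function v with derivatives given by H, g. *)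
Definition hess_apply (H : 'I_2 -> 'I_2 -> plane R -> R)
    (a b : plane R -> plane R) (x : plane R) : R :=
  \sum_(l < 2) \sum_(m < 2) H l m x * coord l (a x) * coord m (b x).

Definition grad_dot (g : 'I_2 -> plane R -> R) (b : plane R -> plane R)
    (x : plane R) : R := \sum_(l < 2) g l x * coord l (b x).

End CurvedTriangle.

Arguments affine_core : clear implicits.
Arguments curved_triangle : clear implicits.
Arguments elt {R Omega} _ _.

(* Main.v *)
(* Idea. Let K = psi(T). Mollify v to v_n and pull it back to
   u_n = v_n o psi o D_n, where D_n contracts T slightly towards its barycenter,
   so that only values of v_n well inside K matter and u_n is twice
   differentiable on all of T. Taylor's formula along the segments from y to the
   three vertices expresses the interpolation error of u_n at y through second
   derivatives of u_n in the directions vertex - y, which are combinations of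
   the h_i r_i with coefficients at most 1; the chain rule turns them into
   D^2 v_n[tau_i, tau_j] + grad v_n . b_ij. After integration over K the
   substitution y -> (1 - t) y + t vertex costs (1 - t)^-2, exactly the weight of
   the remainder. Substitutions only use the Lipschitz constants of psi and its
   inverse, so the constant depends on C1 alone. Finally, bounds on u_st over
   parallelograms make the u_n equicontinuous: they converge everywhere to the
   continuous representative of v, and Fatou's lemma passes to the limit. *)
From HB Require Import structures.
From mathcomp Require Import all_boot all_order all_algebra.
From mathcomp Require Import all_classical all_reals all_analysis.
From mathcomp Require Import measurable_realfun ess_sup_inf ring lra.
Require Import Defs.
Set Implicit Arguments.
Unset Strict Implicit.
Unset Printing Implicit Defensive.

Import Order.TTheory GRing.Theory Num.Theory.
Import numFieldNormedType.Exports.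

Local Open Scope classical_set_scope.
Local Open Scope ring_scope.

(** * Measure on the plane *)

(** Two kinds of constants are kept apart. The quantitative ones come from the substitutions: a map
    that contracts by at most a factor L in the max-norm costs 4 L^2, the map y -> th ((1 - t) y + t
    vertex) + c conjugated by [psi] has L = 4 C1^2 / (th (1 - t)), and th >= 1/2, so each of the
    three vertices contributes (4 C1)^4 whatever the shape of the core. A factor 2 lost in the
    passage to the limit gives 6 (4 C1)^4, rounded up to the perfect square 9 (4 C1)^4. All other
    constants (Lipschitz constant of the barycentric coordinates, bounds on D psi and D^2 psi over
    the core) may degenerate with K, since they only serve the limit on one fixed element. The
    contraction D_n answers an obstacle: v is extended by 0, so near the boundary of K the
    derivatives of v_n are not the mollified weak derivatives. The vertices lie exactly there, and
    convergence almost everywhere says nothing about three points; hence the equicontinuity argument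
    up to the boundary. *)

Notation mplane R := (measurableTypeR R * measurableTypeR R)%type.

Section PlaneMeasure.
Context {R : realType}.

Lemma mu2_sigma_finite : sigma_finite setT (@mu2 R).
Proof.
pose F n : set (measurableTypeR R) := `[- (n%:R), n%:R]%classic.
have mF n : measurable (F n) by exact: measurable_itv.
exists (fun n => F n `*` F n).
  rewrite predeqE => -[x y]; split => // _.
  pose m := Num.max `|x| `|y|.
  exists (Num.bound m) => //=.
  have hm : m <= (Num.bound m)%:R by rewrite ltW// archi_boundP// le_max normr_ge0.
  rewrite /F/= !in_itv/= -!ler_norml.
  by split; apply: le_trans hm; rewrite le_max lexx ?orbT.
move=> n; split; first exact: measurableX.
rewrite /mu2/= product_measure1E// /F /= !lebesgue_measure_itv/=.
by case: ifP => // _; [rewrite -EFinD -EFinM ltry|rewrite mul0e ltry].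
Qed.

(** Bundles [mu2] with its sigma-finiteness, as Tonelli's theorem requires on products with a factor
    [mplane R]. *)
Definition mu2_sf : {sigma_finite_measure set (mplane R) -> \bar R} :=
  HB.pack_for {sigma_finite_measure set (mplane R) -> \bar R}
    (@lebesgue_measure R \x @lebesgue_measure R)%E
    (@Measure_isSigmaFinite.Build _ _ _ (@mu2 R) mu2_sigma_finite).

Lemma mu2_box (I J : set (measurableTypeR R)) : measurable I -> measurable J ->
  mu2 (I `*` J) = (lebesgue_measure I * lebesgue_measure J)%E.
Proof. by move=> mI mJ; rewrite /mu2/= product_measure1E. Qed.

Lemma measurable_ball2 (x : plane R) (r : R) :
  measurable (ball x r : set (mplane R)).
Proof.
rewrite (_ : ball x r = (ball x.1 r : set (measurableTypeR R)) `*` ball x.2 r); last first.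
  by apply/seteqP; split => y.
by apply: measurableX; rewrite ball_itv; exact: measurable_itv.
Qed.

(** Second countability ties the topology to the product sigma-algebra: an open set is the countable
    union of the balls with rational centre and radius 1/(n+1) that it contains. *)
Lemma open_measurable2 (O : set (plane R)) :
  open O -> measurable (O : set (mplane R)).
Proof.
move=> oO.
pose B (p q : rat) (n : nat) : set (mplane R) :=
  if pselect (ball ((ratr p, ratr q) : plane R) n.+1%:R^-1 `<=` O)
  then ball ((ratr p, ratr q) : plane R) n.+1%:R^-1 else set0.
have -> : O = \bigcup_p \bigcup_q \bigcup_n B p q n.
  apply/seteqP; split => [x Ox|x [p _] [q _] [n _]]; last first.
    by rewrite /B; case: pselect => [bO /bO|_ []].
  have /nbhs_ballP[e /= e0 he] : nbhs x O by apply: open_nbhs_nbhs.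
  (* Twice the radius 1/(n+1) stays below [e], so a ball of that radius around a rational point near
     [x] remains in [ball x e]. *)
  pose n := Num.bound (2 / e).
  have hn : 2 / e < n.+1%:R.
    apply: (@lt_le_trans _ _ n%:R); last by rewrite ler_nat.
    by rewrite archi_boundP// divr_ge0// ltW.
  have n0 : 0 < (n.+1%:R : R)^-1 by rewrite invr_gt0.
  have hn2 : (n.+1%:R : R)^-1 + n.+1%:R^-1 < e.
    rewrite ltr_pdivrMr// in hn.
    rewrite (_ : _ + _ = 2 / n.+1%:R); last by ring.
    by rewrite ltr_pdivrMr// mulrC.
  have /rat_in_itvoo[p hp] : x.1 - n.+1%:R^-1 < x.1 + n.+1%:R^-1 by rewrite ltrBlDr -addrA ltrDl addr_gt0.
  have /rat_in_itvoo[q hq] : x.2 - n.+1%:R^-1 < x.2 + n.+1%:R^-1 by rewrite ltrBlDr -addrA ltrDl addr_gt0.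
  rewrite !in_itv/= -!ltr_distl in hp hq.
  exists p => //; exists q => //; exists n => //.
  have xb : ball ((ratr p, ratr q) : plane R) n.+1%:R^-1 x by split.
  rewrite /B; case: pselect => [_ //|nO]; case: nO => y yb.
  by apply: he; apply: (le_ball (ltW hn2)); exact: (ball_triangle (ball_sym xb) yb).
apply: bigcupT_measurable_rat => p'.
apply: bigcupT_measurable_rat => q'.
apply: bigcupT_measurable => n; rewrite /B; case: pselect => [?|?]; last exact: measurable0.
exact: measurable_ball2.
Qed.

Lemma closed_measurable2 (F : set (plane R)) :
  closed F -> measurable (F : set (mplane R)).
Proof. by move/closed_openC/open_measurable2/measurableC; rewrite setCK. Qed.

Lemma within_continuous_measurable_fun2 (D : set (plane R)) (f : plane R -> R) :
  measurable (D : set (mplane R)) -> {within D, continuous f} ->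
  measurable_fun (D : set (mplane R)) f.
Proof.
move=> mD /continuousP cf; apply: (measurability _ (RGenOInfty.measurableE R)).
move=> _ [_ [a ->] <-].
have /cf/open_subspaceP [V oV VD] : open (`]a, +oo[%classic : set R).
  exact: interval_open.
by rewrite setIC -VD; apply: measurableI => //; exact: open_measurable2.
Qed.

Lemma continuous_measurable_fun2 (f : plane R -> R) (D : set (mplane R)) :
  continuous f -> measurable_fun D f.
Proof.
move=> cf; apply: measurable_funTS; apply: within_continuous_measurable_fun2 => //.
exact: continuous_subspaceT.
Qed.

End PlaneMeasure.

Lemma cvg_lt_exists (R : realType) (u : nat -> \bar R) (l a : \bar R) :
  u @ \oo --> l -> (l < a)%E -> exists n, (u n < a)%E.
Proof.
move=> cvg la; have : nbhs l [set y | (y < a)%E].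
  by apply: open_nbhs_nbhs; split => //; exact: open_ereal_lt_ereal.
by move/cvg => [N _ /(_ N (leqnn N)) /= h]; exists N.
Qed.

(** * Regularity of finite Borel measures on the plane *)

Section Regularity.
Context {R : realType} (m : {measure set (mplane R) -> \bar R}).
Hypothesis m_fin : (m setT < +oo)%E.

Definition regular_set (B : set (plane R)) := forall e : R, 0 < e ->
  exists F O : set (plane R), [/\ closed F, open O, F `<=` B, B `<=` O &
    (m (O `\` F) < e%:E)%E].

Let mfin (A : set (mplane R)) : measurable A -> (m A < +oo)%E.
Proof.
by move=> mA; apply: le_lt_trans m_fin; apply: le_measure; rewrite ?inE.
Qed.

Lemma regular_setC B : regular_set B -> regular_set (~` B).
Proof.
move=> rB e e0; have [F [U [cF oO FB BO h]]] := rB e e0.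
exists (~` U), (~` F); split.
- exact: open_closedC.
- exact: closed_openC.
- exact: subsetC.
- exact: subsetC.
- rewrite (_ : ~` F `\` ~` U = U `\` F)//.
  by rewrite setDE setCK setIC -setDE.
Qed.

(** An infinite union of closed sets need not be closed. Only finitely many inner sets are kept, and
    continuity from above, which rests on the finiteness of [m], makes the remainder small. *)
Lemma regular_set_bigcup (B : (set (plane R))^nat) :
  (forall n, regular_set (B n)) -> regular_set (\bigcup_n B n).
Proof.
move=> rB e e0.
have /choice[FO hFO] : forall n, exists FO : set (plane R) * set (plane R),
    [/\ closed FO.1, open FO.2, FO.1 `<=` B n, B n `<=` FO.2 &
    (m (FO.2 `\` FO.1) < ((e / 2) / (2 ^ n.+1)%:R)%:E)%E].
  move=> n; have /(rB n)[F [U h]] : 0 < (e / 2) / (2 ^ n.+1)%:R.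
    by rewrite !divr_gt0// ltr0n expn_gt0.
  by exists (F, U).
pose O := \bigcup_n (FO n).2.
pose F N := \big[setU/set0]_(i < N) (FO i).1.
have FE N : F N = \bigcup_(i in `I_N) (FO i).1.
  by rewrite /F -(bigcup_mkord N (fun i => (FO i).1)).
have oO : open O by apply: bigcup_open => n _; have [] := hFO n.
have cF N : closed (F N) by apply: closed_bigsetU => i _; have [] := hFO i.
have mO := open_measurable2 oO.
have mF N := closed_measurable2 (cF N).
pose D N : set (mplane R) := O `\` F N.
have mD N : measurable (D N) by exact: measurableD.
have mD' : measurable (\bigcap_n D n) by exact: bigcapT_measurable.
have Dni : nonincreasing_seq D.
  move=> i j ij; apply/subsetPset; apply: setDS => x.
  by rewrite !FE => -[k /= ki xk]; exists k => //=; apply: leq_trans ij.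
(* A point in every [D n] lies in some outer set but not in the inner set of the same index. These
   gaps add up to e/2, which leaves room for a strict bound at a finite stage. *)
have m_half : (m (\bigcap_n D n) <= (e / 2)%:E)%E.
  apply: (@le_trans _ _ (\sum_(n <oo) m ((FO n).2 `\` (FO n).1))%E).
    apply: measure_sigma_subadditive => //.
    - move=> n; have [cFn oOn _ _ _] := hFO n.
      by apply: measurableD; [exact: open_measurable2|exact: closed_measurable2].
    - move=> x Dx; have [[n _ On] _] := Dx 0%N I.
      exists n => //; split => // Fn.
      have [_] := Dx n.+1 I; apply.
      by rewrite FE; exists n => /=.
  apply: (@le_trans _ _ (\sum_(n <oo) ((e / 2) / (2 ^ n.+1)%:R)%:E)%E).
    by apply: lee_nneseries => n _ //; have [_ _ _ _ /ltW] := hFO n.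
  by apply: epsilon_trick0; rewrite divr_ge0// ltW.
have := nonincreasing_cvg_mu (mfin (mD 0%N)) mD mD' Dni.
move=> cvg.
have he : (m (\bigcap_n D n) < e%:E)%E.
  by apply: le_lt_trans m_half _; rewrite lte_fin; lra.
have [N /= hN] := cvg_lt_exists cvg he.
exists (F N), O; split => //.
- rewrite FE => x [k _ xk]; exists k => //.
  by have [_ _ + _ _] := hFO k; exact.
- by move=> x [k _ xk]; exists k => //; have [_ _ _ + _] := hFO k; exact.
Qed.

(** The closed sets p >= a + 1/(n+1) exhaust the open set p > a, so their complements in it shrink
    to nothing. *)
Lemma regular_open_half (p : plane R -> R) (a : R) : continuous p ->
  regular_set (p @^-1` `]a, +oo[).
Proof.
move=> cp e e0.
have oB : open (p @^-1` `]a, +oo[).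
  by apply: open_comp => [x _|]; [exact: cp|exact: interval_open].
pose F n := p @^-1` `[a + n.+1%:R^-1, +oo[.
have cF n : closed (F n).
  by apply: closed_comp => [x _|]; [exact: cp|exact: interval_closed].
pose D n : set (mplane R) := p @^-1` `]a, +oo[ `\` F n.
have mD n : measurable (D n).
  by apply: measurableD; [exact: open_measurable2|exact: closed_measurable2].
have D0 : \bigcap_n D n = set0.
  apply/seteqP; split => // x Dx.
  have [+ _] := Dx 0%N I; rewrite /= in_itv/= andbT => ax.
  have [n hn] : exists n, n.+1%:R^-1 < p x - a.
    have d0 : 0 < p x - a by rewrite subr_gt0.
    exists (Num.bound (p x - a)^-1).
    rewrite invf_plt ?posrE//; apply: lt_trans (_ : (Num.bound (p x - a)^-1)%:R < _).
      by rewrite archi_boundP// invr_ge0 ltW.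
    by rewrite ltr_nat.
  have [_] := Dx n I; apply; rewrite /F/= in_itv/= andbT.
  by rewrite -lerBrDl ltW.
have Dni : nonincreasing_seq D.
  move=> i j ij; apply/subsetPset; apply: setDS => x.
  rewrite /F/= !in_itv/= !andbT; apply: le_trans.
  by rewrite lerD2l lef_pV2 ?posrE// ler_nat ltnS.
have mD' : measurable (\bigcap_n D n) by exact: bigcapT_measurable.
have := nonincreasing_cvg_mu (mfin (mD 0%N)) mD mD' Dni.
rewrite D0 measure0 => cvg.
have he : (0 < e%:E)%E by rewrite lte_fin.
have [N /= hN] := cvg_lt_exists cvg he.
exists (F N), (p @^-1` `]a, +oo[); split => //.
move=> x; rewrite /F/= !in_itv/= !andbT; apply: lt_le_trans.
by rewrite ltrDl invr_gt0.
Qed.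

Lemma regular_preimage (p : plane R -> R) (A : set (measurableTypeR R)) :
  continuous p -> measurable A -> regular_set (p @^-1` A).
Proof.
move=> cp; have -> : @measurable _ (measurableTypeR R) =
  <<s @RGenOInfty.G R >>.
  exact: RGenOInfty.measurableE.
move: A; apply: smallest_sub => [|_ [x ->]]; last exact: regular_open_half.
split.
- rewrite /= preimage_set0 => e e0; exists set0, set0.
  split; [exact: closed0|exact: open0|by []|by []|by rewrite setD0 measure0].
- by move=> A /= rA; rewrite setTD preimage_setC; exact: regular_setC.
- by move=> B rB /=; rewrite preimage_bigcup; exact: regular_set_bigcup.
Qed.

(** Regular sets form a sigma-algebra that contains the generators of the product one, namely the
    preimages of Borel sets under the two projections. *)
Lemma measurable_regular (B : set (mplane R)) : measurable B -> regular_set B.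
Proof.
move: B; apply: smallest_sub.
  split.
  - move=> e e0; exists set0, set0.
    split; [exact: closed0|exact: open0|by []|by []|by rewrite setD0 measure0].
  - by move=> A /= rA; rewrite setTD; exact: regular_setC.
  - by move=> B rB /=; exact: regular_set_bigcup.
move=> _ [[A mA <-]|[A mA <-]]; rewrite setTI.
- by apply: (@regular_preimage fst) => // x; exact: cvg_fst.
- by apply: (@regular_preimage snd) => // x; exact: cvg_snd.
Qed.

End Regularity.

(** * A crude change of variables *)

Section Squares.
Context {R : realType}.

(** Half-open, so that the four quarters partition the square exactly. The triple [q] holds the
    lower left corner and the side. *)
Definition hsquare (q : R * R * R) : set (mplane R) :=
  (`[q.1.1, q.1.1 + q.2[%classic : set (measurableTypeR R)) `*`
  `[q.1.2, q.1.2 + q.2[%classic.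

Lemma measurable_hsquare q : measurable (hsquare q).
Proof. by apply: measurableX; exact: measurable_itv. Qed.

Lemma mu2_hsquare q : 0 < q.2 -> mu2 (hsquare q) = (q.2 ^+ 2)%:E.
Proof.
move=> q0; rewrite mu2_box; [|exact: measurable_itv|exact: measurable_itv].
rewrite !lebesgue_measure_itv/= !lte_fin !ltrDl q0 -!EFinB -EFinM; congr (_%:E).
ring.
Qed.

Definition hsquare_child (q q' : R * R * R) :=
  [/\ q'.2 = q.2 / 2, q'.1.1 = q.1.1 \/ q'.1.1 = q.1.1 + q.2 / 2 &
      q'.1.2 = q.1.2 \/ q'.1.2 = q.1.2 + q.2 / 2].

Definition quarter (i j : bool) (q : R * R * R) : R * R * R :=
  (if i then q.1.1 + q.2 / 2 else q.1.1, if j then q.1.2 + q.2 / 2 else q.1.2,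
   q.2 / 2).

Lemma quarter_child i j q : hsquare_child q (quarter i j q).
Proof. by split => //=; [case: i|case: j]; [right|left|right|left]. Qed.

Lemma hsquare_split (q : R * R * R) : 0 < q.2 ->
  hsquare q = hsquare (quarter false false q) `|`
    (hsquare (quarter true false q) `|`
    (hsquare (quarter false true q) `|`
     hsquare (quarter true true q))).
Proof.
case: q => [[a b] s] /= s0.
rewrite /hsquare /quarter /=; apply/seteqP; split => -[x y]; rewrite /= !in_itv/=.
  move=> [/andP[ax xa] /andP[yb by_]].
  have [hx|hx] := ltP x (a + s / 2); have [hy|hy] := ltP y (b + s / 2).
  - by left; split; apply/andP.
  - by right; right; left; split; apply/andP; split => //; lra.
  - by right; left; split; apply/andP; split => //; lra.
  - by right; right; right; split; apply/andP; split => //; lra.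
by case=> [|[|[|]]] [/andP[? ?] /andP[? ?]]; split; apply/andP; split; lra.
Qed.

Lemma quarter_disjoint i j i' j' q x : hsquare (quarter i j q) x ->
  hsquare (quarter i' j' q) x -> i = i' /\ j = j'.
Proof.
case: x => a b; rewrite /hsquare/quarter/= !in_itv/=.
move=> [/andP[H H0] /andP[H1 H2]] [/andP[H3 H4] /andP[H5 H6]].
by split; [case: i i' H H0 H3 H4 => -[] //=; lra|case: j j' H1 H2 H5 H6 => -[] //=; lra].
Qed.

Lemma measure_hsquare4 (m : {measure set (mplane R) -> \bar R})
    (A : set (mplane R)) q : measurable A -> 0 < q.2 ->
  m (A `&` hsquare q) =
  (m (A `&` hsquare (quarter false false q)) +
  (m (A `&` hsquare (quarter true false q)) +
  (m (A `&` hsquare (quarter false true q)) +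
   m (A `&` hsquare (quarter true true q)))))%E.
Proof.
move=> mA q0; rewrite [in LHS]hsquare_split// !setIUr.
have mB i j : measurable (A `&` hsquare (quarter i j q)).
  by apply: measurableI => //; exact: measurable_hsquare.
rewrite measureU//; last 2 first.
- by do ?apply: measurableU.
- apply/seteqP; split => // x [[_ h]] [[_ h']|[[_ h']|[_ h']]];
  by have [] := quarter_disjoint h h'.
rewrite measureU//; last 2 first.
- exact: measurableU.
- apply/seteqP; split => // x [[_ h]] [[_ h']|[_ h']];
  by have [] := quarter_disjoint h h'.
rewrite measureU//; apply/seteqP; split => // x [[_ h]] [_ h'].
by have [] := quarter_disjoint h h'.
Qed.

(** Additivity of the right-hand side of the bisected inequality: with [d] equal to e times the
    squared half side, the four error terms add up to that of the whole square. *)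
Lemma quarter_sum (C d : R) (a b c e : \bar R) : 0 <= C ->
  (0 <= a -> 0 <= b -> 0 <= c -> 0 <= e ->
  (C%:E * a + d%:E) + ((C%:E * b + d%:E) + ((C%:E * c + d%:E) +
    (C%:E * e + d%:E))) = C%:E * (a + (b + (c + e))) + (4 * d)%:E)%E.
Proof.
move=> C0 a0 b0 c0 e0; have C0' : (0 <= C%:E)%E by rewrite lee_fin.
have ce : (0 <= c + e)%E by rewrite adde_ge0.
rewrite (ge0_muleDr _ a0 (adde_ge0 b0 ce)) (ge0_muleDr _ b0 ce) (ge0_muleDr _ c0 e0).
rewrite (addeACA (C%:E * c)%E) (addeACA (C%:E * b)%E) (addeACA (C%:E * a)%E).
by congr (_ + _)%E; rewrite -!EFinD; congr (_%:E); ring.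
Qed.

(* Goursat-style bisection: a superadditive inequality that fails on a square
   fails on arbitrarily small squares shrinking to a point. *)
Lemma hsquare_bisection (P : R * R * R -> Prop) (q0 : R * R * R) :
  0 < q0.2 -> P q0 ->
  (forall q, 0 < q.2 -> P q -> exists2 q', P q' & hsquare_child q q') ->
  exists x : plane R, forall r : R, 0 < r ->
    exists q, [/\ 0 < q.2, q.2 < r, P q & hsquare q `<=` ball x r].
Proof.
move=> q00 Pq0 hP.
have /choice[f hf] : forall q, exists q', 0 < q.2 -> P q -> P q' /\ hsquare_child q q'.
  move=> q; have [[q1 q2]|nq] := pselect (0 < q.2 /\ P q); last first.
    by exists q => q1 q2; exfalso; apply: nq.
  by have [q' ? ?] := hP _ q1 q2; exists q'.
pose u n := iter n f q0.
have hu n : [/\ (u n).2 = q0.2 / 2 ^+ n, P (u n) & hsquare_child (u n) (u n.+1)].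
  have pos k : 0 < q0.2 / 2 ^+ k by rewrite divr_gt0 ?exprn_gt0.
  elim: n => [|n [un Pn [c2 c1 c3]]].
    have [||p c] := hf q0 => //.
    by rewrite expr0 divr1; split.
  have e1 : (u n.+1).2 = q0.2 / 2 ^+ n.+1.
    by rewrite c2 un exprSr invfM mulrA.
  have p0 : 0 < (u n).2 by rewrite un.
  have [p1 _] := hf (u n) p0 Pn.
  have p2 : 0 < (u n.+1).2 by rewrite e1.
  by have [p3 c4] := hf (u n.+1) p2 p1; split.
have upos n : 0 < (u n).2.
  by have [-> _ _] := hu n; rewrite divr_gt0 ?exprn_gt0.
(* Nested intervals, for both coordinates at once: [g] is either projection, and the common point is
   the supremum of the lower ends. *)
have nested (g : R * R -> R) :
    (forall q q', hsquare_child q q' -> g q'.1 = g q.1 \/ g q'.1 = g q.1 + q.2 / 2) ->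
    exists x : R, forall n, g (u n).1 <= x <= g (u n).1 + (u n).2.
  move=> hg.
  have step n : g (u n).1 <= g (u n.+1).1 /\
      g (u n.+1).1 + (u n.+1).2 <= g (u n).1 + (u n).2.
    have [_ _ c] := hu n; have [c2 _ _] := c; have := upos n.
    by case: (hg _ _ c) => ->; rewrite c2 => ?; split; lra.
  have mono n k : g (u n).1 <= g (u (n + k)%N).1 /\
      g (u (n + k)%N).1 + (u (n + k)%N).2 <= g (u n).1 + (u n).2.
    elim: k => [|k [h1 h2]]; first by rewrite addn0.
    have [h3 h4] := step (n + k)%N; rewrite addnS.
    by split; [apply: le_trans h3|apply: le_trans h2].
  have le n k : g (u n).1 <= g (u k).1 + (u k).2.
    have [nk|/ltnW kn] := leqP n k.
      have [+ _] := mono n (k - n)%N; rewrite subnKC// => h.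
      by apply: (le_trans h); rewrite lerDl ltW.
    have [_] := mono k (n - k)%N; rewrite subnKC//; apply: le_trans.
    by rewrite lerDl ltW.
  exists (sup (range (fun n => g (u n).1))) => n; apply/andP; split.
    apply: ub_le_sup; last by exists n.
    by exists (g (u 0%N).1 + (u 0%N).2) => _ [k _ <-].
  apply: ge_sup; first by exists (g (u 0%N).1); exists 0%N.
  by move=> _ [k _ <-].
have [x hx] := nested fst ltac:(by move=> q q' []).
have [y hy] := nested snd ltac:(by move=> q q' []).
exists (x, y) => r r0.
have [n hn] : exists n, (u n).2 < r.
  have [n hn] : exists n : nat, q0.2 / r < 2 ^+ n.
    exists (Num.bound (q0.2 / r)).
    apply: lt_le_trans (_ : (Num.bound (q0.2 / r))%:R <= _).
      by rewrite archi_boundP// divr_ge0// ltW.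
    by rewrite -natrX ler_nat ltnW// ltn_expl.
  exists n; have [-> _ _] := hu n.
  by rewrite ltr_pdivrMr ?exprn_gt0// mulrC -ltr_pdivrMr.
exists (u n); split => //; first by have [] := hu n.
move=> -[a b] [/=]; rewrite !in_itv/= => /andP[? ?] /andP[? ?].
have /andP[? ?] := hx n; have /andP[? ?] := hy n.
by split; rewrite /ball/= ltr_norml; apply/andP; split; lra.
Qed.

End Squares.

Section CrudeChangeOfVariables.
Context {R : realType}.
Variables (V W : set (plane R)) (S : plane R -> plane R) (L N : R).
Hypotheses (mV : measurable (V : set (mplane R)))
  (mS : measurable_fun setT (S : mplane R -> mplane R)).
Hypotheses (oW : open W) (L0 : 0 < L) (N0 : 0 < N) (bW : W `<=` ball (0, 0) N).
Hypothesis Vfin : (mu2 (V : set (mplane R)) < +oo)%E.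
Hypothesis S_expand : forall x, W x -> exists2 r : R, 0 < r &
  forall a b, V a -> V b -> ball x r (S a) -> ball x r (S b) ->
    `|a - b| <= L * `|S a - S b|.

Let nu : {measure set (mplane R) -> \bar R} :=
  measure_function_pushforward__canonical__measure_function_Measure
    (mrestr mu2 mV) mS.

Let nuE A : nu A = mu2 (S @^-1` A `&` V). Proof. by []. Qed.

Let nu_lt_pinfty A : measurable A -> (nu A < +oo)%E.
Proof.
move=> mA; apply: le_lt_trans Vfin; rewrite nuE; apply: le_measure; rewrite ?inE//.
apply: measurableI => //; rewrite -[X in measurable X]setTI; exact: mS.
Qed.

(** As soon as one point [a] of V is sent into a small square of side s, all others sent there lie
    in the box of half side L s about [a], whose area is 4 L^2 s^2. *)
Let nu_small_square (x : plane R) (r : R) : 0 < r ->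
  (forall a b, V a -> V b -> ball x r (S a) -> ball x r (S b) ->
    `|a - b| <= L * `|S a - S b|) ->
  forall q, 0 < q.2 -> hsquare q `<=` ball x r ->
  (nu (hsquare q) <= ((4 * L ^+ 2) * q.2 ^+ 2)%:E)%E.
Proof.
move=> r0 hr q q0 qb; rewrite nuE.
have mpre : measurable (S @^-1` hsquare q `&` V : set (mplane R)).
  apply: measurableI => //; rewrite -[X in measurable X]setTI.
  by apply: mS => //; exact: measurable_hsquare.
have [->|/set0P[a [Sa Va]]] := eqVneq (S @^-1` hsquare q `&` V : set (mplane R)) set0.
  by rewrite measure0 lee_fin; apply: mulr_ge0; rewrite ?sqr_ge0// mulr_ge0 ?sqr_ge0.
pose I (c : R) : set (measurableTypeR R) := `[c - L * q.2, c + L * q.2]%classic.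
have mI c : measurable (I c) by exact: measurable_itv.
apply: (@le_trans _ _ (mu2 (I a.1 `*` I a.2))).
  apply: le_measure; rewrite ?inE//; first exact: measurableX.
  move=> b [Sb Vb].
  have hab := hr a b Va Vb (qb _ Sa) (qb _ Sb).
  have hS : `|S a - S b| <= q.2.
    move: Sa Sb; rewrite /hsquare /= !in_itv/=.
    move=> [/andP[? ?] /andP[? ?]] [/andP[? ?] /andP[? ?]].
    rewrite prod_normE ge_max/= !ler_norml.
    by apply/andP; split; apply/andP; split; lra.
  have : `|a - b| <= L * q.2 by apply: le_trans hab _; rewrite ler_wpM2l// ltW.
  rewrite prod_normE ge_max/= !ler_norml => /andP[/andP[? ?] /andP[? ?]].
  by split; rewrite /I /= in_itv/=; apply/andP; split; lra.
have Lq : 0 < L * q.2 by rewrite mulr_gt0.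
have hI c : lebesgue_measure (I c) = (2 * (L * q.2))%:E.
  have hc : c - L * q.2 < c + L * q.2 by lra.
  by rewrite lebesgue_measure_itv/= lte_fin hc -EFinB; congr (_%:E); ring.
by rewrite mu2_box// !hI -EFinM lee_fin le_eqVlt; apply/orP; left; apply/eqP; ring.
Qed.

(** Bisection of the inequality with an extra term proportional to the area. A failure would
    concentrate at a point x: if x is outside the closed F, small squares miss F; if x is in F,
    small squares lie in the open O, where the estimate on small squares contradicts the failure.
    This is why one set is closed and the other open. *)
Let nu_closed_le (F O : set (plane R)) : closed F -> open O ->
  F `<=` O -> O `<=` W -> (nu F <= (4 * L ^+ 2)%:E * mu2 (O : set (mplane R)))%E.
Proof.
move=> cF oO FO OW.
set C := 4 * L ^+ 2; have C0 : 0 <= C by rewrite mulr_ge0 ?sqr_ge0.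
have mF := closed_measurable2 cF; have mO := open_measurable2 oO.
pose q0 : R * R * R := (- N, - N, 2 * N).
have bF : F `<=` hsquare q0.
  move=> x /FO/OW/bW; rewrite /ball/= /prod_ball/= /ball/= !sub0r !normrN !ltr_norml.
  move=> [/andP[? ?] /andP[? ?]]; rewrite /hsquare/= !in_itv/=.
  by split; apply/andP; split; lra.
pose mq q := @measurable_hsquare R q.
have key (e : R) : 0 < e -> forall q : R * R * R, 0 < q.2 ->
    (nu (F `&` hsquare q) <= C%:E * mu2 (O `&` hsquare q) + (e * q.2 ^+ 2)%:E)%E.
  move=> e0 q1 q10; rewrite leNgt; apply/negP => Pq1.
  pose P (q : R * R * R) := (C%:E * mu2 (O `&` hsquare q) + (e * q.2 ^+ 2)%:E <
    nu (F `&` hsquare q))%E.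
  have [|x hx] := @hsquare_bisection R P q1 q10 Pq1.
    move=> q qs Pq.
    apply: contrapT => nex.
    have hc (q' : R * R * R) : hsquare_child q q' ->
        (nu (F `&` hsquare q') <= C%:E * mu2 (O `&` hsquare q') + (e * q'.2 ^+ 2)%:E)%E.
      by move=> c; rewrite leNgt; apply/negP => Pq'; apply: nex; exists q'.
    move: Pq; rewrite /P ltNge => /negP; apply.
    rewrite (measure_hsquare4 nu)// (measure_hsquare4 mu2)//.
    have h1 := hc _ (quarter_child false false q).
    have h2 := hc _ (quarter_child true false q).
    have h3 := hc _ (quarter_child false true q).
    have h4 := hc _ (quarter_child true true q).
    apply: le_trans (leeD h1 (leeD h2 (leeD h3 h4))) _.
    rewrite quarter_sum// [(quarter _ _ _).2]/=.
    rewrite (_ : e * q.2 ^+ 2 = 4 * (e * (q.2 / 2) ^+ 2))//; by field.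
  have [Fx|nFx] := pselect (F x); last first.
    have [r /= r0 hr] : nbhs_ball x (~` F).
      by apply/nbhs_ballP; apply: open_nbhs_nbhs; split => //; exact: closed_openC.
    have [q [qs _ Pq qb]] := hx r r0.
    move: Pq; rewrite /P (_ : F `&` hsquare q = set0); last first.
      by apply/seteqP; split => // y [Fy /qb/hr].
    rewrite measure0 ltNge => /negP; apply.
    by rewrite adde_ge0 ?mule_ge0 ?lee_fin// mulr_ge0 ?sqr_ge0// ltW.
  have [r r0 hr] := S_expand (OW _ (FO _ Fx)).
  have [s /= s0 hs] : nbhs_ball x O.
    by apply/nbhs_ballP; apply: open_nbhs_nbhs; split => //; exact: FO.
  have rs0 : 0 < Num.min r s by rewrite lt_min r0.
  have [q [qs _ Pq qb]] := hx _ rs0.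
  have qr : hsquare q `<=` ball x r.
    by apply: (subset_trans qb); apply: le_ball; rewrite ge_min lexx.
  have qO : hsquare q `<=` O.
    by apply: subset_trans hs; apply: (subset_trans qb); apply: le_ball; rewrite ge_min lexx orbT.
  move: Pq; rewrite /P ltNge => /negP; apply.
  apply: (@le_trans _ _ (nu (hsquare q))).
    by apply: le_measure; rewrite ?inE//; exact: measurableI.
  apply: le_trans (nu_small_square r0 hr qs qr) _.
  rewrite (_ : O `&` hsquare q = hsquare q); last exact: setIidr.
  rewrite mu2_hsquare// -EFinM -EFinD lee_fin lerDl.
  by rewrite mulr_ge0 ?sqr_ge0// ltW.
(* The inequality is needed only on the large square [q0], with the weight divided by its area so
   that the total error is [e]. *)
apply/lee_addgt0Pr => e e0.
have N2 : 0 < q0.2 by rewrite /q0/= mulr_gt0.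
have e1 : 0 < e / q0.2 ^+ 2 by rewrite divr_gt0// exprn_gt0.
have := key _ e1 q0 N2.
rewrite (_ : F `&` hsquare q0 = F); last exact: setIidl.
move=> h; apply: (le_trans h); rewrite divfK ?expf_neq0 ?gt_eqF//.
apply: leeD => //; apply: lee_wpmul2l; rewrite ?lee_fin//.
by apply: le_measure; rewrite ?inE//; exact: measurableI.
Qed.

Let mW : measurable (W : set (mplane R)) := open_measurable2 oW.

Let mu2W : (mu2 (W : set (mplane R)) < +oo)%E.
Proof.
have bQ : W `<=` hsquare (- N, - N, 2 * N).
  move=> x /bW; rewrite /ball/= /prod_ball/= /ball/= !sub0r !normrN !ltr_norml.
  move=> [/andP[? ?] /andP[? ?]]; rewrite /hsquare/= !in_itv/=.
  by split; apply/andP; split; lra.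
apply: (@le_lt_trans _ _ (mu2 (hsquare (- N, - N, 2 * N)))).
  by apply: le_measure; rewrite ?inE//; exact: measurable_hsquare.
by rewrite mu2_hsquare ?ltry//= mulr_gt0.
Qed.

(** Regularity is applied to the sum of both measures, so that a single pair of sets F and U
    approximates B for [mu2] on W and for [nu]. The two errors enter as C d + d, whence d = e / (C +
    1). *)
Let nu_le (B : set (mplane R)) : measurable B -> B `<=` W ->
  (nu B <= (4 * L ^+ 2)%:E * mu2 B)%E.
Proof.
move=> mB BW; set C := 4 * L ^+ 2; have C0 : 0 <= C by rewrite mulr_ge0 ?sqr_ge0.
pose m1 : {measure set (mplane R) -> \bar R} := measure_add (mrestr mu2 mW) nu.
have m1E A : m1 A = (mu2 (A `&` W) + nu A)%E by exact: measure_addE.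
have m1fin : (m1 setT < +oo)%E.
  by rewrite m1E setTI; apply: lte_add_pinfty; [exact: mu2W|exact: nu_lt_pinfty].
apply/lee_addgt0Pr => e e0.
pose d := e / (C + 1).
have C10 : 0 < C + 1 by rewrite ltr_wpDl.
have d0 : 0 < d by rewrite divr_gt0.
have [F [U [cF oU FB BU]]] := measurable_regular m1fin mB d0.
rewrite m1E => hd.
have mUF : measurable (U `\` F : set (mplane R)).
  by apply: measurableD; [exact: open_measurable2|exact: closed_measurable2].
have hmu : (mu2 ((U `\` F) `&` W) <= d%:E)%E.
  by apply: le_trans (ltW hd); rewrite leeDl.
have hnu : (nu (U `\` F) <= d%:E)%E.
  by apply: le_trans (ltW hd); rewrite leeDr.
have oUW : open (U `&` W) by exact: openI.
have mUW := open_measurable2 oUW.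
have mF := closed_measurable2 cF.
apply: (@le_trans _ _ (nu F + nu (U `\` F))%E).
  apply: (@le_trans _ _ (nu (F `|` (U `\` F)))%E).
    apply: le_measure; rewrite ?inE//; first exact: measurableU.
    by move=> x /BU Ux; have [Fx|nFx] := pselect (F x); [left|right].
  by rewrite measureU// setDIK.
have h1 : (nu F <= C%:E * mu2 (U `&` W : set (mplane R)))%E.
  apply: nu_closed_le => //.
  by move=> x Fx; split; [exact/BU/FB|exact/BW/FB].
have h2 : (mu2 (U `&` W : set (mplane R)) <= mu2 B + d%:E)%E.
  apply: (@le_trans _ _ (mu2 (B `|` ((U `\` F) `&` W)))%E).
    apply: le_measure; rewrite ?inE//.
      by apply: measurableU => //; exact: measurableI.
    move=> x [Ux Wx]; have [Fx|nFx] := pselect (F x); first by left; exact: FB.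
    by right.
  apply: le_trans (measureU2 _ _ _) _ => //; first exact: measurableI.
  exact: leeD.
apply: le_trans (leeD h1 hnu) _.
apply: (@le_trans _ _ (C%:E * (mu2 B + d%:E) + d%:E)%E).
  by apply: leeD => //; apply: lee_wpmul2l => //; rewrite lee_fin.
have dE : (0 <= d%:E)%E by rewrite lee_fin ltW.
rewrite (ge0_muleDr _ (measure_ge0 mu2 B) dE) -addeA leeD2l//.
rewrite -EFinM -EFinD lee_fin le_eqVlt; apply/orP; left; apply/eqP.
by rewrite /d; field; rewrite gt_eqF.
Qed.

(** The left-hand side is an integral against the push-forward [nu], and domination of [nu] on all
    measurable sets passes to integrals of nonnegative functions. *)
Lemma crude_change_of_variables_total (g : mplane R -> R) :
  (forall x, V x -> W (S x)) -> measurable_fun setT g -> (forall x, 0 <= g x) ->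
  (\int[mu2]_(x in V) (g (S x))%:E <=
    (4 * L ^+ 2)%:E * \int[mu2]_(x in W) (g x)%:E)%E.
Proof.
move=> VW mg g0; have mf := (measurable_EFinP _ _).2 mg.
set f := EFin \o g in mf.
have f0 x : (0 <= f x)%E by rewrite lee_fin.
have C0 : 0 <= 4 * L ^+ 2 by rewrite mulr_ge0 ?sqr_ge0.
pose m2 : {measure set (mplane R) -> \bar R} :=
  mscale (NngNum C0) (mrestr mu2 mW).
have m12 A : measurable A -> (nu A <= m2 A)%E.
  move=> mA; rewrite /m2/= /mscale/= /mrestr/=.
  apply: le_trans (nu_le _ _) => //.
  - rewrite !nuE le_measure ?inE//.
    + apply: measurableI => //; rewrite -[X in measurable X]setTI; exact: mS.
    + apply: measurableI => //; rewrite -[X in measurable X]setTI; apply: mS => //.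
      exact: measurableI.
    + by move=> x [Ax Vx]; split => //; split => //; exact: VW.
  - exact: measurableI.
have mSW : measurable (S @^-1` W : set (mplane R)).
  by rewrite -[X in measurable X]setTI; exact: mS.
have mfS : measurable_fun setT (f \o S) by exact: measurableT_comp.
have -> : (\int[mu2]_(x in V) (g (S x))%:E =
    \int[mrestr mu2 mV]_(x in V) (f \o S) x)%E.
  by apply: eq_measure_integral => A mA AV; rewrite /= /mrestr setIidl.
apply: (@le_trans _ _ (\int[mrestr mu2 mV]_(x in S @^-1` W) (f \o S) x)%E).
  apply: ge0_subset_integral => //.
  - exact: measurable_funS mfS.
  - by move=> x _; exact: f0.
have := @ge0_integral_pushforward _ _ _ _ _ _ mS (mrestr mu2 mV) W f mW
  (measurable_funS measurableT (@subsetT _ _) mf) (fun y _ => f0 y).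
move=> <-.
apply: le_trans (ge0_le_measure_integral m12 mW f0 mf) _.
have -> : (\int[m2]_(x in W) f x =
    (4 * L ^+ 2)%:E * \int[mrestr mu2 mW]_(x in W) f x)%E.
  apply: (@ge0_integral_mscale _ _ _ (mrestr mu2 mW) W mW (NngNum C0) f).
    by apply: measurable_funS mf.
  by move=> x _; exact: f0.
have -> : (\int[mrestr mu2 mW]_(x in W) f x = \int[mu2]_(x in W) f x)%E.
  by apply: eq_measure_integral => A mA AV; rewrite /= /mrestr setIidl.
exact: lexx.
Qed.

End CrudeChangeOfVariables.

(* A one-sided substitution rule without Jacobian: S only has to expand lengths
   locally, and the constant is far from optimal. *)
Lemma crude_change_of_variables (R : realType) (V W : set (plane R))
    (S : plane R -> plane R) (L N : R) (g : mplane R -> R) :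
  measurable (V : set (mplane R)) -> (mu2 (V : set (mplane R)) < +oo)%E ->
  measurable_fun (V : set (mplane R)) (fst \o S) ->
  measurable_fun (V : set (mplane R)) (snd \o S) ->
  open W -> 0 < L -> 0 < N -> W `<=` ball (0, 0) N ->
  (forall x, W x -> exists2 r : R, 0 < r &
    forall a b, V a -> V b -> ball x r (S a) -> ball x r (S b) ->
      `|a - b| <= L * `|S a - S b|) ->
  (forall x, V x -> W (S x)) -> measurable_fun setT g -> (forall x, 0 <= g x) ->
  (\int[mu2]_(x in V) (g (S x))%:E <=
    (4 * L ^+ 2)%:E * \int[mu2]_(x in W) (g x)%:E)%E.
Proof.
move=> mV Vfin m1 m2 oW L0 N0 bW hS VW mg g0.
(* Extending S by 0 outside V gives a measurable map of the whole plane without changing either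
   side. *)
pose S' (x : plane R) : plane R := (((fst \o S) \_ V) x, ((snd \o S) \_ V) x).
have S'E x : V x -> S' x = S x.
  by move=> Vx; rewrite /S' !patchE mem_set//= -surjective_pairing.
have mS' : measurable_fun setT (S' : mplane R -> mplane R).
  by apply: measurable_fun_pair; apply/(measurable_restrictT _ mV).
have -> : (\int[mu2]_(x in V) (g (S x))%:E = \int[mu2]_(x in V) (g (S' x))%:E)%E.
  by apply: eq_integral => x; rewrite inE => Vx; rewrite S'E.
apply: (crude_change_of_variables_total mV mS' oW L0 N0 bW Vfin) => //.
  move=> x Wx; have [r r0 hr] := hS x Wx; exists r => // a b Va Vb.
  by rewrite !S'E//; exact: hr.
by move=> x Vx; rewrite S'E//; exact: VW.
Qed.

(** * Density in L2 *)

Section SquareIntegral.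
Context {R : realType}.
Implicit Types (D : set (mplane R)) (f g h : mplane R -> R).

Definition sqint D f : \bar R := (\int[mu2]_(x in D) (f x ^+ 2)%:E)%E.

Lemma sqint_ge0 D f : (0 <= sqint D f)%E.
Proof. by apply: integral_ge0 => x _; rewrite lee_fin sqr_ge0. Qed.

Lemma measurable_sqr D f : measurable_fun D f ->
  measurable_fun D (fun x => (f x ^+ 2)%:E).
Proof. by move=> mf; apply/measurable_EFinP; exact: measurable_funX. Qed.

Lemma sqint_le D f g : measurable D -> measurable_fun D f -> measurable_fun D g ->
  (forall x, D x -> `|f x| <= `|g x|) -> (sqint D f <= sqint D g)%E.
Proof.
move=> mD mf mg fg; apply: ge0_le_integral => //.
- by move=> x _; rewrite lee_fin sqr_ge0.
- exact: measurable_sqr.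
- exact: measurable_sqr.
- move=> x Dx; rewrite lee_fin -[f x ^+ 2]ger0_norm ?sqr_ge0//.
  rewrite -[g x ^+ 2]ger0_norm ?sqr_ge0// !normrX lerXn2r ?nnegrE//.
  exact: fg.
Qed.

Lemma sqintZ D f (k : R) : measurable D -> measurable_fun D f ->
  sqint D (fun x => k * f x) = ((k ^+ 2)%:E * sqint D f)%E.
Proof.
move=> mD mf; rewrite /sqint.
under eq_integral do rewrite exprMn EFinM.
apply: ge0_integralZl_EFin => //; last by rewrite sqr_ge0.
- by move=> x _; rewrite lee_fin sqr_ge0.
- exact: measurable_sqr.
Qed.

(** Integrates (a + b)^2 <= 2 a^2 + 2 b^2. It stands in for the triangle inequality, so that no
    roots of integrals are needed in limit arguments. *)
Lemma sqintD_le D f g h : measurable D -> measurable_fun D f ->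
  measurable_fun D g -> measurable_fun D h ->
  (forall x, D x -> `|f x| <= `|g x| + `|h x|) ->
  (sqint D f <= 2%:E * sqint D g + 2%:E * sqint D h)%E.
Proof.
move=> mD mf mg mh fgh; rewrite /sqint.
have h0 (u : mplane R -> R) : forall x, D x -> (0 <= (u x ^+ 2)%:E)%E.
  by move=> x _; rewrite lee_fin sqr_ge0.
have p2 : 0 <= 2 :> R by [].
rewrite -(@ge0_integralZl_EFin _ _ _ mu2 D mD _ (h0 g) (measurable_sqr mg) _ p2).
rewrite -(@ge0_integralZl_EFin _ _ _ mu2 D mD _ (h0 h) (measurable_sqr mh) _ p2).
rewrite -ge0_integralD//; first last.
- by apply: measurable_funeM; exact: measurable_sqr.
- by move=> x Dx; rewrite -EFinM lee_fin mulr_ge0 ?sqr_ge0.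
- by apply: measurable_funeM; exact: measurable_sqr.
- by move=> x Dx; rewrite -EFinM lee_fin mulr_ge0 ?sqr_ge0.
apply: ge0_le_integral => //.
- exact: h0.
- exact: measurable_sqr.
- by apply: emeasurable_funD; apply: measurable_funeM; exact: measurable_sqr.
- move=> x Dx; rewrite -!EFinM -EFinD lee_fin.
  have := fgh x Dx; have := normr_ge0 (f x).
  have := sqr_ge0 (`|g x| - `|h x|).
  rewrite -(real_normK (num_real (f x))) -(real_normK (num_real (g x))).
  rewrite -(real_normK (num_real (h x))).
  move: `|f x| `|g x| `|h x| => a b c; nra.
Qed.

End SquareIntegral.

Section Density.
Context {R : realType}.

(** Lipschitz rather than merely continuous: the mollification error is then at most L times the
    radius, and truncated distance functions provide enough examples. *)
Definition lipschitz_supp (phi : plane R -> R) :=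
  (exists L : R, forall x y, `|phi x - phi y| <= L * `|x - y|) /\
  (exists N : R, forall x, N <= `|x| -> phi x = 0).

Lemma lipschitz_supp_continuous phi : lipschitz_supp phi -> continuous phi.
Proof.
move=> [[L hL] _] x; apply/cvgrPdist_lt => e e0.
have L1 : 0 < `|L| + 1 by rewrite ltr_wpDl.
have d0 : 0 < e / (`|L| + 1) by rewrite divr_gt0.
near=> y.
have xy : `|x - y| < e / (`|L| + 1).
  by near: y; apply: (@cvgr_dist_lt _ _ _ _ _ id x) => //; exact: cvg_id.
apply: le_lt_trans (hL x y) _.
apply: (@le_lt_trans _ _ ((`|L| + 1) * `|x - y|)).
  by rewrite ler_wpM2r//; apply: le_trans (ler_norm _) _; rewrite lerDl.
by rewrite mulrC -ltr_pdivlMr.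
Unshelve. all: by end_near. Qed.

Lemma lipschitz_supp0 : lipschitz_supp (fun=> 0).
Proof.
by split; exists 0 => // x y; rewrite subrr normr0 mul0r.
Qed.

Lemma lipschitz_suppD phi psi : lipschitz_supp phi -> lipschitz_supp psi ->
  lipschitz_supp (fun x => phi x + psi x).
Proof.
move=> [[L hL] [N hN]] [[L' hL'] [N' hN']]; split.
  exists (L + L') => x y; rewrite mulrDl opprD addrACA.
  by apply: le_trans (ler_normD _ _) _; exact: lerD.
by exists (Num.max N N') => x; rewrite ge_max => /andP[? ?]; rewrite hN// hN'// addr0.
Qed.

Lemma lipschitz_suppZ (k : R) phi : lipschitz_supp phi ->
  lipschitz_supp (fun x => k * phi x).
Proof.
move=> [[L hL] [N hN]]; split.
  exists (`|k| * L) => x y; rewrite -mulrBr normrM -mulrA.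
  by apply: ler_wpM2l => //; exact: hL.
by exists N => x /hN ->; rewrite mulr0.
Qed.

Definition L2_approx (f : mplane R -> R) := measurable_fun setT f /\
  forall e : R, 0 < e -> exists2 phi, lipschitz_supp phi &
    (sqint setT (fun x => (f x - phi x)%R) <= e%:E)%E.

Lemma L2_approxZ (k : R) f : L2_approx f -> L2_approx (fun x => k * f x).
Proof.
move=> [mf hf]; split; first exact: measurable_funM.
move=> e e0; have k1 : 0 < k ^+ 2 + 1 by rewrite ltr_wpDl ?sqr_ge0.
have [phi hphi hle] := hf (e / (k ^+ 2 + 1)) (divr_gt0 e0 k1).
exists (fun x => k * phi x); first exact: lipschitz_suppZ.
have mphi := continuous_measurable_fun2 (D := setT) (lipschitz_supp_continuous hphi).
have -> : (fun x => k * f x - k * phi x) = (fun x => k * (f x - phi x)).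
  by apply/funext => x; rewrite mulrBr.
rewrite sqintZ//; last exact: measurable_funB.
apply: (@le_trans _ _ ((k ^+ 2)%:E * (e / (k ^+ 2 + 1))%:E)%E).
  by apply: lee_wpmul2l => //; rewrite lee_fin sqr_ge0.
rewrite -EFinM lee_fin mulrA ler_pdivrMr// mulrC.
by rewrite ler_wpM2l ?lerDl ?ltW.
Qed.

Lemma L2_approx_lim (f : mplane R -> R) : measurable_fun setT f ->
  (forall e : R, 0 < e -> exists2 g, L2_approx g &
    (sqint setT (fun x => (f x - g x)%R) <= e%:E)%E) -> L2_approx f.
Proof.
move=> mf h; split => // e e0.
have e4 : 0 < e / 4 by rewrite divr_gt0.
have [g [mg hg] fg] := h _ e4.
have [phi hphi gphi] := hg _ e4.
have mphi := continuous_measurable_fun2 (D := setT) (lipschitz_supp_continuous hphi).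
exists phi => //.
apply: le_trans (sqintD_le (g := fun x => f x - g x) (h := fun x => g x - phi x) _ _ _ _ _) _ => //.
- exact: measurable_funB.
- exact: measurable_funB.
- exact: measurable_funB.
- move=> x _; rewrite (_ : f x - phi x = (f x - g x) + (g x - phi x)) ?ler_normD//.
  by rewrite addrA subrK.
apply: (@le_trans _ _ (2%:E * (e / 4)%:E + 2%:E * (e / 4)%:E)%E).
  by apply: leeD; apply: lee_wpmul2l; rewrite ?lee_fin.
by rewrite -!EFinM -EFinD lee_fin; lra.
Qed.

Lemma L2_approxD f g : L2_approx f -> L2_approx g -> L2_approx (fun x => f x + g x).
Proof.
move=> [mf hf] [mg hg]; split; first exact: measurable_funD.
move=> e e0; have e4 : 0 < e / 4 by rewrite divr_gt0.
have [phi hphi fphi] := hf _ e4.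
have [psi hpsi gpsi] := hg _ e4.
have mphi := continuous_measurable_fun2 (D := setT) (lipschitz_supp_continuous hphi).
have mpsi := continuous_measurable_fun2 (D := setT) (lipschitz_supp_continuous hpsi).
exists (fun x => phi x + psi x); first exact: lipschitz_suppD.
apply: le_trans (sqintD_le (g := fun x => f x - phi x) (h := fun x => g x - psi x) _ _ _ _ _) _ => //.
- by apply: measurable_funB; exact: measurable_funD.
- exact: measurable_funB.
- exact: measurable_funB.
- by move=> x _; rewrite opprD addrACA ler_normD.
apply: (@le_trans _ _ (2%:E * (e / 4)%:E + 2%:E * (e / 4)%:E)%E).
  by apply: leeD; apply: lee_wpmul2l; rewrite ?lee_fin.
by rewrite -!EFinM -EFinD lee_fin; lra.
Qed.

Lemma L2_approx0 : L2_approx (fun=> 0).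
Proof.
split; first exact: measurable_cst.
move=> e e0; exists (fun=> 0); first exact: lipschitz_supp0.
rewrite /sqint; under eq_integral do rewrite subrr expr0n.
by rewrite integral0 lee_fin ltW.
Qed.

Lemma L2_approx_sum (I : Type) (s : seq I) (F : I -> mplane R -> R) :
  (forall i, L2_approx (F i)) -> L2_approx (fun x => \sum_(i <- s) F i x).
Proof.
move=> hF; elim: s => [|i s IH].
  under eq_fun do rewrite big_nil; exact: L2_approx0.
by under eq_fun do rewrite big_cons; exact: L2_approxD.
Qed.

Implicit Types (A : set (plane R)) (x y : plane R).

Definition setdist (A : set (plane R)) (x : plane R) : R :=
  inf [set `|x - y| | y in A].

Let setdist_lb A x : lbound [set `|x - y| | y in A] 0.
Proof. by move=> _ [y _ <-]. Qed.

Lemma setdist_ge0 A x : A !=set0 -> 0 <= setdist A x.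
Proof.
move=> [a Aa]; apply: lb_le_inf; first by exists `|x - a|; exists a.
exact: setdist_lb.
Qed.

Lemma setdist_le A x y : A y -> setdist A x <= `|x - y|.
Proof. by move=> Ay; apply: ge_inf; [exists 0; exact: setdist_lb|exists y]. Qed.

Lemma setdist_lip A x y : A !=set0 -> setdist A x <= setdist A y + `|x - y|.
Proof.
move=> [a Aa]; rewrite -lerBlDr; apply: lb_le_inf; first by exists `|y - a|; exists a.
move=> _ [b Ab <-]; rewrite lerBlDr; apply: le_trans (setdist_le x Ab) _.
by rewrite [leRHS]addrC; exact: ler_distD.
Qed.

Lemma setdist_lip_norm A x y : A !=set0 -> `|setdist A x - setdist A y| <= `|x - y|.
Proof.
move=> A0; rewrite ler_norml; apply/andP; split.
  by rewrite lerNl opprB lerBlDr addrC distrC; exact: setdist_lip.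
by rewrite lerBlDr addrC; exact: setdist_lip.
Qed.

Lemma setdist_gt0 (A : set (plane R)) x : closed A -> A !=set0 -> ~ A x -> 0 < setdist A x.
Proof.
move=> cA A0 nAx.
have /nbhs_ballP[r /= r0 hr] : nbhs x (~` A).
  by apply: open_nbhs_nbhs; split => //; exact: closed_openC.
have [a Aa] := A0.
apply: (lt_le_trans r0); apply: lb_le_inf; first by exists `|x - a|; exists a.
move=> _ [b Ab <-]; rewrite leNgt; apply/negP => xb.
by apply: (hr b) => //; rewrite -ball_normE.
Qed.

(** Outer regularity gives an open U around B with little excess area. The functions min(1, (n+1)
    dist(., complement of U)) vanish outside U and differ from 1 inside U only on sets that decrease
    to the empty set, because the distance is positive on U. *)
Lemma L2_approx_indic (B : set (mplane R)) (N : R) : 0 < N -> measurable B ->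
  B `<=` ball ((0, 0) : plane R) N -> L2_approx \1_B.
Proof.
move=> N0 mB BN; split; first exact: measurable_indic.
move=> e e0.
have oN : open (ball ((0, 0) : plane R) N) by exact: ball_open.
have mN := open_measurable2 oN.
pose m : {measure set (mplane R) -> \bar R} := mrestr mu2 mN.
have NQ : ball ((0, 0) : plane R) N `<=` hsquare (- N, - N, 2 * N).
  move=> x; rewrite /ball/= /prod_ball/= /ball/= !sub0r !normrN !ltr_norml.
  move=> [/andP[? ?] /andP[? ?]]; rewrite /hsquare/= !in_itv/=.
  by split; apply/andP; split; lra.
have mfin : (m setT < +oo)%E.
  rewrite /m/= /mrestr setTI.
  apply: (@le_lt_trans _ _ (mu2 (hsquare (- N, - N, 2 * N)))).
    by apply: le_measure; rewrite ?inE//; exact: measurable_hsquare.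
  by rewrite mu2_hsquare ?ltry//= mulr_gt0.
have e2 : 0 < e / 2 by rewrite divr_gt0.
have [F [U0 [cF oU0 FB BU0 hm]]] := measurable_regular mfin mB e2.
pose U := U0 `&` ball ((0, 0) : plane R) N.
have oU : open U by exact: openI.
have mU := open_measurable2 oU.
have mUB : measurable (U `\` B : set (mplane R)) by exact: measurableD.
have hUB : (mu2 (U `\` B : set (mplane R)) <= (e / 2)%:E)%E.
  apply: le_trans (ltW hm); rewrite /m/= /mrestr; apply: le_measure; rewrite ?inE//.
    apply: measurableI => //; apply: measurableD; first exact: open_measurable2.
    exact: closed_measurable2.
  by move=> x [[U0x Nx] nBx]; split => //; split => // /FB.
pose A := ~` U.
(* The distance is an infimum, so the complement must be nonempty; U being bounded, an explicit far
   point does. *)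
have A0 : A !=set0.
  exists (N + 1, 0); rewrite /A/U/= => -[_]; rewrite /ball/= /prod_ball/= /ball/= => -[+ _].
  by rewrite sub0r normrN gtr0_norm; lra.
have cA : closed A by exact: open_closedC.
pose phi n x := Num.min 1 (n.+1%:R * setdist A x).
have phi01 n x : 0 <= phi n x <= 1.
  by rewrite /phi le_min ler01 ge_min lexx mulr_ge0//= setdist_ge0.
have phiU n x : ~ U x -> phi n x = 0.
  move=> nUx; have /eqP : setdist A x <= 0.
    by have := @setdist_le A x x nUx; rewrite subrr normr0.
  have := setdist_ge0 x A0; rewrite /phi => h0 h1.
  have -> : setdist A x = 0 by apply/eqP; rewrite eq_le h0 andbT; apply/eqP.
  by rewrite mulr0 min_r.
have phil n : lipschitz_supp (phi n).
  split.
    exists n.+1%:R => x y.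
    have hle : `|n.+1%:R * setdist A x - n.+1%:R * setdist A y| <= n.+1%:R * `|x - y|.
      by rewrite -mulrBr normrM ger0_norm//; apply: ler_wpM2l => //; exact: setdist_lip_norm.
    apply: le_trans hle; rewrite /phi.
    move: (_ * setdist A x) (_ * setdist A y) => a b.
    by rewrite /Num.min; case: ltP => ?; case: ltP => ?; rewrite ler_norml;
      case: (ger0P (a - b)) => ?; apply/andP; split; lra.
  exists N => x Nx; apply: phiU => -[_]; rewrite -ball_normE/= /ball_/=.
  by rewrite (_ : (0, 0) = 0 :> plane R)// sub0r normrN ltNge Nx.
pose Fn n := [set x | n.+1%:R * setdist A x < 1] `&` U.
have mphi n : measurable_fun [set: mplane R] (phi n).
  exact: continuous_measurable_fun2 (lipschitz_supp_continuous (phil n)).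
have mFn n : measurable (Fn n : set (mplane R)).
  apply: measurableI => //.
  have -> : [set x | n.+1%:R * setdist A x < 1] = setT `&` phi n @^-1` `]-oo, 1[.
    apply/seteqP; split => x /=; rewrite ?in_itv/= /phi gt_min ltxx//=.
    by move=> [].
  by apply: mphi => //; exact: measurable_itv.
have Fni : nonincreasing_seq Fn.
  move=> i j ij; apply/subsetPset => x [/= h Ux]; split => //=; apply: le_lt_trans h.
  by rewrite ler_wpM2r ?setdist_ge0// ler_nat ltnS.
have F0 : \bigcap_n Fn n = set0.
  apply/seteqP; split => // x hx.
  have [_ Ux] := hx 0%N I.
  have d0 : 0 < setdist A x by apply: setdist_gt0 => //; exact.
  have [+ _] := hx (Num.bound (setdist A x)^-1) I; rewrite /= ltNge => /negP; apply.
  rewrite -ler_pdivrMr// div1r; apply: ltW.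
  apply: lt_le_trans (archi_boundP _) _; first by rewrite invr_ge0 ltW.
  by rewrite ler_nat.
have mF0 : measurable (\bigcap_n (Fn n : set (mplane R))) by exact: bigcapT_measurable.
have F0fin : (mu2 (Fn 0%N : set (mplane R)) < +oo)%E.
  apply: le_lt_trans mfin; rewrite /m/= /mrestr setTI; apply: le_measure; rewrite ?inE//.
  by move=> x [_ []].
have := nonincreasing_cvg_mu F0fin mFn mF0 Fni.
rewrite F0 measure0 => cvg.
have he : (0 < (e / 2)%:E)%E by rewrite lte_fin.
have [n /= hn] := cvg_lt_exists cvg he.
exists (phi n) => //.
have mE : measurable ((U `\` B) `|` Fn n : set (mplane R)) by exact: measurableU.
apply: (@le_trans _ _ (\int[mu2]_x (\1_((U `\` B) `|` Fn n : set (mplane R)) x)%:E)%E).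
  apply: ge0_le_integral => //.
  - by move=> x _; rewrite lee_fin sqr_ge0.
  - by apply: measurable_sqr; apply: measurable_funB => //; exact: measurable_indic.
  - by apply/measurable_EFinP; exact: measurable_indic.
  - move=> x _; rewrite lee_fin !indicE.
    have /andP[p0 p1] := phi01 n x.
    have [Ux|nUx] := pselect (U x); last first.
      rewrite (phiU n x nUx) subr0 (_ : x \in B = false) ?expr0n//=.
      by apply/negbTE; rewrite notin_setE => Bx; apply: nUx; split; [exact: BU0|exact: BN].
    have [Bx|nBx] := pselect (B x); last first.
      rewrite [x \in B](_ : _ = false); last by apply/negbTE; rewrite notin_setE.
      rewrite mem_set; last by left.
      by rewrite sub0r sqrrN expr_le1.
    rewrite [x \in B]mem_set//.
    have [h|h] := ltP (n.+1%:R * setdist A x) 1.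
      rewrite mem_set; last by right.
      by rewrite !mulr1n expr_le1//; lra.
    by rewrite /phi min_l// subrr expr0n.
rewrite integral_indic// setIT.
apply: le_trans (measureU2 _ _ _) _ => //.
apply: le_trans (leeD hUB (ltW hn)) _.
by rewrite -EFinD lee_fin; lra.
Qed.

Import HBNNSimple.

(** Simple functions increase to [f], and f^2 dominates the squared errors, so dominated convergence
    reduces the claim to indicators. *)
Lemma L2_approx_nneg (f : mplane R -> R) (N : R) : 0 < N ->
  measurable_fun setT f -> (forall x, 0 <= f x) ->
  (forall x, ~ ball ((0, 0) : plane R) N x -> f x = 0) ->
  (sqint setT f < +oo)%E -> L2_approx f.
Proof.
move=> N0 mf f0 fN ff.
have mfE : measurable_fun setT (EFin \o f) by exact/measurable_EFinP.
pose g := nnsfun_approx measurableT mfE.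
have gcvg (x : mplane R) : g n x @[n --> \oo] --> f x.
  have : (g n x)%:E @[n --> \oo] --> (EFin \o f) x.
    by apply: cvg_nnsfun_approx => // y _; rewrite lee_fin.
  by move=> /fine_cvgP[_]; apply: cvg_trans; apply: near_eq_cvg; exact: nearW.
have gf n (x : mplane R) : g n x <= f x.
  have nd : nondecreasing_seq (fun n => g n x).
    by move=> i j ij; have /lefP := nd_nnsfun_approx measurableT mfE ij; exact.
  have := nondecreasing_cvgn_le nd (cvgP _ (gcvg x)) n.
  by rewrite (cvg_lim _ (gcvg x)).
have g0 n (x : mplane R) : 0 <= g n x by [].
apply: L2_approx_lim => // e e0.
have mg n : measurable_fun setT (g n) by [].
have [] := @dominated_convergence _ _ _ (@mu2 R) setT measurableT
    (fun n x => ((f x - g n x) ^+ 2)%:E) (cst 0%E) (fun x => (f x ^+ 2)%:E).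
- by move=> n; apply: measurable_sqr; exact: measurable_funB.
- exact: measurable_cst.
- apply: aeW => x _ /=.
  apply: cvg_EFin; first exact: nearW.
  rewrite /comp/= (_ : 0 = (f x - f x) ^+ 2); last by rewrite subrr expr0n.
  have : (f x - g n x) * (f x - g n x) @[n --> \oo] --> (f x - f x) * (f x - f x).
    by apply: cvgM; apply: cvgB => //; exact: cvg_cst.
  by under eq_fun do rewrite -expr2.
- apply/integrableP; split; first exact: measurable_sqr.
  rewrite (_ : (\int[_]_(_ in _) _)%E = sqint setT f)//.
  by apply: eq_integral => x _; rewrite gee0_abs// lee_fin sqr_ge0.
- apply: aeW => x n _; rewrite gee0_abs ?lee_fin ?sqr_ge0//.
  by rewrite lerXn2r ?nnegrE ?subr_ge0 ?f0// lerBlDr lerDl g0.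
move=> _ _.
rewrite (_ : (\int[_]_(_ in _) _)%E = 0%E) => [cvg|]; last by rewrite integral0.
have he : (0 < e%:E)%E by rewrite lte_fin.
have [n /= hn] := cvg_lt_exists cvg he.
exists (g n); last exact: ltW.
have -> : (g n : mplane R -> R) = fun x =>
    \sum_(y <- finmap.enum_fset (fset_set (range (g n)))) (y * \1_(g n @^-1` [set y]) x).
  by apply/funext => x; rewrite [LHS]fimfunE fsbig_finite.
apply: L2_approx_sum => y.
(* The level set of the value 0 may be unbounded but contributes nothing. The others lie in the
   ball, since 0 <= g n <= f and f vanishes outside it. *)
have [->|y0] := eqVneq y 0.
  under eq_fun do rewrite mul0r; exact: L2_approx0.
apply: L2_approxZ; apply: (L2_approx_indic N0) => //.
move=> x /= gx; apply: contrapT => nNx.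
have := gf n x; rewrite fN// gx => yle.
have := g0 n x; rewrite gx => yge.
by move: y0; rewrite eq_le yle yge.
Qed.

Lemma L2_density (f : mplane R -> R) (N : R) : 0 < N -> measurable_fun setT f ->
  (forall x, ~ ball ((0, 0) : plane R) N x -> f x = 0) ->
  (sqint setT f < +oo)%E -> L2_approx f.
Proof.
move=> N0 mf fN ff.
pose fp x := Num.max (f x) 0; pose fm x := Num.max (- f x) 0.
have mfp : measurable_fun setT fp by exact: measurable_maxr.
have mfm : measurable_fun setT fm.
  by apply: measurable_maxr => //; exact: measurableT_comp.
have -> : f = fun x => fp x + (-1) * fm x.
  apply/funext => x; rewrite /fp /fm /Num.max.
  by case: ltP => ?; case: ltP => ?; lra.
apply: L2_approxD; last apply: L2_approxZ; apply: (L2_approx_nneg N0) => //.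
- by move=> x; rewrite /fp le_max lexx orbT.
- by move=> x /fN h; rewrite /fp h maxxx.
- apply: le_lt_trans ff; apply: sqint_le => // x _; rewrite /fp /Num.max.
  by case: ltP => ?; rewrite ?normr0.
- by move=> x; rewrite /fm le_max lexx orbT.
- by move=> x /fN h; rewrite /fm h oppr0 maxxx.
- apply: le_lt_trans ff; apply: sqint_le => // x _; rewrite /fm /Num.max.
  by case: ltP => ?; rewrite ?normr0// normrN.
Qed.

End Density.

(** * Mollification *)

Section FlatFunction.
Context {R : realType}.

(* Polynomials in 1/s times exp(-1/s): a family closed under differentiation. *)
Definition flat (P : {poly R}) (s : R) : R :=
  if 0 < s then P.[s^-1] * expR (- s^-1) else 0.

Lemma monomial_expR_le (n : nat) (t : R) : 0 < t -> t ^+ n * expR (- t) <= n`!%:R.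
Proof.
move=> t0; rewrite expRN ler_pdivrMr ?expR_gt0//.
case: n => [|n]; first by rewrite expr0 mul1r ltW// expR_gt1.
rewrite mulrC -ler_pdivrMr ?ltr0n ?fact_gt0//.
by apply: le_trans (expR_ge1Dxn n (ltW t0)); rewrite lerDr.
Qed.

Lemma poly_expR_bounded (P : {poly R}) :
  exists2 C : R, 0 <= C & forall t, 0 < t -> `|P.[t] * expR (- t)| <= C.
Proof.
exists (\sum_(i < size P) `|P`_i| * i`!%:R).
  by apply: sumr_ge0 => i _; rewrite mulr_ge0.
move=> t t0; rewrite horner_coef mulr_suml.
apply: le_trans (ler_norm_sum _ _ _) _; apply: ler_sum => i _.
rewrite -mulrA normrM ler_wpM2l// ger0_norm ?monomial_expR_le//.
by rewrite mulr_ge0 ?exprn_ge0 ?expR_ge0// ltW.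
Qed.

(** The bound on the bounded function t^2 P(t) exp(-t) at t = 1/s. Quadratic smallness at 0 is what
    makes the difference quotient there vanish. *)
Lemma flat_le_sqr (P : {poly R}) :
  exists2 C : R, 0 <= C & forall s, `|flat P s| <= C * s ^+ 2.
Proof.
have [C C0 hC] := poly_expR_bounded ('X^2 * P).
exists C => // s; rewrite /flat; case: ifP => [s0|_]; last first.
  by rewrite normr0 mulr_ge0 ?sqr_ge0.
have := hC s^-1; rewrite invr_gt0 => /(_ s0).
rewrite hornerM hornerXn -mulrA normrM exprVn normfV (ger0_norm (sqr_ge0 s)).
by rewrite mulrC ler_pdivrMr// exprn_gt0.
Qed.

(** For s > 0 the derivative of P(1/s) exp(-1/s) is s^-2 (P - P')(1/s) exp(-1/s), again of the same
    form with polynomial X^2 (P - P'). *)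
Lemma flat_is_derive (P : {poly R}) (s : R) :
  is_derive s (1 : R) (flat P : R -> R) (flat ('X^2 * (P - P^`())) s).
Proof.
have [s0|s0|->] := ltgtP s 0.
- have -> : flat ('X^2 * (P - P^`())) s = 0 by rewrite /flat ltNge (ltW s0).
  apply: (@near_eq_is_derive _ _ _ (cst (0 : R))).
  near=> y; rewrite /flat ltNge [y <= 0](_ : _ = true)//; apply/ltW.
  by near: y; exact: lt_nbhsl.
- pose h (y : R) := P.[y^-1] * expR (- y^-1).
  apply: (@near_eq_is_derive _ _ _ h).
    near=> y; rewrite /flat /h [0 < y](_ : _ = true)//.
    by near: y; exact: lt_nbhsr.
  have sn : s != 0 by rewrite gt_eqF.
  have d1 : is_derive s 1 (fun y : R => y^-1) (- s ^- 2).
    apply: (is_derive_eq (is_deriveV (f := id) sn (is_derive_id s 1))).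
    exact: mulr1.
  have d2 : is_derive s 1 (fun y : R => - y^-1) (s ^- 2).
    by apply: is_derive_eq; rewrite opprK.
  have d3 := @is_derive1_comp _ expR (fun y : R => - y^-1) s _ _ (is_derive_expR _) d2.
  have d4 := @is_derive1_comp _ (horner P) (fun y : R => y^-1) s _ _ (is_derive_poly P _) d1.
  have d5 := is_deriveM d4 d3.
  apply: (is_derive_eq d5).
  change (P.[s^-1] * (expR (- s^-1) * s ^- 2) +
    expR (- s^-1) * ((P^`()).[s^-1] * - s ^- 2) = flat ('X^2 * (P - P^`())) s).
  rewrite /flat s0 hornerM hornerXn hornerD hornerN -exprVn.
  move: (expR (- s^-1)) => a; move: (P.[s^-1]) => b.
  move: ((P^`()).[s^-1]) => c; ring.
- have -> : flat ('X^2 * (P - P^`())) 0 = 0 by rewrite /flat ltxx.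
  have [C C0 hC] := flat_le_sqr P.
  have f0 : flat P 0 = 0 by rewrite /flat ltxx.
  have cvg : h^-1 *: ((flat P \o shift (0 : R)) (h *: (1 : R)) - flat P 0)
      @[h --> (0 : R)^'] --> (0 : R).
    apply/cvgrPdist_le => e e0; near=> h.
    rewrite /= sub0r normrN addr0 f0 subr0 /GRing.scale/= mulr1 normrM normfV.
    have hn : h != 0 by near: h; exact: nbhs_dnbhs_neq.
    rewrite mulrC ler_pdivrMr ?normr_gt0//; apply: (le_trans (hC h)).
    rewrite -(real_normK (num_real h)) expr2 mulrA ler_wpM2r//.
    have h1 : `|h| <= e / (C + 1).
      near: h; apply: nbhs_dnbhs; apply/nbhs_ballP.
      exists (e / (C + 1)) => /=; first by rewrite divr_gt0// ltr_wpDl.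
      by move=> y; rewrite /ball/= sub0r normrN => /ltW.
    apply: (@le_trans _ _ (C * (e / (C + 1)))); first exact: ler_wpM2l.
    rewrite mulrCA ger_pMr// ler_pdivrMr ?ltr_wpDl//; lra.
  apply: DeriveDef; first by apply/cvg_ex; exists 0; exact: cvg.
  exact: cvg_lim cvg.
Unshelve. all: by end_near. Qed.

Lemma flat1_gt0 (s : R) : 0 < s -> 0 < flat 1 s.
Proof. by move=> s0; rewrite /flat s0 hornerE mul1r expR_gt0. Qed.

Lemma flat1_ge0 (s : R) : 0 <= flat 1 s.
Proof.
by have [/flat1_gt0/ltW//|s0] := ltP 0 s; rewrite /flat ltNge s0.
Qed.

End FlatFunction.

(** * Smooth functions of two variables *)

Section Smooth2.
Context {R : realType}.
Implicit Types (f g : plane R -> R^o) (x v : plane R).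

Definition smooth2 f := forall k, Ck_on k setT f.

Lemma smooth2_partial f l : smooth2 f -> smooth2 (partial l f).
Proof. by move=> sf k; have [_] := sf k.+1; exact. Qed.

Lemma smooth2_differentiable f x : smooth2 f -> differentiable f x.
Proof. by move=> sf; have [+ _] := sf 1%N; exact. Qed.

Lemma smooth2_continuous f : smooth2 f -> continuous f.
Proof. by move=> sf x; exact: (sf 0%N). Qed.

(** Coinduction for smoothness: a class of continuous, differentiable functions that is stable under
    partial derivatives contains only smooth functions. *)
Lemma smooth2_ind (P : (plane R -> R^o) -> Prop) :
  (forall f, P f -> continuous f) ->
  (forall f x, P f -> differentiable f x) ->
  (forall f l, P f -> P (partial l f)) -> forall f, P f -> smooth2 f.
Proof.
move=> h0 h1 h2 f Pf k; elim: k f Pf => [|k IH] f Pf /=.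
  by move=> x _; exact: h0.
by split => [x _|l]; [exact: h1|apply: IH; exact: h2].
Qed.

Lemma smooth2M f g : smooth2 f -> smooth2 g -> smooth2 (f * g).
Proof.
move=> sf sg k; elim: k f g sf sg => [|k IH] f g sf sg /=.
  by move=> x _; apply: cvgM; exact: smooth2_continuous.
split => [x _|l].
  by apply: differentiableM; exact: smooth2_differentiable.
(* By the product rule a derivative is a sum of two products. The induction hypothesis handles each
   product, and an inner induction on the order handles the sum. *)
suff -> : partial l (f * g) = f * partial l g + g * partial l f.
  have h1 := IH _ _ sf (smooth2_partial l sg).
  have h2 := IH _ _ sg (smooth2_partial l sf).
  move: (f * partial l g) (g * partial l f) h1 h2 => {IH sf sg f g} f g.
  elim: k f g => [|k IH] f g /=.
    by move=> h1 h2 x _; apply: cvgD; [exact: h1|exact: h2].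
  move=> [d1 h1] [d2 h2]; split => [x _|m].
    by apply: differentiableD; [exact: d1|exact: d2].
  rewrite (_ : partial m (f + g) = partial m f + partial m g); first exact: IH.
  by apply/funext => x; rewrite /partial deriveD//; apply: diff_derivable; [exact: d1|exact: d2].
apply/funext => x; rewrite /partial deriveM//; apply: diff_derivable; exact: smooth2_differentiable.
Qed.

Lemma smooth2Z (c : R) f : smooth2 f -> smooth2 (c \*: f).
Proof.
move=> sf.
apply: (smooth2_ind (P := fun h => exists2 f, smooth2 f & h = c \*: f)); last by exists f.
- by move=> _ [g sg ->] x; apply: differentiable_continuous; exact: (@differentiableZ _ _ _ g c x (smooth2_differentiable x sg)).
- by move=> _ x [g sg ->]; exact: (@differentiableZ _ _ _ g c x (smooth2_differentiable x sg)).
- move=> _ l [g sg ->]; exists (partial l g); first exact: smooth2_partial.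
  by apply/funext => x; rewrite /partial deriveZ//; apply: diff_derivable; exact: smooth2_differentiable.
Qed.

Lemma partial_shift (V : normedModType R) (f : plane R -> V) l (a x : plane R) :
  partial l (fun y => f (y - a)) x = partial l f (x - a).
Proof.
rewrite /partial /derive; apply: (congr1 (fun g : R -> V => lim (g h @[h --> (0 : R)^']))).
by apply/funext => h /=; rewrite addrA.
Qed.

Lemma smooth2_shift f (a : plane R) : smooth2 f -> smooth2 (fun y => f (y - a)).
Proof.
move=> sf.
have hd g x : smooth2 g -> differentiable (fun y => g (y - a)) x.
  move=> sg; have d1 : differentiable (fun y : plane R => y - a) x.
    by apply: differentiableB => //; exact: differentiable_cst.
  exact: (@differentiable_comp _ _ _ _ _ g x d1 (smooth2_differentiable _ sg)).
apply: (smooth2_ind (P := fun h => exists2 f, smooth2 f & h = fun y => f (y - a))).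
- by move=> _ [g sg ->] x; apply: differentiable_continuous; exact: hd.
- by move=> _ x [g sg ->]; exact: hd.
- move=> _ l [g sg ->]; exists (partial l g); first exact: smooth2_partial.
  by apply/funext => x; rewrite partial_shift.
- by exists f.
Qed.

Lemma partial_comp1 (d d' : R -> R) (p : plane R -> R) l x :
  is_derive (p x) (1 : R) d (d' (p x)) -> differentiable p x ->
  differentiable (d \o p : plane R -> R^o) x /\
  partial l (d \o p : plane R -> R^o) x = partial l p x * d' (p x).
Proof.
move=> dd dp.
have ddd : differentiable (d : R -> R^o) (p x) by apply/derivable1_diffP; exact: ex_derive.
split; first exact: differentiable_comp.
rewrite /partial deriveE; last exact: differentiable_comp.
rewrite diff_comp//= deriveE//.
have -> : 'd p x (basis_vec l) = 'd p x (basis_vec l) *: (1 : R) by rewrite /GRing.scale/= mulr1.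
rewrite linearZ/= /GRing.scale/= mulr1; congr (_ * _).
by rewrite -(@derive_val _ _ _ _ _ _ _ dd) deriveE.
Qed.

Lemma coord_partial (l m : 'I_2) x :
  differentiable (coord l : plane R -> R^o) x /\
  partial m (coord l : plane R -> R^o) x = (l == m)%:R.
Proof.
have h : is_diff x (coord l : plane R -> R^o) (coord l : plane R -> R^o).
  rewrite /coord; case: (l == ord0).
  - pose f : {linear plane R -> R^o} := fst.
    have cf : continuous f by move=> y; exact: cvg_fst.
    by apply: DiffDef; [exact: linear_differentiable|exact: diff_lin].
  - pose f : {linear plane R -> R^o} := snd.
    have cf : continuous f by move=> y; exact: cvg_snd.
    by apply: DiffDef; [exact: linear_differentiable|exact: diff_lin].
split; first exact: ex_diff.
rewrite /partial deriveE; last exact: ex_diff.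
rewrite diff_val /coord /basis_vec /=.
by case: l {h} => -[|[|//]] ? /=; case: m => -[|[|//]] ? /=.
Qed.

(** Induction on the order with the polynomial generalised, because every derivative changes the
    polynomial and adds a scalar factor. *)
Lemma smooth2_flat (P : {poly R}) (a c : R) (l : 'I_2) :
  smooth2 (fun x => flat P (a * coord l x + c) : R^o).
Proof.
pose p x : R := a * coord l x + c.
have hp x : differentiable (p : plane R -> R^o) x.
  rewrite (_ : p = a \*: (coord l : plane R -> R^o) + cst c); last exact/funext.
  apply: differentiableD => //; apply: differentiableZ.
  by have [] := coord_partial l l x.
have hpp m x : partial m (p : plane R -> R^o) x = a * (l == m)%:R.
  have [dl pl] := coord_partial l m x.
  rewrite (_ : p = a \*: (coord l : plane R -> R^o) + cst c); last exact/funext.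
  rewrite /partial deriveD//; last by apply: diff_derivable; apply: differentiableZ.
  rewrite derive_cst addr0 deriveZ; last exact: diff_derivable.
  by rewrite -pl.
move=> k; elim: k P => [|k IH] Q /=.
  move=> x _; apply: differentiable_continuous.
  by have [] := partial_comp1 l (flat_is_derive Q (p x)) (hp x).
split => [x _|m].
  by have [] := partial_comp1 l (flat_is_derive Q (p x)) (hp x).
rewrite (_ : partial m _ =
    (a * (l == m)%:R) \*: (fun x => flat ('X^2 * (Q - Q^`())) (p x) : R^o)).
  move: (a * _) (IH ('X^2 * (Q - Q^`()))) => b.
  move: (fun x => _ : R^o) => g {IH}.
  elim: k g => [|k IH] g /=.
    move=> h x _; apply: (@cvgM R _ _ _ (cst b) g b (g x)); last exact: h.
    exact: cvg_cst.
  move=> [d1 h1]; split => [x _|i]; first by apply: differentiableZ; exact: d1.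
  rewrite (_ : partial i _ = b \*: partial i g); first exact: IH.
  by apply/funext => x; rewrite /partial deriveZ//; apply: diff_derivable; exact: d1.
apply/funext => x.
have [_] := partial_comp1 m (flat_is_derive Q (p x)) (hp x).
by rewrite hpp => ->.
Qed.

End Smooth2.

Section Chain.
Context {R : realType} {V : normedModType R}.

Lemma plane_basis (k : plane R) :
  k = k.1 *: basis_vec ord0 + k.2 *: basis_vec ord_max.
Proof.
case: k => a b; rewrite /basis_vec /=.
by congr pair; rewrite /= /GRing.scale/= ?mulr1 ?mulr0 ?addr0 ?add0r.
Qed.

Lemma derive_plane (f : plane R -> V) (x k : plane R) : differentiable f x ->
  'D_k f x = k.1 *: partial ord0 f x + k.2 *: partial ord_max f x.
Proof.
move=> df; rewrite /partial !deriveE// {1}(plane_basis k) linearD !linearZ.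
by [].
Qed.

Lemma is_derive_curve (f : plane R -> V) (c : R -> plane R) (t : R) (d : plane R) :
  differentiable f (c t) -> is_derive t (1 : R) c d ->
  is_derive t (1 : R) (f \o c) (d.1 *: partial ord0 f (c t) + d.2 *: partial ord_max f (c t)).
Proof.
move=> df [dc cd].
have dc' : differentiable c t by apply/derivable1_diffP.
have dfc : differentiable (f \o c) t by exact: differentiable_comp.
apply: DeriveDef; first exact/derivable1_diffP.
rewrite deriveE// diff_comp//= -deriveE// -derive_plane//.
by rewrite -cd !deriveE.
Qed.

Lemma is_derive_line (z k : plane R) (t : R) :
  is_derive t (1 : R) (fun s : R => z + s *: k) k.
Proof.
have h : is_derive t (1 : R) (fun s : R => cst z s + s *: k) (0 + (1 : R) *: k).
  apply: is_deriveD.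
  have dk : is_diff t ( *:%R^~ k : R -> plane R) ( *:%R^~ k) by exact: is_diff_scalel.
  apply: DeriveDef.
    by apply/derivable1_diffP; exact: ex_diff.
  by rewrite deriveE ?diff_val//; exact: ex_diff.
by apply: (is_derive_eq h); rewrite add0r scale1r.
Qed.

Lemma is_derive_along (f : plane R -> V) (z k : plane R) (t : R) :
  differentiable f (z + t *: k) ->
  is_derive t (1 : R) (fun s : R => f (z + s *: k))
    (k.1 *: partial ord0 f (z + t *: k) + k.2 *: partial ord_max f (z + t *: k)).
Proof. by move=> df; exact: (is_derive_curve df (is_derive_line z k t)). Qed.

End Chain.

Section Taylor2.
Context {R : realType}.

Lemma MVT01 (f f' : R -> R) :
  (forall t : R, 0 <= t <= 1 -> is_derive t (1 : R) f (f' t)) ->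
  exists2 c, 0 <= c <= 1 & f 1 - f 0 = f' c.
Proof.
move=> hf.
have h1 (x : R) : x \in `]0, 1[ -> is_derive x (1 : R) f (f' x).
  by rewrite in_itv/= => /andP[c0 c1]; apply: hf; rewrite !ltW.
have h2 : {within `[0, 1], continuous f}.
  apply: derivable_within_continuous => x; rewrite in_itv/= => hx.
  by have [] := hf x hx.
have [c hc1 hc2] := MVT_segment ler01 h1 h2.
by exists c; [rewrite in_itv/= in hc1|rewrite hc2 subr0 mulr1].
Qed.

Lemma quadratic_form_le (K M a b u v w z : R) : `|a| <= K -> `|b| <= K ->
  `|u| <= M -> `|v| <= M -> `|w| <= M -> `|z| <= M ->
  `|a * (a * u + b * v) + b * (a * w + b * z)| <= 4 * M * K ^+ 2.
Proof.
move=> ha hb hu hv hw hz.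
have h1 (c d p : R) : `|c| <= K -> `|d| <= K -> `|p| <= M -> `|c * (d * p)| <= K * (K * M).
  by move=> ? ? ?; rewrite !normrM; apply: ler_pM => //; exact: ler_pM.
have -> : 4 * M * K ^+ 2 = (K * (K * M) + K * (K * M)) + (K * (K * M) + K * (K * M)).
  by ring.
rewrite !mulrDr; apply: le_trans (ler_normD _ _) _.
by apply: lerD; apply: le_trans (ler_normD _ _) _; apply: lerD; exact: h1.
Qed.

(** Two uses of the mean value theorem along the segment from z to z + k. The factor 1/2 is lost,
    but only the quadratic order in [k] matters. *)
Lemma taylor2_bound (f : plane R -> R^o) (M : R) : smooth2 f ->
  (forall l m x, `|partial l (partial m f) x| <= M) ->
  forall z k, `|f (z + k) - f z - (k.1 * partial ord0 f z + k.2 * partial ord_max f z)|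
    <= 4 * M * `|k| ^+ 2.
Proof.
move=> sf hM z k.
have M0 : 0 <= M by exact: le_trans (hM ord0 ord0 0).
pose g (t : R) : R := f (z + t *: k).
pose g' (t : R) : R := k.1 * partial ord0 f (z + t *: k) + k.2 * partial ord_max f (z + t *: k).
have dg t : is_derive t (1 : R) g (g' t).
  by apply: is_derive_along; exact: smooth2_differentiable.
pose g'' (t : R) : R := k.1 * (k.1 * partial ord0 (partial ord0 f) (z + t *: k) +
    k.2 * partial ord_max (partial ord0 f) (z + t *: k)) +
  k.2 * (k.1 * partial ord0 (partial ord_max f) (z + t *: k) +
    k.2 * partial ord_max (partial ord_max f) (z + t *: k)).
have dg' t : is_derive t (1 : R) g' (g'' t).
  have h l := is_derive_along (k := k)
    (smooth2_differentiable (z + t *: k) (smooth2_partial l sf)).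
  exact: (is_deriveD (is_deriveZ k.1 (h ord0)) (is_deriveZ k.2 (h ord_max))).
have [c c01 hc] := MVT01 (fun t _ => dg t).
have k1 : `|k.1| <= `|k| by rewrite [leRHS]prod_normE le_max lexx.
have k2 : `|k.2| <= `|k| by rewrite [leRHS]prod_normE le_max lexx orbT.
have hg'' t : `|g'' t| <= 4 * M * `|k| ^+ 2.
  exact: quadratic_form_le.
have [c' _ hc'] : exists2 c', 0 <= c' <= 1 & g' c - g' 0 = c * g'' (c * c').
  have dgc t : is_derive t (1 : R) (g' \o ( *%R c)) (g'' (c * t) * c).
    have h : is_derive t (1 : R) ( *%R c) c.
      by apply: (is_derive_eq (is_deriveZ c (is_derive_id t (1 : R)))); exact: mulr1.
    exact: (is_derive1_comp (dg' (c * t)) h).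
  have [c' c'01 h] := MVT01 (fun t _ => dgc t).
  by exists c' => //; move: h; rewrite /= mulr1 mulr0 mulrC.
have -> : f (z + k) = g 1 by rewrite /g scale1r.
have -> : f z = g 0 by rewrite /g scale0r addr0.
rewrite hc (_ : k.1 * _ + _ = g' 0); last by rewrite /g' scale0r addr0.
rewrite hc' normrM; have /andP[c0 c1] := c01.
apply: le_trans (hg'' (c * c')); rewrite ler_piMl// ger0_norm//.
Qed.

Definition box (e : R) : set (plane R) := [set x | `|x| <= e].

Lemma compact_box e : compact (box e).
Proof.
rewrite (_ : box e = `[- e, e]%classic `*` `[- e, e]%classic).
  by apply: compact_setX; exact: segment_compact.
apply/seteqP; split => -[x y] /=; rewrite /box/= prod_normE ge_max/= !in_itv/= !ler_norml.
  by move=> /andP[].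
by move=> [-> ->].
Qed.

Lemma closed_box e : closed (box e).
Proof.
by apply: compact_closed; [exact: norm_hausdorff|exact: compact_box].
Qed.

Lemma smooth2_supp_partial (f : plane R -> R^o) e l :
  (forall x, ~ box e x -> f x = 0) -> forall x, ~ box e x -> partial l f x = 0.
Proof.
move=> f0 x nx; rewrite /partial -(derive_cst (0 : R^o) x (basis_vec l)).
apply: near_eq_derive.
have : nbhs x (~` box e) by apply: open_nbhs_nbhs; split => //; exact/closed_openC/closed_box.
by apply: filterS => y ny; rewrite f0.
Qed.

Lemma smooth2_supp_bounded (f : plane R -> R^o) e :
  0 <= e -> smooth2 f -> (forall x, ~ box e x -> f x = 0) ->
  exists2 M : R, 0 <= M & forall x, `|f x| <= M.
Proof.
move=> e0 sf f0.
have cf : {within box e, continuous (fun x => `|f x|)}.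
  apply: continuous_subspaceT => x; apply: cvg_norm; exact: smooth2_continuous.
have b0 : box e !=set0 by exists 0; rewrite /box/= normr0.
have [x0 _ hx0] := compact_EVT_max b0 (@compact_box e) cf.
exists `|f x0| => // x.
have [bx|nbx] := pselect (box e x); first by apply: hx0; rewrite inE.
by rewrite f0// normr0.
Qed.

End Taylor2.

(** * The mollifying kernel *)

Section Kernel.
Context {R : realType}.
Variable e : R.
Hypothesis e0 : 0 < e.

(** The factors are written with [1 * s] and [- 1 * s] to match the shape [a * coord l x + c] of
    [smooth2_flat]. *)
Definition bump1 (s : R) : R := flat 1 (1 * s + e) * flat 1 (- 1 * s + e).

Lemma flat_continuous (P : {poly R}) : continuous (flat P).
Proof.
move=> s; apply/differentiable_continuous/derivable1_diffP.
by have [] := flat_is_derive P s.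
Qed.

Lemma bump1_continuous : continuous bump1.
Proof.
move=> s; apply: cvgM.
  apply: (@continuous_comp _ _ _ (fun s : R => 1 * s + e) (flat 1)); last exact: flat_continuous.
  by apply: cvgD; [apply: cvgM; [exact: cvg_cst|exact: cvg_id]|exact: cvg_cst].
apply: (@continuous_comp _ _ _ (fun s : R => - 1 * s + e) (flat 1)); last exact: flat_continuous.
by apply: cvgD; [apply: cvgM; [exact: cvg_cst|exact: cvg_id]|exact: cvg_cst].
Qed.

Lemma bump1_ge0 s : 0 <= bump1 s.
Proof. by rewrite mulr_ge0 ?flat1_ge0. Qed.

Lemma bump1N s : bump1 (- s) = bump1 s.
Proof. by rewrite /bump1 mulrC; congr (flat _ _ * flat _ _); ring. Qed.

Lemma bump1_supp s : e <= `|s| -> bump1 s = 0.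
Proof.
have f0 u : u <= 0 -> flat (1 : {poly R}) u = 0 by rewrite /flat leNgt => /negbTE ->.
rewrite /bump1 ler_normr => /orP[es|es].
  by rewrite [X in _ * X]f0 ?mulr0//; lra.
by rewrite f0 ?mul0r//; lra.
Qed.

Lemma bump1_le1 s : bump1 s <= 1.
Proof.
have h u : flat 1 u <= 1.
  rewrite /flat; case: ifP => // u0; rewrite hornerE mul1r expR_le1.
  by rewrite oppr_le0 invr_ge0 ltW.
by rewrite /bump1 -[leRHS]mulr1; apply: ler_pM; rewrite ?flat1_ge0 ?h.
Qed.

Let mu := @lebesgue_measure R.

Lemma measurable_bump1 (D : set R) (a : R) : measurable_fun D (fun s => bump1 (s - a)).
Proof.
apply: measurable_funTS; apply: continuous_measurable_fun => s.
apply: (@continuous_comp _ _ _ (fun s : R => s - a) bump1); last exact: bump1_continuous.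
by apply: cvgB; [exact: cvg_id|exact: cvg_cst].
Qed.

Lemma bump1_shift (a : R) :
  (\int[mu]_s (bump1 (s - a))%:E = \int[mu]_s (bump1 s)%:E)%E.
Proof.
pose F (s : R) := s - a.
have dF s : is_derive s (1 : R) F 1.
  have h := is_deriveB (is_derive_id s (1 : R)) (is_derive_cst a s (1 : R)).
  by apply: (is_derive_eq h); rewrite subr0.
have F1 : F^`()%classic = cst 1 by apply/funext => s; rewrite derive1E derive_val.
rewrite (@increasing_ge0_integration_by_substitutionT R F bump1).
- by apply: eq_integral => s _; rewrite F1/= /F /GRing.mul/= mulr1.
- by move=> x y xy; rewrite /F ltrD2r.
- by rewrite F1; exact: cst_continuous.
- by rewrite F1; exact: is_cvg_cst.
- by rewrite F1; exact: is_cvg_cst.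
- by move=> x; have [] := dF x.
- by apply/cvgrNyPle => A; near=> x; rewrite /F lerBlDr; near: x; apply: nbhs_ninfty_le; exact: num_real.
- by apply/cvgryPge => A; near=> x; rewrite /F lerBrDr; near: x; apply: nbhs_pinfty_ge; exact: num_real.
- exact: bump1_continuous.
- exact: bump1_ge0.
Unshelve. all: by end_near. Qed.

Definition bump1_mass : R := fine (\int[mu]_s (bump1 s)%:E)%E.

Lemma bump1_massE : (\int[mu]_s (bump1 s)%:E)%E = bump1_mass%:E.
Proof.
rewrite fineK// ge0_fin_numE; last by apply: integral_ge0 => s _; rewrite lee_fin bump1_ge0.
apply: (@le_lt_trans _ _ (\int[mu]_s (\1_(`[- e, e]%classic : set R) s)%:E)%E).
  apply: ge0_le_integral => //.
  - by move=> s _; rewrite lee_fin bump1_ge0.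
  - by apply/measurable_EFinP; apply: continuous_measurable_fun; exact: bump1_continuous.
  - by apply/measurable_EFinP; exact: measurable_indic.
  - move=> s _; rewrite lee_fin indicE.
    have [h|h] := boolP (s \in _); first exact: bump1_le1.
    rewrite bump1_supp//; move: h; rewrite notin_setE/= in_itv/= -ler_norml => /negP.
    by rewrite -ltNge => /ltW.
rewrite integral_indic// setIT.
pose J : set (measurableTypeR R) := `[- e, e]%classic.
change (lebesgue_measure J < +oo)%E.
by rewrite lebesgue_measure_itv/=; case: ifP => _; rewrite ?ltry// -EFinD ltry.
Qed.

Lemma bump1_mass_gt0 : 0 < bump1_mass.
Proof.
rewrite -lte_fin -bump1_massE.
(* For |s| <= e/2 both arguments e + s and e - s are at least e/2, and [flat 1] is increasing, so
   the bump is at least [c] there. *)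
pose c := flat (1 : {poly R}) (e / 2) ^+ 2.
have c0 : 0 < c by rewrite exprn_gt0// flat1_gt0// divr_gt0.
have mono u v : 0 < u -> u <= v -> flat (1 : {poly R}) u <= flat 1 v.
  move=> u0 uv; have v0 := lt_le_trans u0 uv.
  by rewrite /flat u0 v0 !hornerE ?mul1r ler_expR lerN2 lef_pV2.
pose J : set (measurableTypeR R) := `[- (e / 2), e / 2]%classic.
have mJ : measurable J by exact: measurable_itv.
apply: (@lt_le_trans _ _ (\int[mu]_s (c * \1_J s)%:E)%E).
  under eq_integral do rewrite EFinM.
  rewrite ge0_integralZl_EFin//; last 2 first.
  - by apply/measurable_EFinP; apply: measurable_indic; exact: measurable_itv.
  - exact: ltW.
  rewrite integral_indic// setIT.
  change (0 < c%:E * lebesgue_measure J)%E.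
  rewrite lebesgue_measure_itv/= lte_fin ifT; last by have := e0; lra.
  by rewrite -EFinB -EFinM lte_fin mulr_gt0//; have := e0; lra.
apply: ge0_le_integral => //.
- by move=> s _; rewrite lee_fin mulr_ge0// ltW.
- by apply/measurable_EFinP; apply: measurable_funM => //; apply: measurable_indic; exact: measurable_itv.
- by apply/measurable_EFinP; apply: continuous_measurable_fun; exact: bump1_continuous.
- move=> s _; rewrite lee_fin indicE.
  have [h|h] := boolP (s \in _); last by rewrite mulr0 bump1_ge0.
  move: h; rewrite inE /J/= in_itv/= => /andP[? ?].
  rewrite mulr1 /bump1 /c expr2; apply: ler_pM; rewrite ?flat1_ge0//.
  + by apply: mono; rewrite ?divr_gt0//; lra.
  + by apply: mono; rewrite ?divr_gt0//; lra.
Qed.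

(** A tensor product: its support is a ball of the max-norm, and its integral factors into two
    one-dimensional masses. *)
Definition kernel (y : plane R) : R^o :=
  bump1_mass ^- 2 * (bump1 y.1 * bump1 y.2).

Lemma smooth2_kernel : smooth2 kernel.
Proof.
have -> : kernel = (bump1_mass ^- 2) \*:
  (((fun x => flat 1 (1 * coord ord0 x + e) : R^o) *
   (fun x => flat 1 (- 1 * coord ord0 x + e) : R^o)) *
  ((fun x => flat 1 (1 * coord ord_max x + e) : R^o) *
   (fun x => flat 1 (- 1 * coord ord_max x + e) : R^o))).
  by apply/funext => -[a b].
by apply: smooth2Z; apply: smooth2M; apply: smooth2M; exact: smooth2_flat.
Qed.

Lemma kernel_ge0 y : 0 <= kernel y.
Proof.
apply: mulr_ge0; last by apply: mulr_ge0; exact: bump1_ge0.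
by rewrite invr_ge0 exprn_ge0// ltW// bump1_mass_gt0.
Qed.

Lemma kernelN y : kernel (- y) = kernel y.
Proof. by rewrite /kernel !bump1N. Qed.

Lemma kernel_supp y : ~ box e y -> kernel y = 0.
Proof.
rewrite /box/= => /negP; rewrite -ltNge [ltRHS]prod_normE lt_max => /orP[h|h].
  by rewrite /kernel bump1_supp ?mul0r ?mulr0// ltW.
by rewrite /kernel [bump1 y.2]bump1_supp ?mulr0// ltW.
Qed.

Lemma kernel_integral x : (\int[mu2]_y (kernel (y - x))%:E = 1)%E.
Proof.
pose f (y : mplane R) := (kernel ((y : plane R) - x))%:E.
have mb (D : set R) a : measurable_fun D (fun s => (bump1 (s - a))%:E).
  by apply/measurable_EFinP; exact: measurable_bump1.
have b0 (a : R) : forall s, setT s -> (0 <= (bump1 (s - a))%:E)%E.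
  by move=> s _; rewrite lee_fin bump1_ge0.
have ck : continuous (fun y : plane R => kernel (y - x)).
  exact/smooth2_continuous/smooth2_shift/smooth2_kernel.
have := @fubini_tonelli1 _ _ _ _ _ (@lebesgue_measure R) (@lebesgue_measure R) f.
rewrite /mu2/= => ->; last 2 first.
- by apply/measurable_EFinP; exact: continuous_measurable_fun2.
- by move=> y; rewrite lee_fin kernel_ge0.
rewrite /fubini_F /f.
have m0 := bump1_mass_gt0.
have c0 : 0 <= bump1_mass ^- 2 by rewrite invr_ge0 exprn_ge0// ltW.
transitivity (\int[mu]_s ((bump1_mass ^- 1)%:E * (bump1 (s - x.1))%:E))%E.
  apply: eq_integral => s _.
  transitivity (\int[mu]_t ((bump1_mass ^- 2 * bump1 (s - x.1))%:E * (bump1 (t - x.2))%:E))%E.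
    by apply: eq_integral => t _; rewrite /kernel /= mulrA EFinM.
  rewrite (@ge0_integralZl_EFin _ _ _ mu setT measurableT _ (b0 x.2) (mb setT x.2)).
    rewrite bump1_shift bump1_massE -!EFinM; congr (_%:E).
    by field; rewrite gt_eqF.
  by rewrite mulr_ge0// bump1_ge0.
rewrite (@ge0_integralZl_EFin _ _ _ mu setT measurableT _ (b0 x.1) (mb setT x.1)).
  by rewrite bump1_shift bump1_massE -EFinM mulVf// gt_eqF.
by rewrite invr_ge0 ltW.
Qed.

End Kernel.

Lemma I2P (l : 'I_2) : l = ord0 \/ l = ord_max.
Proof. by case: l => -[|[|//]] ?; [left|right]; exact/val_inj. Qed.

Section QuadraticDifferentiable.
Context {R : realType}.

(** A quadratic error bound identifies the differential. Differentiation under the convolution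
    integral thus reduces to integrating a Taylor bound. *)
Lemma quadratic_differentiable (F : plane R -> R^o) (x : plane R) (a b C : R) :
  (forall k : plane R, `|F (x + k) - F x - (k.1 * a + k.2 * b)| <= C * `|k| ^+ 2) ->
  [/\ differentiable F x, partial ord0 F x = a & partial ord_max F x = b].
Proof.
move=> hF.
pose u : {linear plane R -> R^o} := fst.
pose v : {linear plane R -> R^o} := snd.
pose df : {linear plane R -> R^o} := (a \*: u) \+ (b \*: v).
have dfE k : df k = k.1 * a + k.2 * b.
  by rewrite /df/= /u/v/= /GRing.scale/= [a * _]mulrC [b * _]mulrC.
have cdf : continuous df.
  move=> y; have -> : (df : plane R -> R^o) = fun k => k.1 * a + k.2 * b.
    by apply/funext => k; exact: dfE.
  apply: cvgD; apply: cvgM; [exact: cvg_fst|exact: cvg_cst|exact: cvg_snd|exact: cvg_cst].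
have dF : F \o shift x = cst (F x) + df +o_ (0 : plane R) id.
  apply/eqaddoP => _/posnumP[e]; near=> k.
  have -> : (F \o shift x - (cst (F x) + df)) k = F (x + k) - F x - (k.1 * a + k.2 * b).
    by rewrite -(dfE k) !fctE /= [k + x]addrC opprD addrA.
  apply: (le_trans (hF k)); rewrite expr2 mulrA ler_wpM2r//.
  have k1 : `|k| <= e%:num / (`|C| + 1).
    near: k; apply/nbhs_ballP; exists (e%:num / (`|C| + 1)) => /=.
      by rewrite divr_gt0// ltr_wpDl.
    by move=> k; rewrite -ball_normE/= sub0r normrN => /ltW.
  apply: (@le_trans _ _ ((`|C| + 1) * `|k|)).
    by rewrite ler_wpM2r//; apply: le_trans (ler_norm _) _; rewrite lerDl.
  by rewrite mulrC -ler_pdivlMr// ltr_wpDl.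
have dE := diff_unique cdf dF.
have dd : differentiable F x.
  by apply/diff_locallyP; rewrite dE.
split => //; rewrite /partial deriveE// dE dfE /basis_vec/=.
  by rewrite mul1r mul0r addr0.
by rewrite mul1r mul0r add0r.
Unshelve. all: by end_near. Qed.

End QuadraticDifferentiable.

Section Convolution.
Context {R : realType}.
Implicit Types (f g : mplane R -> R) (rho : plane R -> R^o) (x : plane R).

Definition bounded_L2 (N : R) f := [/\ measurable_fun setT f,
  forall x, ~ box N (x : plane R) -> f x = 0 & (sqint setT f < +oo)%E].

Lemma measurable_box N : measurable (box N : set (mplane R)).
Proof. by apply: closed_measurable2; exact: closed_box. Qed.

Lemma mu2_box_lt_pinfty N : (mu2 (box N : set (mplane R)) < +oo)%E.
Proof.
have N1 : 0 < 2 * (`|N| + 1) by rewrite mulr_gt0// ltr_wpDl.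
apply: (@le_lt_trans _ _ (mu2 (hsquare (- (`|N| + 1), - (`|N| + 1), 2 * (`|N| + 1))))).
  apply: le_measure; rewrite ?inE//; [exact: measurable_box|exact: measurable_hsquare|].
  move=> -[x y]; rewrite /box/= prod_normE ge_max/= !ler_norml /hsquare/= !in_itv/=.
  have := ler_norm N => hN /andP[/andP[? ?] /andP[? ?]].
  by split; apply/andP; split; lra.
by rewrite mu2_hsquare// ltry.
Qed.

(** On a set of finite measure L2 lies in L1, by |f| <= 1 + f^2. *)
Lemma bounded_L2_integrable N f : bounded_L2 N f -> mu2.-integrable setT (EFin \o f).
Proof.
move=> [mf fN ff]; apply/integrableP; split; first exact/measurable_EFinP.
apply: (@le_lt_trans _ _ (\int[mu2]_x ((\1_(box N : set (mplane R)) x)%:E + (f x ^+ 2)%:E))%E).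
  apply: ge0_le_integral => //.
  - by apply: measurableT_comp => //; exact/measurable_EFinP.
  - apply: emeasurable_funD; last exact: measurable_sqr.
    by apply/measurable_EFinP; apply: measurable_indic; exact: measurable_box.
  - move=> x _; rewrite /= -EFinD lee_fin indicE.
    have [bx|nbx] := pselect (box N x).
      rewrite mem_set//= -(real_normK (num_real (f x))).
      by have := sqr_ge0 (`|f x| - 1); have := normr_ge0 (f x); nra.
    by rewrite fN// normr0 expr0n/= addr0.
rewrite ge0_integralD//; first last.
- exact: measurable_sqr.
- by move=> x _; rewrite lee_fin sqr_ge0.
- by apply/measurable_EFinP; apply: measurable_indic; exact: measurable_box.
rewrite integral_indic//; last exact: measurable_box.
by rewrite setIT lte_add_pinfty//; exact: mu2_box_lt_pinfty.
Qed.

Lemma integrable_mul_bounded f (h : mplane R -> R) (M : R) :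
  mu2.-integrable setT (EFin \o f) -> measurable_fun setT h ->
  (forall x, `|h x| <= M) -> mu2.-integrable setT (EFin \o (fun x => f x * h x)).
Proof.
move=> fi mh hM.
have mf : measurable_fun setT f by have /integrableP[/measurable_EFinP] := fi.
have := integrableZl measurableT M fi; apply: le_integrable => //.
  by apply/measurable_EFinP; exact: measurable_funM.
move=> x _; rewrite /= lee_fin !normrM mulrC ler_wpM2r//.
by apply: le_trans (hM x) _; exact: ler_norm.
Qed.

(** The argument is [y - x], so that [partial_shift] applies to y -> rho (y - x). The mollifier is
    even, so this is the usual convolution for it; the reflection shows as a minus sign in the
    derivative. *)
Definition convol f rho x : R := \int[mu2]_y (f y * rho ((y : plane R) - x)).

Lemma measurable_shift rho x : continuous rho ->
  measurable_fun setT (fun y : mplane R => rho ((y : plane R) - x)).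
Proof.
move=> cr; apply: continuous_measurable_fun2 => y.
apply: (@continuous_comp _ _ _ (fun y : plane R => y - x) rho); last exact: cr.
by apply: cvgB; [exact: cvg_id|exact: cvg_cst].
Qed.

Lemma convol_integrable N f rho x (e : R) : bounded_L2 N f -> smooth2 rho ->
  0 <= e -> (forall x, ~ box e x -> rho x = 0) ->
  mu2.-integrable setT (EFin \o (fun y => f y * rho ((y : plane R) - x))).
Proof.
move=> fb sr e0 r0; have [M M0 hM] := smooth2_supp_bounded e0 sr r0.
apply: (@integrable_mul_bounded _ _ M) => //.
- exact: bounded_L2_integrable fb.
- by apply: measurable_shift; exact: smooth2_continuous.
Qed.

(** The Taylor bound for [rho], uniform in y, is integrated against |f|; the quadratic constant is 4
    M' times the L1 norm of [f]. *)
Lemma convol_differentiable N f rho (e : R) : bounded_L2 N f -> smooth2 rho ->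
  0 <= e -> (forall x, ~ box e x -> rho x = 0) -> forall x,
  differentiable (convol f rho : plane R -> R^o) x /\
  forall l, partial l (convol f rho : plane R -> R^o) x = - convol f (partial l rho) x.
Proof.
move=> fb sr e0 r0 x.
have sp l : smooth2 (partial l rho) by exact: smooth2_partial.
have p0 l : forall x, ~ box e x -> partial l rho x = 0 by exact: smooth2_supp_partial.
have /choice[M hM] : forall lm : 'I_2 * 'I_2, exists M : R,
    forall x, `|partial lm.1 (partial lm.2 rho) x| <= M.
  move=> [l m]; have [M _ hM] := smooth2_supp_bounded e0
    (smooth2_partial l (sp m)) (smooth2_supp_partial l (p0 m)).
  by exists M.
pose M' := \sum_(lm : 'I_2 * 'I_2) `|M lm|.
have hM' l m y : `|partial l (partial m rho) y| <= M'.
  apply: (le_trans (hM (l, m) y)); apply: (le_trans (ler_norm _)).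
  by rewrite /M' (bigD1 (l, m))//= lerDl sumr_ge0.
have iF k : mu2.-integrable setT (EFin \o (fun y => f y * rho ((y : plane R) - k))).
  exact: convol_integrable fb sr e0 r0.
have iG l k : mu2.-integrable setT (EFin \o (fun y => f y * partial l rho ((y : plane R) - k))).
  exact: convol_integrable fb (sp l) e0 (p0 l).
have fi := bounded_L2_integrable fb.
have mf : measurable_fun setT f by have [] := fb.
pose I0 := \int[mu2]_y `|f y|.
have [] := @quadratic_differentiable R (convol f rho) x
  (- convol f (partial ord0 rho) x) (- convol f (partial ord_max rho) x) (4 * M' * I0).
  move=> k.
  pose q (y : mplane R) := rho ((y : plane R) - (x + k)) - rho ((y : plane R) - x) -
     ((- k.1) * partial ord0 rho ((y : plane R) - x) +
      (- k.2) * partial ord_max rho ((y : plane R) - x)).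
  have hq y : `|q y| <= 4 * M' * `|k| ^+ 2.
    have := taylor2_bound sr hM' ((y : plane R) - x) (- k).
    rewrite normrN /q (_ : (y : plane R) - (x + k) = (y : plane R) - x + - k) //.
    by rewrite opprD addrA.
  have mq : measurable_fun setT q.
    rewrite /q; apply: measurable_funB.
      by apply: measurable_funB; apply: measurable_shift; exact: smooth2_continuous.
    apply: measurable_funD; apply: measurable_funM => //; apply: measurable_shift;
      exact: smooth2_continuous.
  have iq : mu2.-integrable setT (EFin \o (fun y => f y * q y)).
    exact: integrable_mul_bounded fi mq hq.
  have -> : convol f rho (x + k) - convol f rho x -
      (k.1 * - convol f (partial ord0 rho) x + k.2 * - convol f (partial ord_max rho) x) =
      \int[mu2]_y (f y * q y).
    have e1 := RintegralZl (- k.1) measurableT (iG ord0 x).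
    have e2 := RintegralZl (- k.2) measurableT (iG ord_max x).
    have i1 : mu2.-integrable setT (EFin \o (fun y =>
        - k.1 * (f y * partial ord0 rho ((y : plane R) - x)))).
      exact: (integrableZl measurableT (- k.1) (iG ord0 x)).
    have i2 : mu2.-integrable setT (EFin \o (fun y =>
        - k.2 * (f y * partial ord_max rho ((y : plane R) - x)))).
      exact: (integrableZl measurableT (- k.2) (iG ord_max x)).
    have h1 := RintegralB measurableT (iF (x + k)) (iF x).
    have h2 := RintegralD measurableT i1 i2.
    have h3 := RintegralB measurableT
      (integrableB measurableT (iF (x + k)) (iF x)) (integrableD measurableT i1 i2).
    apply/esym.
    have h4 : \int[mu2]_y (f y * q y) = \int[mu2]_y
        ((f y * rho ((y : plane R) - (x + k)) - f y * rho ((y : plane R) - x)) -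
         (- k.1 * (f y * partial ord0 rho ((y : plane R) - x)) +
          - k.2 * (f y * partial ord_max rho ((y : plane R) - x)))).
      by apply: eq_Rintegral => y _; rewrite /q; ring.
    apply: (etrans h4); apply: (etrans h3).
    apply: (etrans (congr2 (fun a b => a - b) h1 (etrans h2 (congr2 +%R e1 e2)))).
    rewrite /convol.
    move: (Rintegral _ _ _) => A; move: (Rintegral _ _ _) => B.
    move: (Rintegral _ _ _) => C; move: (Rintegral _ _ _) => D; ring.
  apply: le_trans (le_normr_Rintegral measurableT iq) _.
  have ifn : mu2.-integrable setT (EFin \o (fun y => `|f y|)).
    exact: (integrable_norm fi).
  have -> : 4 * M' * I0 * `|k| ^+ 2 = \int[mu2]_y (4 * M' * `|k| ^+ 2 * `|f y|).
    by rewrite RintegralZl// -/I0; ring.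
  apply: le_Rintegral => //.
  - exact: (integrable_norm iq).
  - exact: (integrableZl measurableT _ ifn).
  - by move=> y _; rewrite normrM mulrC ler_wpM2r.
move=> d p q; split; first exact: d.
by move=> l; have [->|->] := I2P l; [exact: p|exact: q].
Qed.

End Convolution.

Section Mollification.
Context {R : realType}.
Implicit Types (f g : mplane R -> R) (x : plane R).

Lemma measurable_kernel_shift (e : R) x :
  measurable_fun setT (fun y : mplane R => kernel e ((y : plane R) - x)).
Proof. by apply: measurable_shift; apply: smooth2_continuous; exact: smooth2_kernel. Qed.

Lemma kernel_shift_integrable (e : R) x : 0 < e ->
  mu2.-integrable setT (EFin \o (fun y : mplane R => kernel e ((y : plane R) - x))).
Proof.
move=> e0; apply/integrableP; split.
  by apply/measurable_EFinP; exact: measurable_kernel_shift.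
apply: (@le_lt_trans _ _ 1%E); last by rewrite ltry.
rewrite -(kernel_integral e0 x) le_eqVlt; apply/orP; left; apply/eqP.
by apply: eq_integral => y _; rewrite /= ger0_norm// kernel_ge0.
Qed.

Lemma Rintegral_kernel (e : R) x : 0 < e ->
  \int[mu2]_y (kernel e ((y : plane R) - x)) = 1.
Proof. by move=> e0; rewrite /Rintegral kernel_integral. Qed.

Lemma mollify_integrable N f (e : R) x : 0 < e -> bounded_L2 N f ->
  mu2.-integrable setT (EFin \o (fun y => f y * kernel e ((y : plane R) - x))).
Proof.
move=> e0 fb; apply: (convol_integrable x fb (smooth2_kernel e) (ltW e0)).
exact: kernel_supp.
Qed.

Lemma mollify_continuous N f (e : R) : 0 < e -> bounded_L2 N f ->
  continuous (convol f (kernel e)).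
Proof.
move=> e0 fb x; apply: (@differentiable_continuous _ _ R^o).
by have [] := convol_differentiable fb (smooth2_kernel e) (ltW e0) (@kernel_supp _ _) x.
Qed.

Lemma measurable_mollify N f (e : R) : 0 < e -> bounded_L2 N f ->
  measurable_fun setT (convol f (kernel e) : mplane R -> R).
Proof.
by move=> e0 fb; apply: continuous_measurable_fun2; exact: mollify_continuous fb.
Qed.

(** The kernel is a probability density and m is the mean of [f] for it, so integrating (f - m)^2 >=
    0 gives the claim. *)
Lemma mollify_jensen N f (e : R) x : 0 < e -> bounded_L2 N f ->
  (((convol f (kernel e) x) ^+ 2)%:E <=
    \int[mu2]_y (f y ^+ 2 * kernel e ((y : plane R) - x))%:E)%E.
Proof.
move=> e0 fb; have [mf fN ff] := fb.
have [M M0 hM] := smooth2_supp_bounded (ltW e0) (smooth2_kernel e) (@kernel_supp _ e).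
have if2 : mu2.-integrable setT (EFin \o (fun y => f y ^+ 2)).
  apply/integrableP; split; first exact: measurable_sqr.
  apply: le_lt_trans ff; rewrite le_eqVlt; apply/orP; left; apply/eqP.
  by apply: eq_integral => y _; rewrite /= ger0_norm// sqr_ge0.
have i1 : mu2.-integrable setT
    (EFin \o (fun y => f y ^+ 2 * kernel e ((y : plane R) - x))).
  exact: (integrable_mul_bounded if2 (measurable_kernel_shift e x) (fun y => hM _)).
have i2 := mollify_integrable x e0 fb.
have i3 := kernel_shift_integrable x e0.
set m := convol f (kernel e) x.
have h1 := RintegralZl (2 * m) measurableT i2.
have h2 := RintegralZl (- m ^+ 2) measurableT i3.
have i4 := integrableZl measurableT (2 * m) i2.
have i5 := integrableZl measurableT (- m ^+ 2) i3.
have h3 := RintegralD measurableT i4 i5.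
have h4 : \int[mu2]_y (2 * m * (f y * kernel e ((y : plane R) - x)) +
    - m ^+ 2 * kernel e ((y : plane R) - x)) = m ^+ 2.
  apply: (etrans h3); apply: (etrans (congr2 +%R h1 h2)).
  rewrite Rintegral_kernel// -/(convol f (kernel e) x) -/m; ring.
have h5 : m ^+ 2 <= \int[mu2]_y (f y ^+ 2 * kernel e ((y : plane R) - x)).
  rewrite -h4; apply: le_Rintegral => //.
    exact: (integrableD measurableT i4 i5).
  move=> y _; have k0 := kernel_ge0 e0 ((y : plane R) - x).
  rewrite -subr_ge0 (_ : _ - _ = (f y - m) ^+ 2 * kernel e ((y : plane R) - x)); last by ring.
  by rewrite mulr_ge0// sqr_ge0.
rewrite -(@fineK _ (\int[mu2]_y (f y ^+ 2 * kernel e ((y : plane R) - x))%:E)%E).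
  by rewrite lee_fin.
exact: (integrable_fin_num measurableT i1).
Qed.

(** Jensen pointwise, then Tonelli: by evenness the kernel also has mass 1 in the variable x. *)
Lemma mollify_sqint_le N f (e : R) : 0 < e -> bounded_L2 N f ->
  (sqint setT (convol f (kernel e)) <= sqint setT f)%E.
Proof.
move=> e0 fb; have [mf fN ff] := fb.
pose F (p : mplane R * mplane R) : \bar R :=
  (f p.2 ^+ 2 * kernel e ((p.2 : plane R) - (p.1 : plane R)))%:E.
have mF : measurable_fun setT F.
  apply/measurable_EFinP; apply: measurable_funM.
    by apply: measurable_funX; apply: measurableT_comp => //; exact: measurable_snd.
  rewrite /kernel; apply: measurable_funM => //.
  have mb (u : mplane R -> R) : measurable_fun setT u ->
      measurable_fun setT (fun p : mplane R * mplane R => bump1 e (u p.2 - u p.1)).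
    move=> mu; apply: (@measurableT_comp _ _ _ _ _ _ (bump1 e)).
      by apply: continuous_measurable_fun; exact: bump1_continuous.
    by apply: measurable_funB; apply: measurableT_comp.
  apply: measurable_funM.
  - exact: (mb fst measurable_fst).
  - exact: (mb snd measurable_snd).
have F0 p : (0 <= F p)%E by rewrite lee_fin mulr_ge0 ?sqr_ge0// kernel_ge0.
have := @fubini_tonelli _ _ _ _ _ (@mu2_sf R) (@mu2_sf R) F mF F0.
move=> hF.
have mG := @measurable_fun_fubini_tonelli_F _ _ _ _ _ (@mu2_sf R) F mF F0.
have hle (x : mplane R) : setT x ->
    ((convol f (kernel e) x ^+ 2)%:E <= fubini_F mu2_sf F x)%E.
  by move=> _; exact: mollify_jensen fb.
have h0 (x : mplane R) : setT x -> (0 <= (convol f (kernel e) x ^+ 2)%:E)%E.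
  by move=> _; rewrite lee_fin sqr_ge0.
apply: (le_trans (@ge0_le_integral _ _ _ mu2 setT measurableT _ _ h0
  (measurable_sqr (measurable_mollify e0 fb)) mG hle)).
apply: (@le_trans _ _ (\int[mu2_sf]_y fubini_G mu2_sf F y)%E).
  by rewrite le_eqVlt; apply/orP; left; apply/eqP; exact: hF.
rewrite le_eqVlt; apply/orP; left; apply/eqP; apply: eq_integral => y _.
rewrite /fubini_G /F /=.
have k0 (z : mplane R) : setT z -> (0 <= (kernel e ((z : plane R) - y))%:E)%E.
  by move=> _; rewrite lee_fin kernel_ge0.
have mk : measurable_fun setT (fun z : mplane R => (kernel e ((z : plane R) - y))%:E).
  by apply/measurable_EFinP; exact: measurable_kernel_shift.
transitivity (\int[mu2]_z ((f y ^+ 2)%:E * (kernel e ((z : plane R) - y))%:E))%E.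
  by apply: eq_integral => z _; rewrite EFinM -kernelN opprB.
rewrite (@ge0_integralZl_EFin _ _ _ mu2 setT measurableT _ k0 mk _ (sqr_ge0 _)).
apply: (etrans (congr1 (fun a => (f y ^+ 2)%:E * a)%E (kernel_integral e0 y))).
by rewrite mule1.
Qed.

Lemma convolB N f g (e : R) x : 0 < e -> bounded_L2 N f -> bounded_L2 N g ->
  convol (fun y => f y - g y) (kernel e) x =
  convol f (kernel e) x - convol g (kernel e) x.
Proof.
move=> e0 fb gb.
have h := RintegralB measurableT (mollify_integrable x e0 fb) (mollify_integrable x e0 gb).
by apply/esym; apply: (etrans (esym h)); apply: eq_Rintegral => y _; rewrite mulrBl.
Qed.

Lemma bounded_L2_widen N N' f : N <= N' -> bounded_L2 N f -> bounded_L2 N' f.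
Proof.
move=> NN' [mf fN ff]; split => // x nx; apply: fN => bx; apply: nx.
exact: le_trans bx NN'.
Qed.

Lemma bounded_L2B N f g : bounded_L2 N f -> bounded_L2 N g ->
  bounded_L2 N (fun x => f x - g x).
Proof.
move=> [mf fN ff] [mg gN gg]; have mfg : measurable_fun setT (fun x => f x - g x).
  exact: measurable_funB.
split => // [x nx|]; first by rewrite fN// gN// subr0.
apply: le_lt_trans (sqintD_le measurableT mfg mf mg _) _.
  by move=> x _; exact: ler_normB.
by rewrite lte_add_pinfty// lte_mul_pinfty// ?lee_fin.
Qed.

Lemma mollify_lipschitz N (phi : plane R -> R) (L e : R) x : 0 < e ->
  bounded_L2 N phi -> (forall x y, `|phi x - phi y| <= L * `|x - y|) -> 0 <= L ->
  `|convol phi (kernel e) x - phi x| <= L * e.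
Proof.
move=> e0 pb hL L0.
have i1 := mollify_integrable x e0 pb.
have i2 := kernel_shift_integrable x e0.
have i3 := integrableZl measurableT (phi x) i2.
have h1 := RintegralB measurableT i1 i3.
have h2 := RintegralZl (phi x) measurableT i2.
have i4 := integrableB measurableT i1 i3.
have i5 := integrableZl measurableT (L * e) i2.
have h3 := RintegralZl (L * e) measurableT i2.
rewrite Rintegral_kernel// mulr1 in h2; rewrite Rintegral_kernel// mulr1 in h3.
rewrite h2 in h1; rewrite -[X in X - _]/(\int[mu2]_y (phi y * kernel e ((y : plane R) - x))).
rewrite -h1; apply: le_trans (le_normr_Rintegral measurableT i4) _.
rewrite -h3; apply: le_Rintegral => //; first exact: (integrable_norm i4).
move=> y _; have k0 := kernel_ge0 e0 ((y : plane R) - x).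
rewrite -mulrBl normrM (ger0_norm k0).
have [b|nb] := pselect (box e ((y : plane R) - x)); last by rewrite kernel_supp// !mulr0.
rewrite ler_wpM2r//; apply: le_trans (hL _ _) _; exact: ler_wpM2l.
Qed.

Lemma mollify_supp N f (e : R) x : 0 < e -> bounded_L2 N f -> ~ box (N + e) x ->
  convol f (kernel e) x = 0.
Proof.
move=> e0 [mf fN ff] nx.
have -> : convol f (kernel e) x = \int[mu2]_y (cst 0 y).
  apply: eq_Rintegral => y _ /=.
  have [by_|nb] := pselect (box N (y : plane R)); last by rewrite fN// mul0r.
  rewrite kernel_supp ?mulr0// => b; apply: nx; rewrite /box/=.
  rewrite -(subrK (y : plane R) x) addrC; apply: le_trans (ler_normD _ _) _.
  by apply: lerD => //; rewrite distrC.
by rewrite /Rintegral integral0.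
Qed.

(** With J the mollification and [phi] Lipschitz near [f], the error splits as J(f - phi) + (J phi -
    phi) + (phi - f). The first term is controlled because J does not increase the L2 norm, the
    second is at most L e on a bounded box. *)
Theorem mollify_cvg N f : bounded_L2 N f -> forall eta : R, 0 < eta ->
  exists2 d : R, 0 < d & forall e : R, 0 < e -> e < d ->
    (sqint setT (fun x => (convol f (kernel e) x - f x)%R) <= eta%:E)%E.
Proof.
move=> fb eta eta0; have [mf fN ff] := fb.
have N1 : 0 < `|N| + 1 by rewrite ltr_wpDl.
have fN' x : ~ ball ((0, 0) : plane R) (`|N| + 1) x -> f x = 0.
  move=> nb; apply: fN => bx; apply: nb; rewrite -ball_normE/=.
  rewrite (_ : (0, 0) = 0 :> plane R)// sub0r normrN.
  by apply: le_lt_trans bx _; apply: le_lt_trans (ler_norm _) _; rewrite ltrDl.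
have [_ happrox] := L2_density N1 mf fN' ff.
have eta16 : 0 < eta / 16 by rewrite divr_gt0.
have [phi hphi hfphi] := happrox _ eta16.
have mphi : measurable_fun setT (phi : mplane R -> R).
  by apply: continuous_measurable_fun2; exact: lipschitz_supp_continuous.
have [[L0 hL0] [Np hNp]] := hphi.
pose L := `|L0|; pose N' := Num.max N Np.
have hL x y : `|phi x - phi y| <= L * `|x - y|.
  by apply: le_trans (hL0 x y) _; rewrite ler_wpM2r// ler_norm.
have phib : bounded_L2 N' phi.
  split => // [x nx|].
    apply: hNp; rewrite leNgt; apply/negP => xN; apply: nx; rewrite /box/=.
    by rewrite le_max (ltW xN) orbT.
  have mfp : measurable_fun setT (fun x => f x - phi x) by exact: measurable_funB.
  apply: le_lt_trans (sqintD_le measurableT mphi mf mfp _) _.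
    by move=> x _; rewrite -{1}(subKr (f x) (phi x)); exact: ler_normB.
  rewrite lte_add_pinfty// lte_mul_pinfty// ?lee_fin//.
  by apply: le_lt_trans hfphi _; rewrite ltry.
have fb' : bounded_L2 N' f by apply: bounded_L2_widen fb; rewrite le_max lexx.
have fpb := bounded_L2B fb' phib.
pose B : \bar R := mu2 (box (N' + 1) : set (mplane R)).
have B0 : (0 <= B)%E by exact: measure_ge0.
have Bfin : B \is a fin_num by rewrite (ge0_fin_numE B0); exact: mu2_box_lt_pinfty.
pose b := fine B.
have b0 : 0 <= b by rewrite fine_ge0.
have den0 : 0 < 16 * (L ^+ 2 + 1) * (b + 1).
  by rewrite mulr_gt0 ?ltr_wpDl// mulr_gt0// ltr_wpDl// sqr_ge0.
(* Radii below 1 keep all supports in one box of area b and allow e^2 <= e. The middle term is then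
   at most L^2 e b; the added ones keep the denominator positive. *)
exists (Num.min 1 (eta / (16 * (L ^+ 2 + 1) * (b + 1)))).
  by rewrite lt_min ltr01 divr_gt0.
move=> e e0; rewrite lt_min => /andP[e1 e2].
have mc := measurable_mollify e0 fb'.
have mcp := measurable_mollify e0 phib.
have mcfp := measurable_mollify e0 fpb.
have h1 := mollify_sqint_le e0 fpb.
have h2 : (sqint setT (fun x => (convol phi (kernel e) x - phi x)%R) <= (eta / 16)%:E)%E.
  apply: (@le_trans _ _ (sqint setT (fun x => (L * e * \1_(box (N' + 1) : set (mplane R)) x)%R))).
    apply: sqint_le => //.
    - exact: measurable_funB.
    - by apply: measurable_funM => //; apply: measurable_indic; exact: measurable_box.
    - move=> x _; rewrite indicE.
      have [bx|nbx] := pselect (box (N' + 1) (x : plane R)).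
        have Le0 : 0 <= L * e by rewrite mulr_ge0 ?normr_ge0// ltW.
        rewrite mem_set// mulr1 [leRHS](ger0_norm Le0).
        exact: (mollify_lipschitz x e0 phib hL (normr_ge0 L0)).
      have c0 : convol phi (kernel e) x = 0.
        apply: (mollify_supp e0 phib) => hbx; apply: nbx.
        by apply: le_trans hbx _; rewrite lerD2l ltW.
      have p0 : phi x = 0.
        have [_ pN _] := phib; apply: pN => hbx; apply: nbx.
        by apply: le_trans hbx _; rewrite lerDl.
      by rewrite c0 p0 subr0 normr0.
  rewrite sqintZ//; last by apply: measurable_indic; exact: measurable_box.
  have -> : sqint setT (\1_(box (N' + 1) : set (mplane R))) = B.
    have h := @integral_indic _ _ _ (@mu2 R) setT measurableT _ (measurable_box (N' + 1)).
    rewrite setIT in h; apply: (etrans _ h).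
    apply: eq_integral => x _; rewrite indicE; case: (_ \in _) => /=.
      by rewrite expr1n.
    by rewrite expr0n.
  rewrite -(fineK Bfin) -/b -EFinM lee_fin.
  have ee : e ^+ 2 <= e by rewrite expr2 ger_pMr// ltW.
  rewrite ltr_pdivlMr// in e2.
  have L2 : 0 <= L ^+ 2 by rewrite sqr_ge0.
  rewrite exprMn; apply: (@le_trans _ _ (L ^+ 2 * e * b)).
    by rewrite ler_wpM2r// ler_wpM2l.
  rewrite ler_pdivlMr//; apply: le_trans (ltW e2).
  have -> : L ^+ 2 * e * b * 16 = e * (16 * L ^+ 2 * b) by ring.
  apply: ler_wpM2l; first exact: ltW.
  move: (L ^+ 2) L2 => a a0; have := mulr_ge0 a0 b0; nra.
have h3 : (sqint setT (fun x => (phi x - f x)%R) <= (eta / 16)%:E)%E.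
  apply: le_trans hfphi; rewrite le_eqVlt; apply/orP; left; apply/eqP.
  by apply: eq_integral => x _; rewrite -sqrrN opprB.
have m1 : measurable_fun setT (fun x => convol f (kernel e) x - f x).
  exact: measurable_funB.
have m2 : measurable_fun setT (fun x => convol phi (kernel e) x - phi x).
  exact: measurable_funB.
have m3 : measurable_fun setT (fun x => phi x - f x) by exact: measurable_funB.
have m4 : measurable_fun setT (fun x => convol phi (kernel e) x - f x).
  exact: measurable_funB.
apply: le_trans (sqintD_le measurableT m1 mcfp m4 _) _.
  move=> x _; rewrite (convolB x e0 fb' phib).
  apply: le_trans (ler_normD _ _); rewrite le_eqVlt; apply/orP; left; apply/eqP.
  by congr (`|_|); ring.
have h4 : (sqint setT (fun x => (convol phi (kernel e) x - f x)%R) <= (eta / 4)%:E)%E.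
  apply: le_trans (sqintD_le measurableT m4 m2 m3 _) _.
    move=> x _; apply: le_trans (ler_normD _ _); rewrite le_eqVlt; apply/orP; left; apply/eqP.
    by congr (`|_|); ring.
  apply: (@le_trans _ _ (2%:E * (eta / 16)%:E + 2%:E * (eta / 16)%:E)%E).
    by apply: leeD; apply: lee_wpmul2l; rewrite ?lee_fin.
  by rewrite -!EFinM -EFinD lee_fin; lra.
apply: (@le_trans _ _ (2%:E * (eta / 16)%:E + 2%:E * (eta / 4)%:E)%E).
  by apply: leeD; apply: lee_wpmul2l; rewrite ?lee_fin//; exact: le_trans h1 hfphi.
by rewrite -!EFinM -EFinD lee_fin; lra.
Qed.

End Mollification.

(** * Sobolev functions and one-dimensional estimates *)

Section WeakMollification.
Context {R : realType}.

(** The kernel centred at [x] has its support inside K, hence is an admissible test function. The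
    minus sign of integration by parts cancels the one from differentiating the reflected kernel. *)
Lemma weak_partial_mollify (K : set (plane R)) (l : 'I_2) (v g : plane R -> R)
    (N e : R) (x : plane R) : 0 < e -> measurable (K : set (mplane R)) ->
  bounded_L2 N (v \_ K) -> is_weak_partial K l v g ->
  (forall y, `|y - x| <= e -> interior K y) ->
  differentiable (convol (v \_ K) (kernel e) : plane R -> R^o) x /\
  partial l (convol (v \_ K) (kernel e) : plane R -> R^o) x =
    convol (g \_ K) (kernel e) x.
Proof.
move=> e0 mK vb vg hx.
have [d p] := convol_differentiable vb (smooth2_kernel e) (ltW e0) (@kernel_supp _ e) x.
split => //; rewrite p.
pose phi (y : plane R) : R^o := kernel e (y - x).
have sphi : smooth2 phi by apply: smooth2_shift; exact: smooth2_kernel.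
have tphi : test_function K phi.
  split; first exact: sphi.
  exists [set y | `|y - x| <= e]; split => //.
  - have -> : [set y : plane R | `|y - x| <= e] = (fun y => y + x) @` box e.
      apply/seteqP; split => y /=.
        by move=> h; exists (y - x) => //; rewrite subrK.
      by move=> [z hz <-]; rewrite addrK.
    apply: continuous_compact; last exact: compact_box.
    apply: continuous_subspaceT => y; apply: cvgD; [exact: cvg_id|exact: cvg_cst].
  - by move=> y hy; apply: kernel_supp => b; exact: hy.
have := vg phi tphi.
rewrite [in X in X -> _]Rintegral_mkcond [in X in _ = - X -> _]Rintegral_mkcond => h.
rewrite /convol; apply/eqP; rewrite eqr_oppLR; apply/eqP.
apply: etrans (etrans h _).
  apply: eq_Rintegral => y _ /=; rewrite !patchE; case: ifP => _; last by rewrite mul0r.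
  by rewrite partial_shift.
congr (- _); apply: eq_Rintegral => y _ /=; rewrite !patchE; case: ifP => _ //.
by rewrite mul0r.
Qed.

(** By compactness the distance to the complement of U has a positive minimum on A; half of it is
    the margin. *)
Lemma compact_open_margin (A U : set (plane R)) : compact A -> open U -> A `<=` U ->
  exists2 e : R, 0 < e & forall x y, A x -> `|y - x| <= e -> U y.
Proof.
move=> cA oU AU.
have [A0|/set0P A0] := eqVneq A set0.
  by exists 1 => // x y; rewrite A0.
have [U0|/set0P U0] := eqVneq (~` U) set0.
  exists 1 => // x y _ _; apply: contrapT => nU.
  by have : (~` U) y by []; rewrite U0.
have cd : {within A, continuous (setdist (~` U))}.
  apply: continuous_subspaceT => x; apply/cvgrPdist_lt => e e0.
  near=> y; apply: le_lt_trans (setdist_lip_norm _ _ U0) _.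
  by near: y; apply: (@cvgr_dist_lt _ _ _ _ _ id x) => //; exact: cvg_id.
have [x0 Ax0 hx0] := compact_EVT_min A0 cA cd.
rewrite inE in Ax0.
have d0 : 0 < setdist (~` U) x0.
  apply: setdist_gt0 => //; first exact: open_closedC.
  by apply; exact: AU.
exists (setdist (~` U) x0 / 2); first by rewrite divr_gt0.
move=> x y Ax xy; apply: contrapT => nUy.
have := setdist_le x (nUy : (~` U) y); have := hx0 x; rewrite inE => /(_ Ax).
rewrite distrC; lra.
Unshelve. all: by end_near. Qed.

End WeakMollification.

Section OneDim.
Context {R : realType}.
Let mu := @lebesgue_measure R.

Lemma measurable_cc (a b : R) : measurable (`[a, b]%classic : set (measurableTypeR R)).
Proof. exact: measurable_itv. Qed.

Lemma mu_cc (a b : R) : a <= b -> (mu `[a, b]%classic = (b - a)%:E)%E.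
Proof.
move=> ab; rewrite /mu lebesgue_measure_itv/= lte_fin.
case: ifPn => [_|]; first by rewrite -EFinB.
by rewrite -leNgt => ba; have -> : a = b; [apply/eqP; rewrite eq_le ab|rewrite subrr].
Qed.

Lemma within_cc_measurable (a b : R) (f : R -> R) : {within `[a, b], continuous f} ->
  measurable_fun (`[a, b]%classic : set R) f.
Proof. by move=> cf; apply: subspace_continuous_measurable_fun => //; exact: measurable_cc. Qed.

Lemma within_cc_integrable (a b : R) (f : R -> R) : {within `[a, b], continuous f} ->
  mu.-integrable `[a, b]%classic (EFin \o f).
Proof. by move=> cf; apply: continuous_compact_integrable => //; exact: segment_compact. Qed.

(** The mean m of [h] satisfies 2 m h - m^2 <= h^2; integration over an interval of length 1 turns
    the left side into m^2. *)
Lemma cauchy_schwarz01 (h : R -> R) : {within `[0, 1], continuous h} ->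
  (((\int[mu]_(t in `[0, 1]) h t) ^+ 2)%R%:E <=
   \int[mu]_(t in `[0%R, 1%R]) ((h t) ^+ 2)%:E)%E.
Proof.
move=> ch; set m := Rintegral _ _ _.
have mD := measurable_cc 0 1.
have ch2 : {within `[0, 1], continuous (fun t => h t ^+ 2)}.
  have -> : (fun t => h t ^+ 2) = (fun t => h t * h t) by apply/funext => t; rewrite expr2.
  by move=> t; exact: (cvgM (ch t) (ch t)).
have i1 := within_cc_integrable ch; have i2 := within_cc_integrable ch2.
have i0 : mu.-integrable `[0, 1]%classic (EFin \o cst (- m ^+ 2)).
  by apply: within_cc_integrable => t; exact: cvg_cst.
have h1 := RintegralZl (2 * m) mD i1.
have i3 := integrableZl mD (2 * m) i1.
have h2 := RintegralD mD i3 i0.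
have h3 : \int[mu]_(t in `[0, 1]) (cst (- m ^+ 2) t) = - m ^+ 2.
  rewrite Rintegral_cst//.
  apply: (etrans (congr1 (fun z => - m ^+ 2 * fine z) (mu_cc (@ler01 R)))).
  by rewrite /= subr0 mulr1.
have h4 : \int[mu]_(t in `[0, 1]) (2 * m * h t + cst (- m ^+ 2) t) = m ^+ 2.
  apply: (etrans h2); apply: (etrans (congr2 +%R h1 h3)); rewrite -/m; ring.
have h5 : m ^+ 2 <= \int[mu]_(t in `[0, 1]) (h t ^+ 2).
  rewrite -[leLHS]h4; apply: le_Rintegral => //; first exact: (integrableD mD i3 i0).
  move=> t _; rewrite /= -subr_ge0 (_ : _ - _ = (h t - m) ^+ 2) ?sqr_ge0//; ring.
rewrite -(@fineK _ (\int[mu]_(t in `[0%R, 1%R]) (h t ^+ 2)%:E)%E); first by rewrite lee_fin.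
exact: (integrable_fin_num mD i2).
Qed.

Lemma FTC_cc (F f : R -> R) (a b : R) : a < b ->
  (forall t, a <= t <= b -> is_derive t (1 : R) F (f t)) ->
  {within `[a, b], continuous f} ->
  F b - F a = \int[mu]_(t in `[a, b]) f t.
Proof.
move=> ab dF cf.
have cF : {within `[a, b], continuous F}.
  by apply: derivable_within_continuous => t; rewrite in_itv/= => /dF [].
have [_ ca cb] := (continuous_within_itvP F ab).1 cF.
have := @continuous_FTC2 R f F a b ab cf.
rewrite /Rintegral => -> //.
- split => //.
  move=> t; rewrite in_itv/= => /andP[ta tb].
  have tab : a <= t <= b by rewrite !ltW.
  by have [d _] := dF t tab.
- move=> t; rewrite in_itv/= => /andP[ta tb]; rewrite derive1E.
  have tab : a <= t <= b by rewrite !ltW.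
  by have [_ ->] := dF t tab.
Qed.

(** The function (1 - t) p'(t) + p(t) is a primitive of (1 - t) p''(t), which gives the integral
    remainder; Cauchy-Schwarz keeps the weight inside the square. *)
Lemma taylor2_sqr (p p' p'' : R -> R) :
  (forall t : R, 0 <= t <= 1 -> is_derive t (1 : R) p (p' t)) ->
  (forall t : R, 0 <= t <= 1 -> is_derive t (1 : R) p' (p'' t)) ->
  {within `[0, 1], continuous p''} ->
  (((p 1 - p 0 - p' 0) ^+ 2)%:E <=
   \int[mu]_(t in `[0%R, 1%R]) (((1 - t) * p'' t) ^+ 2)%:E)%E.
Proof.
move=> dp dp' cp''.
pose F (t : R) : R := (1 - t) * p' t + p t.
have dF (t : R) : 0 <= t <= 1 -> is_derive t (1 : R) F ((1 - t) * p'' t).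
  move=> t01.
  have d1 : is_derive t (1 : R) (fun s : R => 1 - s) (- 1).
    have h := is_deriveB (is_derive_cst (1 : R) t (1 : R)) (is_derive_id t (1 : R)).
    by apply: (is_derive_eq h); rewrite sub0r.
  have d2 := is_deriveD (is_deriveM d1 (dp' t t01)) (dp t t01).
  apply: (is_derive_eq d2).
  change ((1 - t) * p'' t + p' t * - 1 + p' t = (1 - t) * p'' t); ring.
have cf : {within `[0, 1], continuous (fun t : R => (1 - t) * p'' t)}.
  have c1 : {within `[0, 1], continuous (fun t : R => 1 - t)}.
    by apply: continuous_subspaceT => s; apply: cvgB; [exact: cvg_cst|exact: cvg_id].
  by move=> t; exact: (cvgM (c1 t) (cp'' t)).
have h := FTC_cc ltr01 dF cf.
have -> : p 1 - p 0 - p' 0 = F 1 - F 0 by rewrite /F subrr mul0r add0r subr0; ring.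
by rewrite h; exact: cauchy_schwarz01.
Qed.

End OneDim.

(** * Oscillation controlled by the mixed second derivative *)

Section Slab.
Context {R : realType}.
Let mu := @lebesgue_measure R.

Lemma pointwise_within {T U : topologicalType} (D : set T) (f : T -> U) :
  (forall x, D x -> {for x, continuous f}) -> {within D, continuous f}.
Proof. by move=> h; apply: continuous_in_subspaceT => x; rewrite inE; exact: h. Qed.

Definition square (b : R) : set (mplane R) :=
  (`[0, b]%classic : set (measurableTypeR R)) `*` `[0, b]%classic.

Lemma measurable_square b : measurable (square b).
Proof. by apply: measurableX; exact: measurable_itv. Qed.

Lemma Rintegral_cc_ge0_le (b s t : R) (f : R -> R) : 0 <= s -> s <= t -> t <= b ->
  {within `[0, b], continuous f} ->
  `|\int[mu]_(x in `[s, t]) f x| <= \int[mu]_(x in `[0, b]) `|f x|.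
Proof.
move=> s0 st tb cf.
have sub : `[s, t]%classic `<=` `[0, b]%classic.
  by move=> x /=; rewrite !in_itv/= => /andP[? ?]; apply/andP; split; lra.
have cf' : {within `[s, t], continuous f} by exact: continuous_subspaceW cf.
have cn : {within `[0, b], continuous (fun x => `|f x|)}.
  by move=> x; exact: (cvg_norm (cf x)).
have i1 := within_cc_integrable cf'.
have i2 := within_cc_integrable cn.
apply: le_trans (le_normr_Rintegral (measurable_cc s t) i1) _.
rewrite /Rintegral; apply: fine_le.
- apply: (integrable_fin_num (measurable_cc s t)).
  exact: (integrable_norm i1).
- exact: (integrable_fin_num (measurable_cc 0 b) i2).
apply: ge0_subset_integral => //.
by apply/measurable_EFinP; exact: within_cc_measurable.
Qed.

(** Averaging |P t| <= |P r| + (integral of |Q|) over r in [0, b] gives b |P t| <= integral of |P| +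
    |Q|, where b <= 1 lets the second term lose its factor b. Young's inequality p <= lam/2 + p^2/(2
    lam) is then applied to both. *)
Lemma slab_slice (b lam : R) (P Q : R -> R) (t : R) : 0 < b -> b <= 1 -> 0 < lam ->
  0 <= t <= b ->
  (forall r : R, 0 <= r <= b -> is_derive r (1 : R) P (Q r)) ->
  {within `[0, b], continuous Q} ->
  ((b * `|P t|)%:E <= (lam * b)%:E + ((2 * lam)^-1)%:E *
    \int[mu]_(r in `[0%R, b]) (P r ^+ 2 + Q r ^+ 2)%:E)%E.
Proof.
move=> b0 b1 l0 t0b dP cQ.
have cP : {within `[0, b], continuous P}.
  by apply: derivable_within_continuous => r; rewrite in_itv/= => /dP [].
have mD := measurable_cc 0 b.
have cnP : {within `[0, b], continuous (fun x => `|P x|)}.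
  by move=> x; exact: (cvg_norm (cP x)).
have cnQ : {within `[0, b], continuous (fun x => `|Q x|)}.
  by move=> x; exact: (cvg_norm (cQ x)).
have cP2 : {within `[0, b], continuous (fun x => P x ^+ 2 + Q x ^+ 2)}.
  have -> : (fun x => P x ^+ 2 + Q x ^+ 2) = (fun x => P x * P x + Q x * Q x).
    by apply/funext => x; rewrite !expr2.
  by move=> x; exact: (cvgD (cvgM (cP x) (cP x)) (cvgM (cQ x) (cQ x))).
pose J := \int[mu]_(r in `[0, b]) `|Q r|.
have step1 r : 0 <= r <= b -> `|P t| <= `|P r| + J.
  move=> r0b; rewrite -lerBlDl; apply: le_trans (lerB_dist _ _) _.
  have hab (s u : R) : 0 <= s <= b -> 0 <= u <= b -> s < u -> `|P u - P s| <= J.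
    move=> /andP[s0 sb] /andP[u0 ub] su.
    have dP' (x : R) : s <= x <= u -> is_derive x (1 : R) P (Q x).
      by move=> /andP[sx xu]; apply: dP; rewrite (le_trans s0 sx) (le_trans xu ub).
    have cQ' : {within `[s, u], continuous Q}.
      apply: continuous_subspaceW cQ => x /=; rewrite !in_itv/= => /andP[sx xu].
      by rewrite (le_trans s0 sx) (le_trans xu ub).
    rewrite (FTC_cc su dP' cQ'); exact: Rintegral_cc_ge0_le (ltW su) _ cQ.
  case: (ltgtP t r) => [tr|rt|->].
  - by rewrite distrC; exact: hab.
  - exact: hab.
  - by rewrite subrr normr0 /J; apply: Rintegral_ge0.
have iP := within_cc_integrable cnP; have iQ := within_cc_integrable cnQ.
have i2 := within_cc_integrable cP2.
have iPQ := integrableD mD iP iQ.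
have mub : fine (mu `[0, b]%classic) = b.
  by rewrite (congr1 fine (mu_cc (ltW b0))) /= subr0.
have icst (c : R) : mu.-integrable `[0, b]%classic (EFin \o cst c).
  by apply: within_cc_integrable => x; exact: cvg_cst.
have intc (c : R) : \int[mu]_(r in `[0, b]) (cst c r) = c * b.
  by rewrite Rintegral_cst// (congr1 (fun z => c * z) mub).
have hJ : \int[mu]_(r in `[0, b]) (`|P r| + `|Q r|) = \int[mu]_(r in `[0, b]) `|P r| + J.
  exact: (RintegralD mD iP iQ).
have J0 : 0 <= J by apply: Rintegral_ge0.
have step2 : b * `|P t| <= \int[mu]_(r in `[0, b]) (`|P r| + `|Q r|).
  have h : \int[mu]_(r in `[0, b]) (cst (`|P t| - J) r) <= \int[mu]_(r in `[0, b]) `|P r|.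
    apply: le_Rintegral => // r; rewrite /= in_itv/= => hr.
    by rewrite lerBlDr; exact: step1.
  rewrite intc in h; rewrite hJ.
  have : J * b <= J by rewrite ler_piMr.
  rewrite mulrBl lerBlDr in h => hJb; rewrite [leLHS]mulrC; apply: (le_trans h).
  by rewrite lerD2l.
have l20 : 0 < 2 * lam by rewrite mulr_gt0.
have e1 := RintegralZl (2 * lam)^-1 mD i2.
have i3 := integrableZl mD (2 * lam)^-1 i2.
have e2 := RintegralD mD (icst lam) i3.
have step3 : \int[mu]_(r in `[0, b]) (`|P r| + `|Q r|) <=
    lam * b + (2 * lam)^-1 * \int[mu]_(r in `[0, b]) (P r ^+ 2 + Q r ^+ 2).
  rewrite -e1 -(intc lam) -[leRHS]e2.
  apply: le_Rintegral => //; first exact: (integrableD mD (icst lam) i3).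
  move=> r _ /=; rewrite -(real_normK (num_real (P r))) -(real_normK (num_real (Q r))).
  move: `|P r| `|Q r| => p q.
  rewrite -(ler_pM2l l20) [leRHS]mulrDr [X in _ <= _ + X]mulrA mulfV ?gt_eqF// mul1r.
  by have := sqr_ge0 (p - lam); have := sqr_ge0 (q - lam); nra.
rewrite -(@fineK _ (\int[mu]_(r in `[0%R, b]) (P r ^+ 2 + Q r ^+ 2)%:E)%E).
  by rewrite -EFinM -EFinD lee_fin; exact: le_trans step2 step3.
exact: (integrable_fin_num mD i2).
Qed.

(* U(s, t) - U(s', t) is the integral of P = U_s between s and s'; averaging
   P(r, .) over the slab costs Q = U_st, and Young's inequality with the free
   weight lam replaces the Hoelder estimate of exponent 1/2. *)
Lemma slab_holder (b lam M : R) (U P Q : plane R -> R) : 0 < b -> b <= 1 -> 0 < lam ->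
  (forall s t : R, 0 <= s <= b -> 0 <= t <= b ->
    is_derive s (1 : R) (fun s => U (s, t)) (P (s, t))) ->
  (forall s t : R, 0 <= s <= b -> 0 <= t <= b ->
    is_derive t (1 : R) (fun t => P (s, t)) (Q (s, t))) ->
  (forall z, square b z -> {for z, continuous P}) ->
  (forall z, square b z -> {for z, continuous Q}) ->
  (\int[mu2]_(z in square b) (P z ^+ 2 + Q z ^+ 2)%:E <= M%:E)%E ->
  forall s s' t, 0 <= s <= b -> 0 <= s' <= b -> 0 <= t <= b ->
  `|U (s, t) - U (s', t)| <= lam * `|s - s'| + (2 * lam * b)^-1 * M.
Proof.
move=> b0 b1 l0 dU dP cP cQ hM.
have l20 : 0 <= (2 * lam)^-1 by rewrite invr_ge0 mulr_ge0// ltW.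
have mSq := measurable_square b.
have M0 : 0 <= M.
  rewrite -lee_fin; apply: le_trans hM; apply: integral_ge0 => z _.
  by rewrite lee_fin addr_ge0// sqr_ge0.
pose f (z : mplane R) := P z ^+ 2 + Q z ^+ 2.
have f0 z : 0 <= f z by rewrite addr_ge0// sqr_ge0.
have mf : measurable_fun (square b) f.
  by apply: measurable_funD; apply: measurable_funX;
    apply: within_continuous_measurable_fun2 => //; exact: pointwise_within.
pose F (z : mplane R) := ((f \_ (square b)) z)%:E.
have mF : measurable_fun setT F.
  by apply/measurable_EFinP; apply/(measurable_restrictT _ mSq).
have F0 z : (0 <= F z)%E.
  by rewrite lee_fin patchE; case: ifP.
pose l : {sigma_finite_measure set (measurableTypeR R) -> \bar R} := @lebesgue_measure R.
have mG := @measurable_fun_fubini_tonelli_F _ _ _ _ _ l F mF F0.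
have tonelli := @fubini_tonelli1 _ _ _ _ _ l l F mF F0.
have hint : (\int[mu2]_z F z <= M%:E)%E.
  apply: le_trans hM; rewrite [leRHS]integral_mkcond le_eqVlt; apply/orP; left; apply/eqP.
  apply: eq_integral => z _; rewrite /F !patchE; case: ifP => //.
have slice (s : R) : 0 <= s <= b ->
    (\int[mu]_(r in `[0%R, b]) (f (s, r))%:E <= fubini_F l F s)%E.
  move=> hs; rewrite /fubini_F.
  rewrite [leLHS]integral_mkcond le_eqVlt; apply/orP; left; apply/eqP.
  apply: eq_integral => r _; rewrite /F !patchE.
  have [rb|rb] := boolP (r \in `[0, b]%classic).
    rewrite mem_set//; split => /=; first by rewrite in_itv.
    by move: rb; rewrite inE.
  rewrite memNset// => -[/= _ rb']; move: rb; rewrite notin_setE; exact.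
have dslice (s : R) : 0 <= s <= b -> {within `[0, b], continuous (fun r : R => Q (s, r))}.
  move=> hs; apply: pointwise_within => r /=; rewrite in_itv/= => hr.
  have cz : {for (s, r), continuous Q} by apply: cQ; split; rewrite /= in_itv.
  apply: (@continuous_comp _ _ _ (fun r : R => (s, r)) Q) => //.
  exact: (cvg_pair (cvg_cst s) cvg_id).
(* The slice estimate is integrated from s to s': its constant part gives lam b (s' - s), its
   quadratic part at most the double integral over the square. *)
have key s s' t : 0 <= s <= b -> 0 <= s' <= b -> 0 <= t <= b -> s < s' ->
    b * `|U (s', t) - U (s, t)| <= lam * b * (s' - s) + (2 * lam)^-1 * M.
  move=> hs hs' ht ss'.
  have /andP[s0 sb] := hs; have /andP[s'0 s'b] := hs'.
  have sub (r : R) : s <= r <= s' -> 0 <= r <= b.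
    by move=> /andP[? ?]; apply/andP; split; lra.
  have cPt : {within `[s, s'], continuous (fun r : R => P (r, t))}.
    apply: pointwise_within => r /=; rewrite in_itv/= => /sub hr.
    have cz : {for (r, t), continuous P} by apply: cP; split; rewrite /= in_itv.
    apply: (@continuous_comp _ _ _ (fun r : R => (r, t)) P) => //.
    exact: (cvg_pair cvg_id (cvg_cst t)).
  rewrite (FTC_cc ss' (fun r hr => dU r t (sub r hr) ht) cPt).
  have cn : {within `[s, s'], continuous (fun r : R => `|P (r, t)|)}.
    by move=> x; exact: (cvg_norm (cPt x)).
  have mD := measurable_cc s s'.
  have i1 := within_cc_integrable cPt; have i2 := within_cc_integrable cn.
  have e1 := RintegralZl b mD i2.
  have i3 := integrableZl mD b i2.
  apply: le_trans (_ : b * \int[mu]_(r in `[s, s']) `|P (r, t)| <= _).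
    by rewrite ler_pM2l//; exact: (le_normr_Rintegral mD i1).
  rewrite -e1 -lee_fin /Rintegral fineK; last exact: (integrable_fin_num mD i3).
  apply: (@le_trans _ _ (\int[mu]_(r in `[s, s']) ((lam * b)%:E + ((2 * lam)^-1)%:E * fubini_F l F r))%E).
    apply: ge0_le_integral => //.
    - by move=> r _; rewrite lee_fin mulr_ge0// ltW.
    - exact: (measurable_int _ i3).
    - apply: emeasurable_funD => //; apply: measurable_funeM.
      exact: measurable_funTS mG.
    - move=> r; rewrite /= in_itv/= => /sub hr.
      apply: le_trans (slab_slice b0 b1 l0 ht (fun q hq => dP r q hr hq) (dslice r hr)) _.
      by apply: leeD => //; apply: lee_wpmul2l; rewrite ?lee_fin//; exact: slice.
  have G0 r : (0 <= fubini_F l F r)%E by apply: integral_ge0.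
  rewrite ge0_integralD//; first last.
  - by apply: measurable_funeM; exact: measurable_funTS mG.
  - by move=> r _; rewrite mule_ge0 ?lee_fin.
  - by move=> r _; rewrite lee_fin mulr_ge0// ltW.
  rewrite EFinD; apply: leeD.
    rewrite integral_cst//= (mu_cc (ltW ss')) -EFinM lee_fin//.
  rewrite (@ge0_integralZl_EFin _ _ _ mu `[s, s']%classic mD _ (fun r _ => G0 r)
    (measurable_funTS mG) _ l20).
  rewrite EFinM; apply: lee_wpmul2l; rewrite ?lee_fin//.
  apply: le_trans hint.
  apply: (@le_trans _ _ (\int[mu]_r fubini_F l F r)%E).
    by apply: ge0_subset_integral.
  rewrite le_eqVlt; apply/orP; left; apply/eqP; exact: (esym tonelli).
have key2 s s' t : 0 <= s <= b -> 0 <= s' <= b -> 0 <= t <= b -> s < s' ->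
    `|U (s', t) - U (s, t)| <= lam * `|s - s'| + (2 * lam * b)^-1 * M.
  move=> hs hs' ht ss'; rewrite -(ler_pM2l b0); apply: le_trans (key s s' t hs hs' ht ss') _.
  rewrite distrC gtr0_norm ?subr_gt0// le_eqVlt; apply/orP; left; apply/eqP.
  by field; rewrite !gt_eqF.
move=> s s' t hs hs' ht; case: (ltgtP s s') => [h|h|->].
- by rewrite distrC; exact: key2.
- by rewrite [`|s - s'|]distrC; exact: key2.
- rewrite !subrr normr0 mulr0 add0r mulr_ge0// invr_ge0 mulr_ge0// ?(ltW b0)//.
  by rewrite mulr_ge0// ltW.
Qed.

End Slab.

(** * The affine core *)

Section Barycentric.
Context {R : realType}.
Variable T : affine_core R.

Lemma plane_eq (x y : plane R) : x.1 = y.1 -> x.2 = y.2 -> x = y.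
Proof. by case: x y => [a b] [c d] /= -> ->. Qed.

Definition i30 : 'I_3 := ord0.
Definition i31 : 'I_3 := @Ordinal 3 1 isT.
Definition i32 : 'I_3 := @Ordinal 3 2 isT.

Lemma I3P (k : 'I_3) : [\/ k = i30, k = i31 | k = i32].
Proof.
by case: k => -[|[|[|//]]] h; [apply: Or31|apply: Or32|apply: Or33]; exact: val_inj.
Qed.

Lemma sum3 (V : nmodType) (F : 'I_3 -> V) : \sum_(k < 3) F k = F i30 + F i31 + F i32.
Proof.
rewrite !big_ord_recr big_ord0 /= add0r.
by congr (F _ + F _ + F _); exact: val_inj.
Qed.

Definition vert (k : 'I_3) : plane R :=
  match val k with 0%N => p1 T | 1%N => p2 T | _ => p3 T end.

Definition core_det := det2 (p2 T - p1 T) (p3 T - p1 T).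

(** Barycentric coordinates by Cramer's rule, defined on the whole plane, so that membership in the
    core becomes a sign condition on affine functions. *)
Definition bary (k : 'I_3) (y : plane R) : R :=
  match val k with
  | 0%N => 1 - det2 (y - p1 T) (p3 T - p1 T) / core_det
             - det2 (p2 T - p1 T) (y - p1 T) / core_det
  | 1%N => det2 (y - p1 T) (p3 T - p1 T) / core_det
  | _ => det2 (p2 T - p1 T) (y - p1 T) / core_det
  end.

Let det0 : core_det != 0. Proof. exact: core_nondegenerate. Qed.

Lemma bary_sum y : \sum_(k < 3) bary k y = 1.
Proof. by rewrite sum3 /bary /=; ring. Qed.

Lemma bary_point y : \sum_(k < 3) bary k y *: vert k = y.
Proof.
rewrite sum3 /bary /vert /=; have := det0; rewrite /core_det /det2.
case: (p1 T) (p2 T) (p3 T) y => [a b] [c d] [e f] [y z] /= h.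
by apply: plane_eq; rewrite /= /GRing.scale/=; field.
Qed.

Lemma bary_affine k (a b : R) y z : a + b = 1 ->
  bary k (a *: y + b *: z) = a * bary k y + b * bary k z.
Proof.
move=> ab; have -> : b = 1 - a by rewrite -ab; ring.
have := det0; case: (I3P k) => ->; rewrite /bary /core_det /det2 /=;
case: (p1 T) (p2 T) (p3 T) y z => [p q] [c d] [e f] [y z] [y' z'] /= h;
by rewrite /GRing.scale/=; field.
Qed.

Lemma bary_vert k j : bary k (vert j) = (k == j)%:R.
Proof.
have := det0; case: (I3P k) => ->; case: (I3P j) => ->;
rewrite /bary /vert /core_det /det2 /=;
by case: (p1 T) (p2 T) (p3 T) => [p q] [c d] [e f] /= h; field.
Qed.

(** The constant L grows as the triangle flattens. It is used for continuity and equicontinuity only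
    and never reaches the final estimate. *)
Lemma bary_lip : exists2 L : R, 0 < L &
  forall k y z, `|bary k y - bary k z| <= L * `|y - z|.
Proof.
pose A := `|core_det^-1|.
pose e := p3 T - p1 T; pose f := p2 T - p1 T.
have D (u w : plane R) : `|det2 u w| <= 2 * `|u| * `|w|.
  rewrite /det2; apply: le_trans (ler_normB _ _) _; rewrite !normrM.
  have h1 : `|u.1| <= `|u| by rewrite prod_normE le_max lexx.
  have h2 : `|u.2| <= `|u| by rewrite prod_normE le_max lexx orbT.
  have h3 : `|w.1| <= `|w| by rewrite prod_normE le_max lexx.
  have h4 : `|w.2| <= `|w| by rewrite prod_normE le_max lexx orbT.
  have -> : 2 * `|u| * `|w| = `|u| * `|w| + `|u| * `|w| by ring.
  by apply: lerD; apply: ler_pM.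
have b1 y z : `|bary i31 y - bary i31 z| <= (2 * `|e| * A) * `|y - z|.
  have -> : bary i31 y - bary i31 z = det2 (y - z) e * core_det^-1.
    by rewrite /bary /=-mulrBl /e /det2 /=; congr (_ * _); ring.
  rewrite normrM -/A [leRHS](_ : _ = (2 * `|y - z| * `|e|) * A); last by ring.
  by apply: ler_wpM2r; [exact: normr_ge0|exact: D].
have b2 y z : `|bary i32 y - bary i32 z| <= (2 * `|f| * A) * `|y - z|.
  have -> : bary i32 y - bary i32 z = det2 f (y - z) * core_det^-1.
    by rewrite /bary /=-mulrBl /f /det2 /=; congr (_ * _); ring.
  rewrite normrM -/A [leRHS](_ : _ = (2 * `|f| * `|y - z|) * A); last by ring.
  by apply: ler_wpM2r; [exact: normr_ge0|exact: D].
have a0 : 0 <= 2 * `|e| * A by rewrite /A; do ?apply: mulr_ge0; rewrite ?normr_ge0.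
have c0 : 0 <= 2 * `|f| * A by rewrite /A; do ?apply: mulr_ge0; rewrite ?normr_ge0.
exists (2 * `|e| * A + 2 * `|f| * A + 1); first by rewrite ltr_wpDl// addr_ge0.
move=> k y z; have := b1 y z; have := b2 y z; have n0 := normr_ge0 (y - z).
have e3 : bary i30 y - bary i30 z =
    - (bary i31 y - bary i31 z) - (bary i32 y - bary i32 z) by rewrite /bary /=; ring.
move: (2 * `|e| * A) (2 * `|f| * A) a0 c0 => c1 c2 c10 c20.
have -> : (c1 + c2 + 1) * `|y - z| = c1 * `|y - z| + c2 * `|y - z| + `|y - z| by ring.
have m1 := mulr_ge0 c10 n0; have m2 := mulr_ge0 c20 n0.
case: (I3P k) => ->; rewrite ?e3.
- move=> h1 h2; apply: le_trans (ler_normB _ _) _; rewrite normrN; lra.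
- by move=> _ h; lra.
- by move=> h _; lra.
Qed.

Lemma bary_continuous k : continuous (bary k).
Proof.
have [L L0 hL] := bary_lip.
move=> y; apply/cvgrPdist_lt => e e0; near=> z.
apply: le_lt_trans (hL k y z) _; rewrite mulrC -ltr_pdivlMr//.
by near: z; apply: (@cvgr_dist_lt _ _ _ _ _ id y) => //; exact: divr_gt0.
Unshelve. all: by end_near. Qed.

Lemma core_setP y : core_set T y <-> forall k, 0 <= bary k y.
Proof.
split; last first.
  move=> h; exists (bary i30 y), (bary i31 y), (bary i32 y); split => //.
    by have := bary_sum y; rewrite sum3.
  by rewrite -{1}(bary_point y) sum3.
move=> [a [b [c [a0 b0 c0 abc ->]]]].
have det0' := det0.
have hc : a = 1 - b - c by rewrite -abc; ring.
have e0 : bary i31 (a *: p1 T + b *: p2 T + c *: p3 T) = b.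
  move: det0'; rewrite hc /bary /core_det /det2 /=.
  by case: (p1 T) (p2 T) (p3 T) => [p q] [u v] [r s] /= h; rewrite /GRing.scale/=; field.
have e1 : bary i32 (a *: p1 T + b *: p2 T + c *: p3 T) = c.
  move: det0'; rewrite hc /bary /core_det /det2 /=.
  by case: (p1 T) (p2 T) (p3 T) => [p q] [u v] [r s] /= h; rewrite /GRing.scale/=; field.
have e2 := bary_sum (a *: p1 T + b *: p2 T + c *: p3 T).
move=> k; case: (I3P k) => ->; rewrite ?e0 ?e1//.
by move: e2; rewrite sum3 e0 e1 => h; have -> : bary i30 (a *: p1 T + b *: p2 T + c *: p3 T) = a by lra.
Qed.

Lemma core_bary_le1 k y : core_set T y -> bary k y <= 1.
Proof.
move=> /core_setP h; rewrite -(bary_sum y) (bigD1 k)//= lerDl; apply: sumr_ge0 => *.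
exact: h.
Qed.

Lemma core_vert k : core_set T (vert k).
Proof. by apply/core_setP => j; rewrite bary_vert. Qed.

(** Plays the part of the interior: open, convex, and reached from the closed core by every
    contraction towards the barycenter. *)
Definition core_int : set (plane R) := [set y | forall k, 0 < bary k y].

Lemma core_int_sub : core_int `<=` core_set T.
Proof. by move=> y h; apply/core_setP => k; exact/ltW/h. Qed.

Lemma core_int_open : open core_int.
Proof.
have -> : core_int = (bary i30 @^-1` [set r | 0 < r]) `&` (bary i31 @^-1` [set r | 0 < r])
    `&` (bary i32 @^-1` [set r | 0 < r]).
  apply/seteqP; split => y /=; first by move=> h; split; [split|]; exact: h.
  by move=> [[h0 h1] h2] k; case: (I3P k) => ->.
by do 2?[apply: openI]; apply: open_comp; try exact: open_gt; move=> ? _; exact: bary_continuous.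
Qed.

Lemma core_bounded y : core_set T y -> `|y| <= \sum_(k < 3) `|vert k|.
Proof.
move=> hy; rewrite -{1}(bary_point y); apply: le_trans (ler_norm_sum _ _ _) _.
apply: ler_sum => k _; rewrite normrZ ger0_norm; last by move/core_setP: hy.
by rewrite ler_piMl// core_bary_le1.
Qed.

Lemma core_closed : closed (core_set T).
Proof.
have -> : core_set T = (bary i30 @^-1` [set r | 0 <= r]) `&` (bary i31 @^-1` [set r | 0 <= r])
    `&` (bary i32 @^-1` [set r | 0 <= r]).
  apply/seteqP; split => y /=; first by move=> /core_setP h; split; [split|]; exact: h.
  by move=> [[h0 h1] h2]; apply/core_setP => k; case: (I3P k) => ->.
by do 2?[apply: closedI]; apply: closed_comp; try exact: closed_ge;
   move=> ? _; exact: bary_continuous.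
Qed.

Lemma core_compact : compact (core_set T).
Proof.
apply: (@subclosed_compact _ _ (box (\sum_(k < 3) `|vert k|))).
- exact: core_closed.
- exact: compact_box.
- by move=> y; exact: core_bounded.
Qed.

Lemma core_convex (a b : R) y z : 0 <= a -> 0 <= b -> a + b = 1 ->
  core_set T y -> core_set T z -> core_set T (a *: y + b *: z).
Proof.
move=> a0 b0 ab /core_setP hy /core_setP hz; apply/core_setP => k.
by rewrite bary_affine// addr_ge0// mulr_ge0.
Qed.

Definition barycenter : plane R := \sum_(k < 3) (3^-1 : R) *: vert k.

Lemma bary_barycenter k : bary k barycenter = 3^-1.
Proof.
have := det0; case: (I3P k) => ->; rewrite /barycenter sum3 /vert /bary /core_det /det2 /=;
by case: (p1 T) (p2 T) (p3 T) => [p q] [u v] [r s] /= h; rewrite /GRing.scale/=; field.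
Qed.

Lemma core_contract (a b : R) y : 0 <= a -> 0 < b -> a + b = 1 ->
  core_set T y -> core_int (a *: y + b *: barycenter).
Proof.
move=> a0 b0 ab /core_setP hy k; rewrite bary_affine// bary_barycenter.
by rewrite ltr_wpDl ?mulr_ge0// mulr_gt0// invr_gt0.
Qed.

Lemma core_int_convex (a b : R) y z : 0 <= a -> 0 <= b -> a + b = 1 ->
  core_int y -> core_int z -> core_int (a *: y + b *: z).
Proof.
move=> a0 b0 ab hy hz k; rewrite bary_affine//.
have [ae|an] := eqVneq a 0.
  have -> : b = 1 by rewrite -ab ae add0r.
  by rewrite ae mul0r add0r mul1r.
have a1 : 0 < a by rewrite lt_neqAle eq_sym an.
by apply: ltr_wpDr; [rewrite mulr_ge0// ltW|rewrite mulr_gt0].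
Qed.

Definition edge_dir (i : 'I_2) : plane R :=
  if i == ord0 then p2 T - p1 T else p3 T - p1 T.

Definition edge_coef (i : 'I_2) (y : plane R) : R :=
  if i == ord0 then bary i31 y else bary i32 y.

(** Coordinates in the oblique basis of the two edges at [p1] are differences of barycentric
    coordinates. They stay bounded by 1 on the core however small its angles, so no shape constant
    appears. *)
Lemma edge_decomp y z :
  z - y = \sum_(i < 2) (edge_coef i z - edge_coef i y) *: edge_dir i.
Proof.
rewrite big_ord_recl big_ord1 /edge_coef /edge_dir /= .
have := det0; rewrite /bary /core_det /det2 /=.
case: (p1 T) (p2 T) (p3 T) y z => [a b] [c d] [e f] [y z] [y' z'] /= h.
by apply: plane_eq; rewrite /= /GRing.scale/=; field.
Qed.

Lemma edge_coef_diff i y z : core_set T y -> core_set T z ->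
  `|edge_coef i z - edge_coef i y| <= 1.
Proof.
move=> hy hz; have h k : `|bary k z - bary k y| <= 1.
  have := core_bary_le1 k hy; have := core_bary_le1 k hz.
  move/core_setP: hy => /(_ k); move/core_setP: hz => /(_ k) h1 h2 h3 h4.
  by rewrite ler_norml; apply/andP; split; lra.
by rewrite /edge_coef; case: ifP.
Qed.

Lemma enormN (x : plane R) : enorm (- x) = enorm x.
Proof. by rewrite /enorm /= !sqrrN. Qed.

Lemma enorm_eq0 (x : plane R) : enorm x = 0 -> x = 0.
Proof.
case: x => a b; rewrite /enorm /= => /eqP; rewrite sqrtr_eq0 => h.
have := sqr_ge0 a; have := sqr_ge0 b => h1 h2.
have /eqP : a ^+ 2 = 0 by lra.
have /eqP : b ^+ 2 = 0 by lra.
by rewrite !sqrf_eq0 => /eqP -> /eqP ->.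
Qed.

Lemma edge_dirE i : edge_dir i = h_dir T i *: r_dir T i.
Proof.
have nz (q p : plane R) : q - p != 0 -> q - p = enorm (p - q) *: ((enorm (q - p))^-1 *: (q - p)).
  move=> h; have -> : enorm (p - q) = enorm (q - p) by rewrite -enormN opprB.
  rewrite scalerA mulfV ?scale1r//.
  by apply: contra h => /eqP/enorm_eq0/eqP.
rewrite /edge_dir /h_dir /r_dir; have := det0; rewrite /core_det.
case: ifP => _ h; apply: nz; apply: contra h => /eqP ->; rewrite /det2 /=; apply/eqP; ring.
Qed.

Lemma h_dir_ge0 i : 0 <= h_dir T i.
Proof. by rewrite /h_dir; case: ifP => _; exact: sqrtr_ge0. Qed.

End Barycentric.

(** * Curved elements *)

Section OpenSets.
Context {R : realType}.

(** A nonempty open set contains a square of positive area, so it cannot lie in a null set. *)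
Lemma ae_open_exists (O : set (plane R)) (P : plane R -> Prop) x : open O -> O x ->
  {ae mu2, forall x : mplane R, P x} -> exists2 y, O y & P y.
Proof.
move=> oO Ox [N [mN N0 hN]]; apply: contrapT => nex.
have [r /= r0 hr] : nbhs_ball x O by apply/nbhs_ballP; apply: open_nbhs_nbhs.
pose q : R * R * R := (x.1, x.2, r / 2).
have q0 : 0 < q.2 by rewrite divr_gt0.
have qN : hsquare q `<=` N.
  move=> y hy; apply: hN => /= Py; apply: nex; exists y => //; apply: hr.
  move: hy; rewrite /hsquare /= !in_itv/= => -[/andP[h1 h2] /andP[h3 h4]].
  by split; rewrite /ball /= ltr_norml; apply/andP; split; lra.
have : (mu2 (hsquare q) <= mu2 N)%E.
  by apply: le_measure; rewrite ?inE//; exact: measurable_hsquare.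
by rewrite N0 mu2_hsquare// lee_fin leNgt exprn_gt0.
Qed.

(** An essential bound holds at every interior point of continuity: if it failed there, it would
    fail on a nonempty open set. *)
Lemma Lp_norm_oo_open (A O : set (plane R)) (f : plane R -> R) (C : R) x :
  open O -> O `<=` A -> {for x, continuous f} -> O x ->
  (Lp_norm +oo A f <= C%:E)%E -> f x <= C.
Proof.
move=> oO OA cf Ox; rewrite /Lp_norm unlock /=.
(* The norm at [+oo] is defined by cases on whether the whole space has positive measure. *)
have mT : (0 < mu2 (setT : set (mplane R)))%E.
  apply: (@lt_le_trans _ _ (mu2 (hsquare (0, 0, 1 : R)))).
    by rewrite mu2_hsquare// lte_fin exprn_gt0.
  by apply: le_measure; rewrite ?inE//; exact: measurable_hsquare.
rewrite mT => /ess_supP hae; rewrite leNgt; apply/negP => Cx.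
have oB : nbhs x [set y | C < f y] by exact: cf (lt_nbhsr Cx).
have xO : nbhs x O by apply: open_nbhs_nbhs.
have Bx : interior ([set y | C < f y] `&` O) x by exact: filterI oB xO.
have [y By] := ae_open_exists (@open_interior _ _) Bx hae.
have [Cy Oy] := interior_subset By.
rewrite /= patchE mem_set; last exact: OA.
by rewrite lee_fin leNgt (lt_le_trans Cy (ler_norm _)).
Qed.

Lemma cvg_sqr {T : Type} (F : set_system T) {FF : Filter F} (e : T -> R) (r : R) :
  e z @[z --> F] --> r -> e z ^+ 2 @[z --> F] --> r ^+ 2.
Proof.
move=> h; have -> : (fun z => e z ^+ 2) = e \* e by apply/funext => z; rewrite expr2.
by rewrite expr2; exact: cvgM.
Qed.

Lemma enorm_continuous : continuous (@enorm R).
Proof.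
move=> x; apply: (@continuous_comp _ _ _ (fun x : plane R => x.1 ^+ 2 + x.2 ^+ 2) Num.sqrt).
  by apply: cvgD; apply: cvg_sqr; [exact: cvg_fst|exact: cvg_snd].
exact: sqrt_continuous.
Qed.

Lemma D1_norm_continuous (f : plane R -> plane R) x :
  (forall l, {for x, continuous (partial l f)}) -> {for x, continuous (D1_norm f)}.
Proof.
move=> hf.
have h l : enorm (partial l f z) ^+ 2 @[z --> x] --> enorm (partial l f x) ^+ 2.
  have h' : enorm (partial l f z) @[z --> x] --> enorm (partial l f x).
    exact: (continuous_comp (hf l) (@enorm_continuous _)).
  exact: (cvg_sqr h').
rewrite /D1_norm; apply: (@continuous_comp _ _ _ _ Num.sqrt); last exact: sqrt_continuous.
have -> : (fun z => \sum_(l < 2) enorm (partial l f z) ^+ 2) =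
    (fun z => enorm (partial ord0 f z) ^+ 2 + enorm (partial ord_max f z) ^+ 2).
  apply/funext => z; rewrite big_ord_recr big_ord1 /=.
  by congr (enorm (partial _ f z) ^+ 2 + _); exact: val_inj.
exact: cvgD.
Qed.

Lemma norm_le_enorm (x : plane R) : `|x| <= enorm x.
Proof.
have h (a b : R) : 0 <= b -> a ^+ 2 <= b -> `|a| <= Num.sqrt b.
  by move=> b0 ab; rewrite -sqrtr_sqr ler_sqrt.
rewrite prod_normE ge_max; have := sqr_ge0 x.1; have := sqr_ge0 x.2 => h2 h1.
by rewrite /enorm !h//; lra.
Qed.

Lemma partial_le_D1_norm (f : plane R -> plane R) l x : `|partial l f x| <= D1_norm f x.
Proof.
apply: le_trans (norm_le_enorm _) _; rewrite /D1_norm.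
rewrite -[leLHS]ger0_norm ?sqrtr_ge0// -sqrtr_sqr; apply: ler_wsqrtr.
rewrite (bigD1 l)//= lerDl; apply: sumr_ge0 => i _; exact: sqr_ge0.
Qed.

(** The mean value theorem is applied to each component, since it fails for vector values. The
    factor 2 comes from adding two partial derivatives with increments bounded in the max-norm. *)
Lemma D1_norm_lip (f : plane R -> plane R) (C : R) (a b : plane R) :
  (forall t : R, 0 <= t <= 1 -> differentiable f (a + t *: (b - a)) /\
     D1_norm f (a + t *: (b - a)) <= C) ->
  `|f b - f a| <= 2 * C * `|b - a|.
Proof.
move=> hf; pose k := b - a.
have e1 : b = a + (1 : R) *: k by rewrite scale1r /k addrC subrK.
have e0 : a = a + (0 : R) *: k by rewrite scale0r addr0.
have comp (p : {linear plane R -> R^o}) : (forall x, `|p x| <= `|x|) ->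
    continuous p -> `|p (f b) - p (f a)| <= 2 * C * `|b - a|.
  move=> hp cp.
  have hd (t : R) : 0 <= t <= 1 -> is_derive t (1 : R) (fun s : R => p (f (a + s *: k)))
      (p (k.1 *: partial ord0 f (a + t *: k) + k.2 *: partial ord_max f (a + t *: k))).
    move=> /hf[df _].
    have [dd ed] := is_derive_along df.
    have dp x : differentiable p x by exact: linear_differentiable.
    have dc : differentiable (fun s : R => f (a + s *: k)) t by apply/derivable1_diffP.
    have dpc := differentiable_comp dc (dp _).
    apply: DeriveDef; first exact/derivable1_diffP.
    rewrite deriveE// diff_comp//= (diff_lin _ cp); congr (p _).
    by rewrite -ed deriveE.
  have [c c01] := MVT01 hd.
  rewrite -e1 -e0 => ->.
  have [_ hC] := hf c c01.
  apply: (le_trans (hp (k.1 *: partial ord0 f (a + c *: k) +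
    k.2 *: partial ord_max f (a + c *: k)))).
  have k1 : `|k.1| <= `|k| by rewrite prod_normE le_max lexx.
  have k2 : `|k.2| <= `|k| by rewrite prod_normE le_max lexx orbT.
  have d1 := le_trans (partial_le_D1_norm f ord0 _) hC.
  have d2 := le_trans (partial_le_D1_norm f ord_max _) hC.
  rewrite -/k; move: (partial ord0 f _) (partial ord_max f _) d1 d2 => X Y d1 d2.
  apply: (le_trans (ler_normD (k.1 *: X) (k.2 *: Y))); rewrite !normrZ.
  have -> : 2 * C * `|k| = `|k| * C + `|k| * C by ring.
  by apply: lerD; apply: ler_pM.
rewrite prod_normE ge_max; apply/andP; split.
  apply: (comp fst); first by move=> x; rewrite prod_normE le_max lexx.
  by move=> x; exact: cvg_fst.
apply: (comp snd); first by move=> x; rewrite prod_normE le_max lexx orbT.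
by move=> x; exact: cvg_snd.
Qed.

End OpenSets.

Section CurvedGeometry.
Context {R : realType}.
Variable K : curved_triangle R.

Local Notation T := (core_set (core K)).
Local Notation U := (nbhd K).

Definition elt_int : set (plane R) := psi K @` core_int (core K).

Local Notation W := elt_int.

Lemma core_nbhd y : T y -> U y. Proof. exact: core_sub_nbhd. Qed.

Lemma psiK y : U y -> psi_inv K (psi K y) = y.
Proof.
move=> Uy; have [_ _ inj _ _] := psi_diffeo K.
by apply: (pinvKV (fun=> point) inj); rewrite inE.
Qed.

Lemma psi_differentiable y : U y -> differentiable (psi K) y.
Proof. by have [_ _ _ [+ _] _] := psi_diffeo K; exact. Qed.

Lemma psi_partial_differentiable l y : U y -> differentiable (partial l (psi K)) y.
Proof. by have [_ _ _ [_ /(_ l)[+ _]] _] := psi_diffeo K; exact. Qed.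

Lemma psi_partial2_continuous l m y : U y ->
  {for y, continuous (partial m (partial l (psi K)))}.
Proof. by have [_ _ _ [_ /(_ l)[_ h]] _] := psi_diffeo K; exact: h m y. Qed.

Lemma psi_continuous y : U y -> {for y, continuous (psi K)}.
Proof. by move=> Uy; apply: differentiable_continuous; exact: psi_differentiable. Qed.

Lemma psi_partial_continuous l y : U y -> {for y, continuous (partial l (psi K))}.
Proof. by move=> Uy; apply: differentiable_continuous; exact: psi_partial_differentiable. Qed.

Lemma psi_inv_differentiable y : U y -> differentiable (psi_inv K) (psi K y).
Proof. by move=> Uy; have [_ _ _ _ [+ _]] := psi_diffeo K; apply; exists y. Qed.

Lemma psi_inv_continuous y : U y -> {for psi K y, continuous (psi_inv K)}.
Proof. by move=> Uy; apply: differentiable_continuous; exact: psi_inv_differentiable. Qed.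

Lemma psi_inv_partial_continuous l y : U y ->
  {for psi K y, continuous (partial l (psi_inv K))}.
Proof.
move=> Uy; have [_ _ _ _ [_ /(_ l)[+ _]]] := psi_diffeo K.
by move=> h; apply: differentiable_continuous; apply: h; exists y.
Qed.

Lemma core_int_core y : core_int (core K) y -> T y.
Proof. exact: core_int_sub. Qed.

(** Inside the open image of U, the image of A is its preimage under the continuous inverse. *)
Lemma psi_open (A : set (plane R)) : open A -> A `<=` U -> open (psi K @` A).
Proof.
move=> oA AU; have [_ oV _ _ _] := psi_diffeo K.
rewrite openE => _ [y Ay <-].
have c := psi_inv_continuous (AU _ Ay).
have h : nbhs (psi K y) (psi_inv K @^-1` A).
  by apply: c; rewrite psiK; [apply: open_nbhs_nbhs|exact: AU].
have h' : nbhs (psi K y) (psi K @` U).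
  by apply: open_nbhs_nbhs; split => //; exists y => //; exact: AU.
apply: (@filterS _ (nbhs (psi K y)) _ (psi_inv K @^-1` A `&` psi K @` U)); last exact: filterI h h'.
by move=> x [/= Ax [z Uz zx]]; exists z => //; move: Ax; rewrite -zx psiK.
Qed.

Lemma elt_int_open : open W.
Proof.
by apply: psi_open; [exact: core_int_open|move=> y /core_int_core/core_nbhd].
Qed.

Lemma elt_int_sub : W `<=` elt_set K.
Proof. by move=> _ [y h <-]; exists y => //; exact: core_int_core. Qed.

Lemma elt_int_interior : W `<=` interior (elt_set K).
Proof. by rewrite -open_subsetE; [exact: elt_int_sub|exact: elt_int_open]. Qed.

Lemma elt_compact : compact (elt_set K).
Proof.
apply: continuous_compact; last exact: core_compact.
by apply: pointwise_within => y /core_nbhd; exact: psi_continuous.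
Qed.

Lemma psi_inv_core x : elt_set K x -> T (psi_inv K x).
Proof. by move=> [y Ty <-]; rewrite psiK//; exact: core_nbhd. Qed.

Lemma psi_invK x : elt_set K x -> psi K (psi_inv K x) = x.
Proof. by move=> [y Ty <-]; rewrite psiK//; exact: core_nbhd. Qed.

Lemma measurable_elt : measurable (elt_set K : set (mplane R)).
Proof.
apply: closed_measurable2; apply: compact_closed; first exact: norm_hausdorff.
exact: elt_compact.
Qed.

Lemma measurable_elt_int : measurable (W : set (mplane R)).
Proof. exact: open_measurable2 elt_int_open. Qed.

Lemma elt_bounded : exists2 N : R, 0 < N & elt_set K `<=` box N.
Proof.
have [N [_ hN]] := compact_bounded elt_compact.
exists (`|N| + 1); first by rewrite ltr_wpDl.
by move=> x Kx; apply: hN Kx => //; rewrite (le_lt_trans (ler_norm _))// ltrDl.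
Qed.

Lemma elt_lt_pinfty : (mu2 (elt_set K : set (mplane R)) < +oo)%E.
Proof.
have [N N0 hN] := elt_bounded.
apply: le_lt_trans (mu2_box_lt_pinfty N); apply: le_measure; rewrite ?inE//.
- exact: measurable_elt.
- exact: measurable_box.
Qed.

Definition contract (d : R) (y : plane R) : plane R :=
  (1 - d) *: y + d *: barycenter (core K).

Lemma contract_int d y : 0 < d -> d <= 1 -> T y -> core_int (core K) (contract d y).
Proof. by move=> d0 d1; apply: core_contract => //; [rewrite subr_ge0|rewrite subrK]. Qed.

Lemma contract_diff d y z : contract d y - contract d z = (1 - d) *: (y - z).
Proof. by rewrite /contract opprD addrACA subrr addr0 scalerBr. Qed.

Lemma contract_cvg y : contract d y @[d --> (0 : R)] --> y.
Proof.
have -> : contract^~ y = (fun d : R => y + d *: (barycenter (core K) - y)).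
  by apply/funext => d; rewrite /contract scalerBl scale1r scalerBr -addrA; congr (_ + _); rewrite addrC.
have [h _] := is_derive_line y (barycenter (core K) - y) (0 : R).
have c : {for (0 : R), continuous (fun d : R => y + d *: (barycenter (core K) - y))}.
  by apply: differentiable_continuous; apply/derivable1_diffP.
have e : y = y + (0 : R) *: (barycenter (core K) - y) by rewrite scale0r addr0.
by rewrite [X in _ --> X]e; exact: c.
Qed.

Section Bounds.
Variable C1 : R.
Hypothesis hC : (Lp_norm +oo T (D1_norm (psi K)) +
  Lp_norm +oo (elt_set K) (D1_norm (psi_inv K)) <= C1%:E)%E.

Lemma D1_norm_psi_le y : core_int (core K) y -> D1_norm (psi K) y <= C1.
Proof.
move=> Ty; apply: (@Lp_norm_oo_open _ T (core_int (core K)) (D1_norm (psi K)) C1 y) => //.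
- exact: core_int_open.
- exact: core_int_sub.
- apply: D1_norm_continuous => l; apply: psi_partial_continuous.
  exact/core_nbhd/core_int_core.
- by apply: le_trans hC; rewrite leeDl// Lnorm_ge0.
Qed.

Lemma D1_norm_psi_inv_le x : W x -> D1_norm (psi_inv K) x <= C1.
Proof.
move=> Wx; apply: (@Lp_norm_oo_open _ (elt_set K) W (D1_norm (psi_inv K)) C1 x) => //.
- exact: elt_int_open.
- exact: elt_int_sub.
- apply: D1_norm_continuous => l; case: Wx => y hy <-.
  exact/psi_inv_partial_continuous/core_nbhd/core_int_core.
- by apply: le_trans hC; rewrite leeDr// Lnorm_ge0.
Qed.

(** The essential bound controls the derivative only on the open core, which is convex. The estimate
    reaches the closed core by contracting both points towards the barycenter and letting the
    contraction tend to the identity. *)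
Lemma psi_lip y z : T y -> T z -> `|psi K y - psi K z| <= 2 * C1 * `|y - z|.
Proof.
move=> Ty Tz.
have C10 : 0 <= C1.
  apply: le_trans (D1_norm_psi_le (contract_int ltr01 (lexx _) Ty)); exact: sqrtr_ge0.
have int (a b : plane R) : core_int (core K) a -> core_int (core K) b ->
    `|psi K b - psi K a| <= 2 * C1 * `|b - a|.
  move=> Ta Tb; apply: D1_norm_lip => t /andP[t0 t1].
  have h : core_int (core K) (a + t *: (b - a)).
    have -> : a + t *: (b - a) = (1 - t) *: a + t *: b.
      by rewrite scalerBl scale1r scalerBr -addrA; congr (_ + _); rewrite addrC.
    by apply: core_int_convex => //; [rewrite subr_ge0|rewrite subrK].
  split; last exact: D1_norm_psi_le.
  exact/psi_differentiable/core_nbhd/core_int_core.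
apply/ler_addgt0Pr => e e0.
have e20 : 0 < e / 2 by rewrite divr_gt0.
have near_psi x : T x -> \forall d \near (0 : R)^'+, `|psi K x - psi K (contract d x)| < e / 2.
  move=> Tx; have c : psi K (contract d x) @[d --> (0 : R)] --> psi K x.
    have c0 : psi K z @[z --> x] --> psi K x by exact: psi_continuous (core_nbhd Tx).
    exact: (cvg_comp (contract^~ x) (psi K) (@contract_cvg x) c0).
  have c' := cvg_at_right_filter c.
  by move/cvgrPdist_lt: c' => /(_ _ e20).
have [d [d0 d1 hy hz]] : exists d : R, [/\ 0 < d, d <= 1,
    `|psi K y - psi K (contract d y)| < e / 2 & `|psi K z - psi K (contract d z)| < e / 2].
  have : \forall d \near (0 : R)^'+, [/\ 0 < d, d <= 1,
      `|psi K y - psi K (contract d y)| < e / 2 & `|psi K z - psi K (contract d z)| < e / 2].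
    near=> d; split.
    - by near: d; exact: nbhs_right_gt.
    - by apply/ltW; near: d; exact: nbhs_right_lt.
    - by near: d; exact: near_psi.
    - by near: d; exact: near_psi.
  by move=> /filter_ex[d hd]; exists d.
have hi := int _ _ (contract_int d0 d1 Tz) (contract_int d0 d1 Ty).
rewrite contract_diff normrZ ger0_norm ?subr_ge0// in hi.
have -> : psi K y - psi K z = (psi K y - psi K (contract d y)) +
   (psi K (contract d y) - psi K (contract d z)) - (psi K z - psi K (contract d z)).
  move: (psi K y) (psi K z) (psi K (contract d y)) (psi K (contract d z)) => a b a' b'.
  by apply: plane_eq; rewrite /=; ring.
have h3 : 2 * C1 * ((1 - d) * `|y - z|) <= 2 * C1 * `|y - z|.
  apply: ler_wpM2l; first by rewrite mulr_ge0.
  by rewrite ler_piMl// gerBl ltW.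
move: hy hz hi h3; move: (psi K y - _) (psi K z - _) (psi K (contract d y) - _) => A B D hA hB hD h3.
apply: le_trans (ler_normB _ _) _; have := ler_normD A D; lra.
Unshelve. all: by end_near. Qed.

(** Only local, because W need not be convex: the segment is kept inside a ball contained in W. This
    is why the substitution rule assumes expansion only locally in the target. *)
Lemma psi_inv_lip x : W x -> exists2 r : R, 0 < r & ball x r `<=` W /\
  forall a b, ball x r a -> ball x r b ->
    `|psi_inv K a - psi_inv K b| <= 2 * C1 * `|a - b|.
Proof.
move=> Wx.
have [r /= r0 hr] : nbhs_ball x W.
  by apply/nbhs_ballP; apply: open_nbhs_nbhs; split => //; exact: elt_int_open.
exists r => //; split => // a b xa xb; apply: D1_norm_lip => t /andP[t0 t1].
have h : W (b + t *: (a - b)).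
  apply: hr; move: xa xb; rewrite -!ball_normE /=.
  have -> : x - (b + t *: (a - b)) = t *: (x - a) + (1 - t) *: (x - b).
    by apply: plane_eq; rewrite /= /GRing.scale/=; ring.
  move: (x - a) (x - b) => A B hA hB.
  apply: le_lt_trans (ler_normD _ _) _; rewrite !normrZ (ger0_norm t0) ger0_norm ?subr_ge0//.
  have [->|tn] := eqVneq t 0; first by rewrite mul0r add0r subr0 mul1r.
  have tp : 0 < t by rewrite lt_neqAle eq_sym tn.
  have h1 : t * `|A| < t * r by rewrite ltr_pM2l.
  have h2 : (1 - t) * `|B| <= (1 - t) * r by apply: ler_wpM2l; [rewrite subr_ge0|exact: ltW].
  by rewrite (_ : r = t * r + (1 - t) * r); [exact: ltr_leD|ring].
split; last exact: D1_norm_psi_inv_le.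
by case: h => y hy <-; apply/psi_inv_differentiable/core_nbhd/core_int_core.
Qed.

Hypothesis C10 : 0 < C1.

Lemma measurable_psi_comp (V : set (mplane R)) (S0 : plane R -> plane R) :
  measurable V -> measurable_fun V (fst \o S0) -> measurable_fun V (snd \o S0) ->
  (forall a, V a -> core_int (core K) (S0 a)) ->
  measurable_fun V (fst \o (psi K \o S0)) /\ measurable_fun V (snd \o (psi K \o S0)).
Proof.
move=> mV m1 m2 hS.
have mT : measurable (core_int (core K) : set (mplane R)).
  by apply: open_measurable2; exact: core_int_open.
have mS : measurable_fun V (S0 : mplane R -> mplane R).
  have h1 := (measurable_restrictT _ mV).1 m1.
  have h2 := (measurable_restrictT _ mV).1 m2.
  have h := measurable_funS measurableT (@subsetT _ V) (measurable_fun_pair h1 h2).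
  apply: eq_measurable_fun h => x Vx /=.
  by rewrite !patchE Vx -surjective_pairing.
have im : (S0 : mplane R -> mplane R) @` V `<=` core_int (core K).
  by move=> _ [a Va <-]; exact: hS.
have cf : {within core_int (core K), continuous (psi K)}.
  by apply: pointwise_within => y /core_int_core/core_nbhd; exact: psi_continuous.
split.
  apply: (@measurable_comp _ _ _ _ _ _ _ (fst \o psi K) V S0 mT im _ mS).
  apply: within_continuous_measurable_fun2 => // y.
  exact: (cvg_comp _ _ (cf y) (@cvg_fst _ _ _ _ _)).
apply: (@measurable_comp _ _ _ _ _ _ _ (snd \o psi K) V S0 mT im _ mS).
apply: within_continuous_measurable_fun2 => // y.
exact: (cvg_comp _ _ (cf y) (@cvg_snd _ _ _ _ _)).
Qed.

Lemma elt_change_of_variables (V : set (plane R)) (S0 : plane R -> plane R) (L0 : R)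
    (g : mplane R -> R) :
  measurable (V : set (mplane R)) -> (mu2 (V : set (mplane R)) < +oo)%E ->
  measurable_fun (V : set (mplane R)) (fst \o S0) ->
  measurable_fun (V : set (mplane R)) (snd \o S0) -> 0 < L0 ->
  (forall a b, V a -> V b -> `|a - b| <= L0 * `|S0 a - S0 b|) ->
  (forall a, V a -> core_int (core K) (S0 a)) ->
  measurable_fun setT g -> (forall x, 0 <= g x) ->
  (\int[mu2]_(x in V) (g (psi K (S0 x)))%:E <=
    (4 * (L0 * (2 * C1)) ^+ 2)%:E * \int[mu2]_(x in W) (g x)%:E)%E.
Proof.
move=> mV Vfin m1 m2 L00 hL hS mg g0.
have [N N0 hN] := elt_bounded.
have [p1 p2] := measurable_psi_comp mV m1 m2 hS.
have SU a : V a -> U (S0 a) by move=> /hS/core_int_core/core_nbhd.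
apply: (@crude_change_of_variables _ V W (psi K \o S0) (L0 * (2 * C1)) (N + 1) g) => //.
- exact: elt_int_open.
- by rewrite !mulr_gt0.
- by rewrite addr_gt0.
- move=> x Wx; rewrite -ball_normE /= sub0r normrN.
  by apply: (le_lt_trans (hN x (elt_int_sub Wx))); rewrite ltrDl.
- move=> x Wx; have [r r0 [_ hr]] := psi_inv_lip Wx; exists r => // a b Va Vb xa xb.
  have := hr _ _ xa xb; rewrite /= !psiK; [|exact: SU|exact: SU] => h.
  apply: le_trans (hL a b Va Vb) _; rewrite -mulrA ler_pM2l//.
- by move=> x Vx; exists (S0 x) => //; exact: hS.
Qed.

(** The inverse of the substitution is a composition [psi] o dilation o [psi_inv], with Lipschitz
    constants 2 C1, 1/th and 2 C1. Both integrals stay on the curved element, so no area of the core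
    appears. *)
Lemma elt_affine_change_of_variables (th : R) (c : plane R) (g : mplane R -> R) :
  0 < th -> (forall y, T y -> core_int (core K) (th *: y + c)) ->
  measurable_fun setT g -> (forall x, 0 <= g x) ->
  (\int[mu2]_(x in elt_set K) (g (psi K (th *: psi_inv K x + c)))%:E <=
    (4 * (2 * C1 / th * (2 * C1)) ^+ 2)%:E * \int[mu2]_(x in W) (g x)%:E)%E.
Proof.
move=> th0 hc mg g0.
have ci : {within elt_set K, continuous (psi_inv K)}.
  by apply: pointwise_within => _ [y /core_nbhd Uy <-]; exact: psi_inv_continuous.
have ca : {within elt_set K, continuous (fun x => th *: psi_inv K x + c)}.
  by move=> x; apply: cvgD; [exact: (cvgZ (cvg_cst th) (ci x))|exact: cvg_cst].
apply: (@elt_change_of_variables (elt_set K) (fun x => th *: psi_inv K x + c)) => //.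
- exact: measurable_elt.
- exact: elt_lt_pinfty.
- apply: within_continuous_measurable_fun2 => //; first exact: measurable_elt.
  move=> x; exact: (cvg_comp _ _ (ca x) (@cvg_fst _ _ _ _ _)).
- apply: within_continuous_measurable_fun2 => //; first exact: measurable_elt.
  move=> x; exact: (cvg_comp _ _ (ca x) (@cvg_snd _ _ _ _ _)).
- by rewrite divr_gt0// mulr_gt0.
- move=> a b Ka Kb; have := psi_lip (psi_inv_core Ka) (psi_inv_core Kb).
  rewrite !psi_invK// => h; apply: (le_trans h).
  rewrite opprD addrACA subrr addr0 -scalerBr normrZ (gtr0_norm th0) mulrA divfK//.
  by rewrite gt_eqF.
- by move=> a /psi_inv_core; exact: hc.
Qed.

End Bounds.
End CurvedGeometry.

(** * The boundary of an element and the nodal values *)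

Section LipschitzCurve.
Context {R : realType}.

(** The curve is covered by n + 1 squares of side 2 (L + 1)/(n + 1), whose total area is of order
    1/n. The surplus L + 1 yields the strict inequalities that half-open squares need, also when L =
    0. *)
Lemma lipschitz_curve_negligible (c : R -> plane R) (L : R) (E : set (mplane R)) :
  0 <= L ->
  (forall s t : R, 0 <= s <= 1 -> 0 <= t <= 1 -> `|c s - c t| <= L * `|s - t|) ->
  (forall x, E x -> exists2 t : R, 0 <= t <= 1 & x = c t) ->
  mu2.-negligible E.
Proof.
move=> L0 hc hE.
pose q (n i : nat) : R * R * R := ((c (i%:R / n.+1%:R)).1 - (L + 1) / n.+1%:R,
  (c (i%:R / n.+1%:R)).2 - (L + 1) / n.+1%:R, 2 * (L + 1) / n.+1%:R).
have L1 : 0 < L + 1 by rewrite ltr_wpDl.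
have q0 n i : 0 < (q n i).2 by rewrite /= divr_gt0// mulr_gt0.
pose A n := \big[setU/set0]_(i < n.+1) hsquare (q n i).
have mA n : measurable (A n) by apply: bigsetU_measurable => i _; exact: measurable_hsquare.
have EA n : E `<=` A n.
  move=> x /hE[t /andP[t0 t1] ->].
  have n0 : 0 < n.+1%:R :> R by [].
  have [i ilt hi] : exists2 i : nat, (i < n.+1)%N & `|i%:R / n.+1%:R - t| <= n.+1%:R^-1.
    (* At t = 1 truncation would return the index n + 1, outside the range; the last sample n/(n+1)
       is close enough. *)
    have [te|tn] := eqVneq t 1.
      exists n => //; rewrite te.
      have -> : n%:R / n.+1%:R - 1 = - n.+1%:R^-1 :> R.
        have nn := lt0r_neq0 n0; rewrite -natr1 in nn *; by field.
      by rewrite normrN ger0_norm// invr_ge0 ltW.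
    have t1' : t < 1 by rewrite lt_neqAle tn.
    have tn0 : 0 <= t * n.+1%:R by rewrite mulr_ge0.
    exists (Num.trunc (t * n.+1%:R)).
      rewrite -(ltr_nat R); apply: le_lt_trans (_ : t * n.+1%:R < _).
        by rewrite truncn_le.
      by rewrite gtr_pMl.
    have h1 : (Num.trunc (t * n.+1%:R))%:R <= t * n.+1%:R by rewrite truncn_le.
    have h2 : t * n.+1%:R < (Num.trunc (t * n.+1%:R)).+1%:R by rewrite truncnS_gt.
    rewrite -[(Num.trunc _).+1%:R]natr1 in h2.
    rewrite -[X in `|_ - X|](mulfK (lt0r_neq0 n0)) -mulrBl normrM (@ger0_norm _ n.+1%:R^-1) ?invr_ge0//.
    rewrite ler_piMl ?invr_ge0// ler_norml.
    have aux (u w : R) : w <= u -> u < w + 1 -> - 1 <= w - u <= 1.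
      by move=> *; apply/andP; split; lra.
    exact: aux h1 h2.
  rewrite /A -(bigcup_mkord n.+1 (fun j => hsquare (q n j))); exists i => //=.
  have ui : 0 <= i%:R / n.+1%:R :> R by rewrite divr_ge0.
  have ui1 : i%:R / n.+1%:R <= 1 :> R by rewrite ler_pdivrMr// mul1r ler_nat ltnW.
  have h : `|c (i%:R / n.+1%:R) - c t| <= L / n.+1%:R.
    apply: le_trans (hc _ _ _ _) _; [by rewrite ui|by rewrite t0|].
    by rewrite ler_wpM2l.
  have hL : L / n.+1%:R < (L + 1) / n.+1%:R by rewrite ltr_pM2r ?invr_gt0// ltrDl.
  have hL2 : 2 * (L + 1) / n.+1%:R = (L + 1) / n.+1%:R + (L + 1) / n.+1%:R by rewrite -mulrA; ring.
  have aux (u v a b : R) : `|u - v| <= a -> a < b -> u - b <= v < u - b + (b + b).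
    by rewrite ler_norml => /andP[? ?] ?; apply/andP; split; lra.
  move: h; rewrite prod_normE ge_max /= => /andP[k1 k2].
  by rewrite /hsquare/q/= !in_itv/= hL2; split; [exact: aux k1 hL|exact: aux k2 hL].
have mN : measurable (\bigcap_n A n) by exact: bigcapT_measurable.
exists (\bigcap_n A n); split => //; last by move=> x Ex n _; exact: EA.
have muA n : (mu2 (A n) <= (4 * (L + 1) ^+ 2 / n.+1%:R)%:E)%E.
  have hB := @Boole_inequality _ _ _ mu2 (fun i => hsquare (q n i)) n.+1
    (fun i _ => measurable_hsquare (q n i)).
  apply: (le_trans hB).
  rewrite (eq_bigr (fun=> ((2 * (L + 1) / n.+1%:R) ^+ 2)%:E)); last first.
    by move=> i _; exact: mu2_hsquare (q0 n i).
  rewrite sumEFin lee_fin sumr_const card_ord -[leLHS]mulr_natr le_eqVlt; apply/orP; left; apply/eqP.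
  have : n.+1%:R != 0 :> R by rewrite pnatr_eq0.
  by move: (n.+1%:R : R) => u u0; field.
apply/eqP; rewrite eq_le measure_ge0 andbT; apply/lee_addgt0Pr => e e0; rewrite add0e.
pose n := Num.bound (4 * (L + 1) ^+ 2 / e).
apply: (@le_trans _ _ (mu2 (A n))).
  by apply: le_measure; rewrite ?inE// => x; apply.
apply: le_trans (muA n) _; rewrite lee_fin ler_pdivrMr// [leRHS]mulrC -ler_pdivrMr//.
apply: le_trans (_ : n%:R <= _); last by rewrite ler_nat.
apply/ltW/archi_boundP; apply: divr_ge0; [by rewrite mulr_ge0 ?sqr_ge0|exact: ltW].
Qed.

End LipschitzCurve.

Section Boundary.
Context {R : realType}.
Variable K : curved_triangle R.

Local Notation T := (core_set (core K)).
Local Notation W := (elt_int K).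

Lemma elt_int_dense x (O : set (plane R)) : elt_set K x -> open O -> O x ->
  exists2 z, W z & O z.
Proof.
move=> Kx oO Ox.
have Ty := psi_inv_core Kx; have Uy := core_nbhd Ty.
have c0 : psi K z @[z --> psi_inv K x] --> x.
  by rewrite -[X in _ --> X](psi_invK Kx); exact: psi_continuous Uy.
have c := cvg_comp (contract K ^~ (psi_inv K x)) (psi K) (@contract_cvg _ K (psi_inv K x)) c0.
have nO : nbhs x O by apply: open_nbhs_nbhs.
have : \forall d \near (0 : R)^'+, [/\ 0 < d, d <= 1 & O (psi K (contract K d (psi_inv K x)))].
  near=> d; split.
  - by near: d; exact: nbhs_right_gt.
  - by apply/ltW; near: d; exact: nbhs_right_lt.
  - by near: d; exact: (cvg_at_right_filter c) nO.
move=> /filter_ex[d [d0 d1 Od]].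
exists (psi K (contract K d (psi_inv K x))) => //.
by exists (contract K d (psi_inv K x)) => //; exact: contract_int.
Unshelve. all: by end_near. Qed.

(** A point of the core outside [core_int] has a vanishing barycentric coordinate, so its image lies
    on one of three Lipschitz curves. Statements proved almost everywhere on W thereby extend to the
    whole element. *)
Lemma elt_boundary_null (C1 : R) : 0 < C1 ->
  (Lp_norm +oo T (D1_norm (psi K)) +
   Lp_norm +oo (elt_set K) (D1_norm (psi_inv K)) <= C1%:E)%E ->
  mu2 (elt_set K `\` W : set (mplane R)) = 0%E.
Proof.
move=> C10 hC.
have mB : measurable (elt_set K `\` W : set (mplane R)).
  by apply: measurableD; [exact: measurable_elt|exact: measurable_elt_int].
pose E (a b : 'I_3) : set (mplane R) := [set x | exists2 t : R, 0 <= t <= 1 &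
  x = psi K ((1 - t) *: vert (core K) a + t *: vert (core K) b)].
have nE a b : mu2.-negligible (E a b).
  pose v := vert (core K).
  apply: (@lipschitz_curve_negligible _ (fun t => psi K ((1 - t) *: v a + t *: v b))
    (2 * C1 * `|v b - v a|)) => //.
    by rewrite !mulr_ge0// ltW.
  move=> s t /andP[s0 s1] /andP[t0 t1].
  have hT (r : R) : 0 <= r -> r <= 1 -> T ((1 - r) *: v a + r *: v b).
    move=> r0 r1; apply: core_convex => //; try exact: core_vert.
      by rewrite subr_ge0.
    by rewrite subrK.
  apply: le_trans (psi_lip hC (hT _ s0 s1) (hT _ t0 t1)) _.
  have -> : (1 - s) *: v a + s *: v b - ((1 - t) *: v a + t *: v b) = (s - t) *: (v b - v a).
    by apply: plane_eq; rewrite /= /GRing.scale/=; ring.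
  by rewrite normrZ [X in _ * X]mulrC mulrA.
apply/negligibleP => //.
have : mu2.-negligible (E i31 i32 `|` (E i30 i32 `|` E i30 i31)).
  by apply: negligibleU => //; exact: negligibleU.
apply: negligibleS => x [Kx nWx].
have Ty := psi_inv_core Kx; have ex := psi_invK Kx.
have /existsNP[k hk] : ~ core_int (core K) (psi_inv K x).
  by move=> h; apply: nWx; exists (psi_inv K x).
have b0 := (core_setP _ _).1 Ty.
have bk : bary (core K) k (psi_inv K x) = 0.
  by apply/eqP; rewrite eq_le b0 andbT leNgt; apply/negP.
have := bary_point (core K) (psi_inv K x); have := bary_sum (core K) (psi_inv K x).
rewrite !sum3 => s1 sy.
have := b0 i30; have := b0 i31; have := b0 i32.
move: bk s1 sy; case: (I3P k) => -> -> s1 sy q2 q1 q0.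
- left; exists (bary (core K) i32 (psi_inv K x)); first by apply/andP; split; lra.
  rewrite -{1}ex -{1}sy scale0r add0r; congr (psi K (_ *: _ + _)); lra.
- right; left; exists (bary (core K) i32 (psi_inv K x)); first by apply/andP; split; lra.
  rewrite -{1}ex -{1}sy scale0r addr0; congr (psi K (_ *: _ + _)); lra.
- right; right; exists (bary (core K) i31 (psi_inv K x)); first by apply/andP; split; lra.
  rewrite -{1}ex -{1}sy scale0r addr0; congr (psi K (_ *: _ + _)); lra.
Qed.

(** Identifies the representative selected by choice with a constructed one. If two continuous
    representatives differed at a point, they would differ on a relatively open set; this meets the
    dense open W in a nonempty open set, against equality almost everywhere. *)
Lemma continuous_rep_unique (v w : plane R -> R) : is_continuous_rep (elt_set K) v w ->
  forall x, elt_set K x -> continuous_rep (elt_set K) v x = w x.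
Proof.
move=> hw x Kx.
have [cr1 cr2] : is_continuous_rep (elt_set K) v (continuous_rep (elt_set K) v).
  exact: (@xgetPex _ v [set w | is_continuous_rep (elt_set K) v w] (ex_intro _ w hw)).
have [w1 w2] := hw; move: cr1 cr2; set r := continuous_rep _ v => r1 r2.
apply/eqP; apply: contrapT => /negP/eqP hne.
pose h y := r y - w y.
have ch : {within elt_set K, continuous h} by move=> y; apply: cvgB; [exact: r1|exact: w1].
move/continuousP : ch => /(_ [set z | z != 0]).
have o0 : open [set z : R | z != 0] by exact: open_neq.
move=> /(_ o0) /open_subspaceP[V oV VE].
have Vx : V x.
  suff : (V `&` elt_set K) x by case.
  by rewrite VE; split => //=; rewrite /h subr_eq0; apply/eqP.
have [z Wz Vz] := elt_int_dense Kx oV Vx.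
have ae : {ae mu2, forall y : mplane R, elt_set K y -> r y = w y}.
  apply: (negligibleS _ (negligibleU r2 w2)) => y /= hy.
  apply: contrapT => /not_orP[/contrapT h1 /contrapT h2]; apply: hy => Ky.
  by rewrite h1// h2.
have oVW : open (V `&` W) by apply: openI => //; exact: elt_int_open.
have [y [Vy Wy] hy] := ae_open_exists oVW (conj Vz Wz) ae.
have Ky := elt_int_sub Wy.
have : (V `&` elt_set K) y by split.
have e : h y = 0 by apply/eqP; rewrite subr_eq0; apply/eqP; exact: hy.
rewrite VE => -[hn _].
by have : h y != 0 := hn; rewrite e eqxx.
Qed.

(** Under [affine_map] the reference coordinates become the last two barycentric coordinates. This
    gives injectivity on the reference triangle, hence the value of the partial inverse. *)
Lemma lagrange_interpE (v : plane R -> R) x : elt_set K x ->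
  lagrange_interp K v x = \sum_(k < 3) bary (core K) k (psi_inv K x) *
    continuous_rep (elt_set K) v (psi K (vert (core K) k)).
Proof.
move=> Kx; have Ty := psi_inv_core Kx.
pose c := core K.
have d0 : core_det c != 0 by exact: core_nondegenerate.
have b1 a : bary c i31 (affine_map c a) = a.1.
  move: d0; rewrite /bary /affine_map /core_det /det2 /=; case: a => a b.
  by case: (p1 c) (p2 c) (p3 c) => [q r] [u w] [s t] /= h; rewrite /GRing.scale/=; field.
have b2 a : bary c i32 (affine_map c a) = a.2.
  move: d0; rewrite /bary /affine_map /core_det /det2 /=; case: a => a b.
  by case: (p1 c) (p2 c) (p3 c) => [q r] [u w] [s t] /= h; rewrite /GRing.scale/=; field.
have refT a : ref_triangle a -> T (affine_map c a).
  move=> [s [t [u [s0 t0 u0 stu ->]]]]; exists s, t, u; split => //.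
  have -> : s = 1 - t - u by rewrite -stu; ring.
  rewrite /affine_map -/c; case: (p1 c) (p2 c) (p3 c) => [q r] [m w] [l o].
  by apply: plane_eq; rewrite /= /GRing.scale/=; ring.
have [_ _ psi_inj _ _] := psi_diffeo K.
have inj : {in @ref_triangle R &, injective (elt_map K)}.
  move=> a b; rewrite !inE => ra rb /psi_inj.
  rewrite !inE => /(_ (core_nbhd (refT _ ra)) (core_nbhd (refT _ rb))) e.
  by apply: plane_eq; [rewrite -b1 e b1|rewrite -b2 e b2].
pose y := psi_inv K x; pose a : plane R := (bary c i31 y, bary c i32 y).
have b0 := (core_setP _ _).1 Ty.
have s1 := bary_sum c y; rewrite sum3 in s1.
have ra : ref_triangle a.
  exists (bary c i30 y), (bary c i31 y), (bary c i32 y); split => //; try exact: b0.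
  by apply: plane_eq; rewrite /= /GRing.scale/=; ring.
have ea : elt_map K a = x.
  rewrite /elt_map /= -(psi_invK Kx); congr psi; rewrite -/y -[RHS](bary_point c) sum3.
  have -> : bary c i30 y = 1 - bary c i31 y - bary c i32 y by rewrite -s1; ring.
  rewrite /affine_map /a /vert /= -/c; move: (bary c i31 y) (bary c i32 y) => s t.
  case: (p1 c) (p2 c) (p3 c) => [q r] [m w] [l o].
  by apply: plane_eq; rewrite /= /GRing.scale/=; ring.
have ei : elt_map_inv K x = a.
  by rewrite -ea; apply: (pinvKV (fun=> point) inj); rewrite inE.
rewrite /lagrange_interp /lagrange_C0 /= ei /ref_interp /= sum3 -/y -/c.
rewrite /elt_map /= /vert /=.
have v0 : affine_map c (0, 0) = p1 c by rewrite /affine_map /= !scale0r !addr0.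
have v1 : affine_map c (1, 0) = p2 c.
  by rewrite /affine_map /= scale0r scale1r addr0 addrC subrK.
have v2 : affine_map c (0, 1) = p3 c.
  by rewrite /affine_map /= scale0r scale1r addr0 addrC subrK.
rewrite v0 v1 v2; have -> : bary c i30 y = 1 - bary c i31 y - bary c i32 y by rewrite -s1; ring.
by rewrite [in LHS](mulrC _ (_ - _)) [in LHS](mulrC _ (bary _ i31 _)) [in LHS](mulrC _ (bary _ i32 _)).
Qed.

End Boundary.

(** * The pointwise interpolation error *)

Section Vectors.
Context {R : realType}.

Lemma sum2 (V : nmodType) (F : 'I_2 -> V) : \sum_(l < 2) F l = F ord0 + F ord_max.
Proof.
by rewrite big_ord_recr big_ord1 /=; congr (F _ + F _); exact: val_inj.
Qed.

Lemma coord0 (x : plane R) : coord ord0 x = x.1. Proof. by []. Qed.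
Lemma coord1 (x : plane R) : coord ord_max x = x.2. Proof. by []. Qed.

Lemma coordD l (x y : plane R) : coord l (x + y) = coord l x + coord l y.
Proof. by rewrite /coord; case: ifP. Qed.

Lemma coordZ l (a : R) (x : plane R) : coord l (a *: x) = a * coord l x.
Proof. by rewrite /coord; case: ifP. Qed.

(** Pointwise forms of [grad_dot] and [hess_apply]: vectors replace the vector fields so that
    bilinearity can be stated. *)
Definition gradv (g : 'I_2 -> plane R -> R) (x p : plane R) : R :=
  \sum_(l < 2) g l x * coord l p.

Definition hessv (H : 'I_2 -> 'I_2 -> plane R -> R) (x p q : plane R) : R :=
  \sum_(l < 2) \sum_(m < 2) H l m x * coord l p * coord m q.

Lemma gradv_comb g x (a b : R) (p q : plane R) :
  gradv g x (a *: p + b *: q) = a * gradv g x p + b * gradv g x q.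
Proof. by rewrite /gradv !sum2 !coordD !coordZ; ring. Qed.

Lemma hessv_comb H x (a b a' b' : R) (p q p' q' : plane R) :
  hessv H x (a *: p + b *: q) (a' *: p' + b' *: q') =
  a * (a' * hessv H x p p' + b' * hessv H x p q') +
  b * (a' * hessv H x q p' + b' * hessv H x q q').
Proof. by rewrite /hessv !sum2 !coordD !coordZ; ring. Qed.

Lemma D1E (f : plane R -> plane R) x (p : plane R) :
  D1 f x p = p.1 *: partial ord0 f x + p.2 *: partial ord_max f x.
Proof. exact: sum2. Qed.

(** [D2] with its derivatives replaced by an arbitrary array of vectors, so that algebraic
    identities do not see the limits inside [partial]. *)
Definition tensor (X : 'I_2 -> 'I_2 -> plane R) (p q : plane R) : plane R :=
  ((p.1 * q.1) *: X ord0 ord0 + (p.1 * q.2) *: X ord0 ord_max) +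
  ((p.2 * q.1) *: X ord_max ord0 + (p.2 * q.2) *: X ord_max ord_max).

Lemma D2E (f : plane R -> plane R) x :
  D2 f x = tensor (fun l m => partial l (partial m f) x).
Proof.
apply/funext => p; apply/funext => q.
by apply: etrans (sum2 _) _; congr (_ + _); exact: sum2.
Qed.

Lemma tensor_comb X (a b a' b' : R) (p q p' q' : plane R) :
  tensor X (a *: p + b *: q) (a' *: p' + b' *: q') =
  a *: (a' *: tensor X p p' + b' *: tensor X p q') +
  b *: (a' *: tensor X q p' + b' *: tensor X q q').
Proof. by apply: plane_eq; rewrite /tensor /= /GRing.scale/=; ring. Qed.

Lemma D1_comb (f : plane R -> plane R) x (a b : R) (p q : plane R) :
  D1 f x (a *: p + b *: q) = a *: D1 f x p + b *: D1 f x q.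
Proof.
rewrite !D1E; move: (partial ord0 f x) (partial ord_max f x) => X Y.
by apply: plane_eq; rewrite /= /GRing.scale/=; ring.
Qed.

Lemma D2_comb (f : plane R -> plane R) x (a b a' b' : R) (p q p' q' : plane R) :
  D2 f x (a *: p + b *: q) (a' *: p' + b' *: q') =
  a *: (a' *: D2 f x p p' + b' *: D2 f x p q') +
  b *: (a' *: D2 f x q p' + b' *: D2 f x q q').
Proof.
by rewrite (D2E f x); exact: tensor_comb.
Qed.

Lemma is_derive_linear (p : {linear plane R -> R^o}) (c : R -> plane R) (t : R) (d : plane R) :
  continuous p -> is_derive t (1 : R) c d -> is_derive t (1 : R) (fun s => p (c s)) (p d).
Proof.
move=> cp [dd ed].
have dp x : differentiable p x by exact: linear_differentiable.
have dc : differentiable c t by apply/derivable1_diffP.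
have dpc := differentiable_comp dc (dp _).
apply: DeriveDef; first exact/derivable1_diffP.
rewrite deriveE// diff_comp//= (diff_lin _ cp); congr (p _).
by rewrite -ed deriveE.
Qed.

Lemma is_derive_coord l (c : R -> plane R) (t : R) (d : plane R) :
  is_derive t (1 : R) c d -> is_derive t (1 : R) (fun s => coord l (c s)) (coord l d).
Proof.
move=> h; case: (I2P l) => ->.
  by apply: (@is_derive_linear fst) h => x; exact: cvg_fst.
by apply: (@is_derive_linear snd) h => x; exact: cvg_snd.
Qed.

Lemma coord_cvg {T : Type} (F : set_system T) {FF : Filter F} l (c : T -> plane R)
    (x : plane R) : c z @[z --> F] --> x -> coord l (c z) @[z --> F] --> coord l x.
Proof.
move=> h; case: (I2P l) => ->.
  exact: (cvg_comp c fst h (@cvg_fst _ _ _ _ _)).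
exact: (cvg_comp c snd h (@cvg_snd _ _ _ _ _)).
Qed.

Lemma gradv_cvg {T : Type} (F : set_system T) {FF : Filter F}
    (g : 'I_2 -> plane R -> R) (a b : T -> plane R) (x y : plane R) :
  (forall l, {for x, continuous (g l)}) ->
  a z @[z --> F] --> x -> b z @[z --> F] --> y ->
  gradv g (a z) (b z) @[z --> F] --> gradv g x y.
Proof.
move=> cg ha hb; rewrite /gradv sum2.
have -> : (fun z => \sum_(l < 2) g l (a z) * coord l (b z)) =
   (fun z => g ord0 (a z) * coord ord0 (b z) + g ord_max (a z) * coord ord_max (b z)).
  by apply/funext => z; rewrite sum2.
have h l : g l (a z) * coord l (b z) @[z --> F] --> g l x * coord l y.
  have h1 : g l (a z) @[z --> F] --> g l x by exact: (cvg_comp a (g l) ha (cg l)).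
  have h2 : coord l (b z) @[z --> F] --> coord l y by exact: coord_cvg.
  exact: (cvgM h1 h2).
exact: (cvgD (h ord0) (h ord_max)).
Qed.

Lemma hessv_cvg {T : Type} (F : set_system T) {FF : Filter F}
    (H : 'I_2 -> 'I_2 -> plane R -> R) (a b c : T -> plane R) (x y w : plane R) :
  (forall l m, {for x, continuous (H l m)}) ->
  a z @[z --> F] --> x -> b z @[z --> F] --> y -> c z @[z --> F] --> w ->
  hessv H (a z) (b z) (c z) @[z --> F] --> hessv H x y w.
Proof.
move=> cH ha hb hc.
pose s l z := gradv (fun m => H l m) (a z) (c z).
have hs l : s l z @[z --> F] --> gradv (fun m => H l m) x w.
  by apply: gradv_cvg => // m; exact: cH.
have e u p q : hessv H u p q = coord ord0 p * gradv (fun m => H ord0 m) u q +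
    coord ord_max p * gradv (fun m => H ord_max m) u q.
  by rewrite /hessv /gradv !sum2; ring.
rewrite e.
have -> : (fun z => hessv H (a z) (b z) (c z)) =
   (fun z => coord ord0 (b z) * s ord0 z + coord ord_max (b z) * s ord_max z).
  by apply/funext => z; rewrite e.
have h l : coord l (b z) * s l z @[z --> F] --> coord l y * gradv (fun m => H l m) x w.
  have h2 : coord l (b z) @[z --> F] --> coord l y by exact: coord_cvg.
  exact: (cvgM h2 (hs l)).
exact: (cvgD (h ord0) (h ord_max)).
Qed.

Lemma D1_continuous (f : plane R -> plane R) (y p : plane R) :
  (forall l, {for y, continuous (partial l f)}) ->
  D1 f z p @[z --> y] --> D1 f y p.
Proof.
move=> h; rewrite D1E (_ : (fun z => D1 f z p) =
    (fun z => p.1 *: partial ord0 f z + p.2 *: partial ord_max f z)); last first.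
  by apply/funext => z; exact: D1E.
have h' (c : R) l : c *: partial l f z @[z --> y] --> c *: partial l f y.
  exact: (cvgZ (cvg_cst _) (h l)).
exact: (cvgD (h' _ ord0) (h' _ ord_max)).
Qed.

Lemma D2_continuous (f : plane R -> plane R) (y p q : plane R) :
  (forall l m, {for y, continuous (partial l (partial m f))}) ->
  D2 f z p q @[z --> y] --> D2 f y p q.
Proof.
move=> h.
have e z : D2 f z p q = q.1 *: D1 (partial ord0 f) z p + q.2 *: D1 (partial ord_max f) z p.
  have aux (X : 'I_2 -> 'I_2 -> plane R) : tensor X p q =
      q.1 *: (p.1 *: X ord0 ord0 + p.2 *: X ord_max ord0) +
      q.2 *: (p.1 *: X ord0 ord_max + p.2 *: X ord_max ord_max).
    by apply: plane_eq; rewrite /tensor /= /GRing.scale/=; ring.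
  have d2 : D2 f z p q = tensor (fun l m => partial l (partial m f) z) p q by rewrite D2E.
  by apply: (etrans d2); apply: (etrans (aux _)); congr (_ *: _ + _ *: _); rewrite D1E.
rewrite e (_ : (fun z => D2 f z p q) = (fun z => q.1 *: D1 (partial ord0 f) z p +
    q.2 *: D1 (partial ord_max f) z p)); last by apply/funext => z; rewrite e.
have h' (r : R) l : r *: D1 (partial l f) z p @[z --> y] --> r *: D1 (partial l f) y p.
  apply: (cvgZ (cvg_cst _)); apply: D1_continuous => m; exact: h.
exact: (cvgD (h' _ ord0) (h' _ ord_max)).
Qed.

End Vectors.

Section LineDerivatives.
Context {R : realType}.
Variables (K : curved_triangle R) (v : plane R -> R)
  (g : 'I_2 -> plane R -> R) (H : 'I_2 -> 'I_2 -> plane R -> R).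

(** The first derivative of v o psi at [a] along [d], and below it the second one along [d] and then
    [e], when [g] and [H] are the derivatives of v. In [D2] the direction of the last
    differentiation comes first, whence the order e, d. *)
Definition pull_grad (a d : plane R) : R := gradv g (psi K a) (D1 (psi K) a d).

Definition pull_hess (a d e : plane R) : R :=
  hessv H (psi K a) (D1 (psi K) a d) (D1 (psi K) a e) +
  gradv g (psi K a) (D2 (psi K) a e d).

Lemma pull_derive (z k : plane R) (t : R) : nbhd K (z + t *: k) ->
  differentiable (v : plane R -> R^o) (psi K (z + t *: k)) ->
  (forall l, partial l (v : plane R -> R^o) (psi K (z + t *: k)) = g l (psi K (z + t *: k))) ->
  is_derive t (1 : R) (fun s : R => v (psi K (z + s *: k))) (pull_grad (z + t *: k) k).
Proof.
move=> Ua dv ev; have dp := is_derive_along (psi_differentiable Ua).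
apply: (is_derive_eq (is_derive_curve dv dp)).
rewrite !ev /pull_grad /gradv sum2 D1E coord0 coord1.
move: (partial _ _ _) (partial _ _ _) => X Y; rewrite /= /GRing.scale/=; ring.
Qed.

Lemma pull_grad_derive (z k d : plane R) (t : R) : nbhd K (z + t *: k) ->
  (forall l, differentiable (g l : plane R -> R^o) (psi K (z + t *: k))) ->
  (forall l m, partial m (g l : plane R -> R^o) (psi K (z + t *: k)) =
     H l m (psi K (z + t *: k))) ->
  is_derive t (1 : R) (fun s : R => pull_grad (z + s *: k) d) (pull_hess (z + t *: k) d k).
Proof.
move=> Ua dg eg; have dp := is_derive_along (psi_differentiable Ua).
have d1 l := is_derive_curve (dg l) dp.
have d2 l := is_derive_coord l (is_deriveD
  (is_deriveZ (coord ord0 d) (is_derive_along (psi_partial_differentiable ord0 Ua)))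
  (is_deriveZ (coord ord_max d) (is_derive_along (psi_partial_differentiable ord_max Ua)))).
have d3 := is_deriveD (is_deriveM (d1 ord0) (d2 ord0)) (is_deriveM (d1 ord_max) (d2 ord_max)).
have e : (fun s : R => pull_grad (z + s *: k) d) = (fun s : R =>
   g ord0 (psi K (z + s *: k)) * coord ord0 (coord ord0 d *: partial ord0 (psi K) (z + s *: k) +
     coord ord_max d *: partial ord_max (psi K) (z + s *: k)) +
   g ord_max (psi K (z + s *: k)) * coord ord_max (coord ord0 d *: partial ord0 (psi K) (z + s *: k) +
     coord ord_max d *: partial ord_max (psi K) (z + s *: k))).
  by apply/funext => s; rewrite /pull_grad /gradv sum2 D1E.
rewrite e; apply: (is_derive_eq d3).
rewrite /pull_hess /hessv /gradv !sum2 D2E !D1E !eg !coord0 !coord1.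
(* The chain rule as a polynomial identity in abstract values of the derivatives, where [ring] can
   decide it. *)
have aux (X : 'I_2 -> 'I_2 -> plane R) (S0 S1 : plane R) (g0 g1 : R)
    (h : 'I_2 -> 'I_2 -> R) :
  g0 * (d.1 *: (k.1 *: X ord0 ord0 + k.2 *: X ord_max ord0) +
        d.2 *: (k.1 *: X ord0 ord_max + k.2 *: X ord_max ord_max)).1 +
  (d.1 *: S0 + d.2 *: S1).1 *
    ((k.1 *: S0 + k.2 *: S1).1 * h ord0 ord0 + (k.1 *: S0 + k.2 *: S1).2 * h ord0 ord_max) +
  (g1 * (d.1 *: (k.1 *: X ord0 ord0 + k.2 *: X ord_max ord0) +
        d.2 *: (k.1 *: X ord0 ord_max + k.2 *: X ord_max ord_max)).2 +
  (d.1 *: S0 + d.2 *: S1).2 *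
    ((k.1 *: S0 + k.2 *: S1).1 * h ord_max ord0 + (k.1 *: S0 + k.2 *: S1).2 * h ord_max ord_max)) =
  h ord0 ord0 * (d.1 *: S0 + d.2 *: S1).1 * (k.1 *: S0 + k.2 *: S1).1 +
  h ord0 ord_max * (d.1 *: S0 + d.2 *: S1).1 * (k.1 *: S0 + k.2 *: S1).2 +
  (h ord_max ord0 * (d.1 *: S0 + d.2 *: S1).2 * (k.1 *: S0 + k.2 *: S1).1 +
   h ord_max ord_max * (d.1 *: S0 + d.2 *: S1).2 * (k.1 *: S0 + k.2 *: S1).2) +
  (g0 * (tensor X k d).1 + g1 * (tensor X k d).2).
  by rewrite /tensor /= /GRing.scale/=; ring.
exact: (aux (fun l m => partial l (partial m (psi K)) (z + t *: k))
  (partial ord0 (psi K) (z + t *: k)) (partial ord_max (psi K) (z + t *: k))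
  (g ord0 (psi K (z + t *: k))) (g ord_max (psi K (z + t *: k)))
  (fun l m => H l m (psi K (z + t *: k)))).
Qed.

End LineDerivatives.

Section PointwiseError.
Context {R : realType}.
Let mu := @lebesgue_measure R.
Variables (K : curved_triangle R) (v : plane R -> R)
  (g : 'I_2 -> plane R -> R) (H : 'I_2 -> 'I_2 -> plane R -> R).

Local Notation T := (core_set (core K)).
Local Notation r_ := (r_dir (core K)).
Local Notation h_ := (h_dir (core K)).

(** The weighted sum of the integrands on the right-hand side of the estimate, transported to the
    core. *)
Definition density (a : plane R) : R :=
  \sum_(i < 2) \sum_(j < 2) h_ i * h_ j *
   (`|hessv H (psi K a) (D1 (psi K) a (r_ i)) (D1 (psi K) a (r_ j))| +
    `|gradv g (psi K a) (D2 (psi K) a (r_ i) (r_ j))|).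

Lemma density_psi_inv x : elt_set K x -> density (psi_inv K x) =
  \sum_(i < 2) \sum_(j < 2) h_ i * h_ j *
   (`|hess_apply H (tau K i) (tau K j) x| + `|grad_dot g (bfield K i j) x|).
Proof.
move=> Kx; rewrite /density psi_invK//.
Qed.

Lemma density_ge0 a : 0 <= density a.
Proof.
apply: sumr_ge0 => i _; apply: sumr_ge0 => j _; apply: mulr_ge0.
  by apply: mulr_ge0; exact: h_dir_ge0.
exact: addr_ge0.
Qed.

(** Each edge vector is h_i r_i, so the bilinear expansion produces exactly the weights h_i h_j with
    coefficients of modulus at most 1. *)
Lemma pull_hess_le (a : plane R) (c : 'I_2 -> R) :
  (forall i, `|c i| <= 1) ->
  `|pull_hess K g H a (\sum_(i < 2) c i *: edge_dir (core K) i)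
      (\sum_(i < 2) c i *: edge_dir (core K) i)| <= density a.
Proof.
move=> hc.
have -> : \sum_(i < 2) c i *: edge_dir (core K) i =
    (c ord0 * h_ ord0) *: r_ ord0 + (c ord_max * h_ ord_max) *: r_ ord_max.
  by rewrite sum2 !edge_dirE; congr (_ + _); exact: scalerA.
rewrite /pull_hess.
rewrite D1_comb D2_comb hessv_comb !gradv_comb /density !sum2.
have ha i : `|c i * h_ i| <= h_ i.
  by rewrite normrM (ger0_norm (h_dir_ge0 _ _)) ler_piMl// h_dir_ge0.
move: (ha ord0) (ha ord_max); move: (c ord0 * _) (c ord_max * _) => s t.
move: (h_ ord0) (h_ ord_max) => p q hs ht.
have term (x y x' y' X Y : R) : `|x| <= x' -> `|y| <= y' ->
    `|x * y * X + x * y * Y| <= x' * y' * (`|X| + `|Y|).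
  move=> hx hy; rewrite -mulrDr !normrM; apply: ler_pM => //; last exact: ler_normD.
  exact: ler_pM.
have aux (X Y : 'I_2 -> 'I_2 -> R) :
   `|s * (s * X ord0 ord0 + t * X ord0 ord_max) + t * (s * X ord_max ord0 + t * X ord_max ord_max) +
     (s * (s * Y ord0 ord0 + t * Y ord0 ord_max) + t * (s * Y ord_max ord0 + t * Y ord_max ord_max))| <=
   (p * p * (`|X ord0 ord0| + `|Y ord0 ord0|) + p * q * (`|X ord0 ord_max| + `|Y ord0 ord_max|)) +
   (q * p * (`|X ord_max ord0| + `|Y ord_max ord0|) + q * q * (`|X ord_max ord_max| + `|Y ord_max ord_max|)).
  rewrite [X in `|X|](_ : _ =
   (s * s * X ord0 ord0 + s * s * Y ord0 ord0 + (s * t * X ord0 ord_max + s * t * Y ord0 ord_max)) +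
   (t * s * X ord_max ord0 + t * s * Y ord_max ord0 + (t * t * X ord_max ord_max + t * t * Y ord_max ord_max)));
   last by ring.
  apply: le_trans (ler_normD _ _) _; apply: lerD;
    by apply: le_trans (ler_normD _ _) _; apply: lerD; exact: term.
exact: (aux (fun i j => hessv H (psi K a) (D1 (psi K) a (r_ i)) (D1 (psi K) a (r_ j)))
  (fun i j => gradv g (psi K a) (D2 (psi K) a (r_ i) (r_ j)))).
Qed.

Hypothesis cg : forall l, continuous (g l).
Hypothesis cH : forall l m, continuous (H l m).

Lemma pull_hess_continuous a d e : nbhd K a -> {for a, continuous (fun a => pull_hess K g H a d e)}.
Proof.
move=> Ua.
have c0 : psi K z @[z --> a] --> psi K a by exact: psi_continuous Ua.
have c1 p : D1 (psi K) z p @[z --> a] --> D1 (psi K) a p.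
  by apply: D1_continuous => l; exact: psi_partial_continuous Ua.
have c2 p q : D2 (psi K) z p q @[z --> a] --> D2 (psi K) a p q.
  by apply: D2_continuous => l m; exact: psi_partial2_continuous Ua.
have h1 : hessv H (psi K z) (D1 (psi K) z d) (D1 (psi K) z e) @[z --> a] -->
    hessv H (psi K a) (D1 (psi K) a d) (D1 (psi K) a e).
  by apply: hessv_cvg => // l m; exact: cH.
have h2 : gradv g (psi K z) (D2 (psi K) z e d) @[z --> a] -->
    gradv g (psi K a) (D2 (psi K) a e d).
  by apply: gradv_cvg => // l; exact: cg.
exact: (cvgD h1 h2).
Qed.

Lemma pull_grad_continuous a d : nbhd K a -> {for a, continuous (fun a => pull_grad K g a d)}.
Proof.
move=> Ua.
have c0 : psi K z @[z --> a] --> psi K a by exact: psi_continuous Ua.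
have c1 p : D1 (psi K) z p @[z --> a] --> D1 (psi K) a p.
  by apply: D1_continuous => l; exact: psi_partial_continuous Ua.
have h2 : gradv g (psi K z) (D1 (psi K) z d) @[z --> a] -->
    gradv g (psi K a) (D1 (psi K) a d).
  by apply: gradv_cvg => // l; exact: cg.
exact: h2.
Qed.

Lemma density_continuous a : nbhd K a -> {for a, continuous density}.
Proof.
move=> Ua.
have c0 : psi K z @[z --> a] --> psi K a by exact: psi_continuous Ua.
have c1 p : D1 (psi K) z p @[z --> a] --> D1 (psi K) a p.
  by apply: D1_continuous => l; exact: psi_partial_continuous Ua.
have c2 p q : D2 (psi K) z p q @[z --> a] --> D2 (psi K) a p q.
  by apply: D2_continuous => l m; exact: psi_partial2_continuous Ua.
pose s i j z := h_ i * h_ j *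
   (`|hessv H (psi K z) (D1 (psi K) z (r_ i)) (D1 (psi K) z (r_ j))| +
    `|gradv g (psi K z) (D2 (psi K) z (r_ i) (r_ j))|).
have cs i j : s i j z @[z --> a] --> s i j a.
  have h1 : hessv H (psi K z) (D1 (psi K) z (r_ i)) (D1 (psi K) z (r_ j)) @[z --> a] -->
      hessv H (psi K a) (D1 (psi K) a (r_ i)) (D1 (psi K) a (r_ j)).
    by apply: hessv_cvg => // l m; exact: cH.
  have h2 : gradv g (psi K z) (D2 (psi K) z (r_ i) (r_ j)) @[z --> a] -->
      gradv g (psi K a) (D2 (psi K) a (r_ i) (r_ j)).
    by apply: gradv_cvg => // l; exact: cg.
  exact: (cvgM (cvg_cst (h_ i * h_ j)) (cvgD (cvg_norm h1) (cvg_norm h2))).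
have e z : density z = (s ord0 ord0 z + s ord0 ord_max z) + (s ord_max ord0 z + s ord_max ord_max z).
  by rewrite /density !sum2.
have h : density z @[z --> a] --> density a.
  rewrite e (_ : density = fun z => (s ord0 ord0 z + s ord0 ord_max z) +
    (s ord_max ord0 z + s ord_max ord_max z)); last exact/funext.
  exact: (cvgD (cvgD (cs _ _) (cs _ _)) (cvgD (cs _ _) (cs _ _))).
exact: h.
Qed.

Variables (th : R) (c : plane R).
Hypothesis th0 : 0 <= th.
Hypothesis th1 : th <= 1.
Hypothesis hD : forall y, T y -> core_int (core K) (th *: y + c).
Hypothesis hv : forall y, T y -> differentiable (v : plane R -> R^o) (psi K (th *: y + c)) /\
  forall l, partial l (v : plane R -> R^o) (psi K (th *: y + c)) = g l (psi K (th *: y + c)).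
Hypothesis hg : forall l y, T y ->
  differentiable (g l : plane R -> R^o) (psi K (th *: y + c)) /\
  forall m, partial m (g l : plane R -> R^o) (psi K (th *: y + c)) = H l m (psi K (th *: y + c)).

Lemma shrink_nbhd y : T y -> nbhd K (th *: y + c).
Proof. by move=> /hD/core_int_core/core_nbhd. Qed.

Lemma edge_error (y : plane R) (k : 'I_3) : T y ->
  (((v (psi K (th *: vert (core K) k + c)) - v (psi K (th *: y + c)) -
     pull_grad K g (th *: y + c) (th *: (vert (core K) k - y))) ^+ 2)%:E <=
   \int[mu]_(t in `[0%R, 1%R])
     (((1 - t) * density (th *: ((1 - t) *: y + t *: vert (core K) k) + c)) ^+ 2)%:E)%E.
Proof.
move=> Ty; set q := vert (core K) k; have Tq : T q by exact: core_vert.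
pose z := th *: y + c; pose kk := th *: (q - y).
have line (t : R) : z + t *: kk = th *: ((1 - t) *: y + t *: q) + c.
  by apply: plane_eq; rewrite /z /kk /= /GRing.scale/=; ring.
have seg (t : R) : 0 <= t <= 1 -> T ((1 - t) *: y + t *: q).
  by move=> /andP[t0 t1]; apply: core_convex => //; rewrite ?subr_ge0 ?subrK.
have nb (t : R) : 0 <= t <= 1 -> nbhd K (z + t *: kk).
  by move=> ht; rewrite line; exact: shrink_nbhd (seg t ht).
pose p (t : R) := v (psi K (z + t *: kk)).
pose p' (t : R) := pull_grad K g (z + t *: kk) kk.
pose p'' (t : R) := pull_hess K g H (z + t *: kk) kk kk.
have dp (t : R) : 0 <= t <= 1 -> is_derive t (1 : R) p (p' t).
  move=> ht; apply: pull_derive; first exact: nb.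
    by rewrite line; have [] := hv (seg t ht).
  by move=> l; rewrite line; have [_] := hv (seg t ht); exact.
have dp' (t : R) : 0 <= t <= 1 -> is_derive t (1 : R) p' (p'' t).
  move=> ht; apply: pull_grad_derive; first exact: nb.
    by move=> l; rewrite line; have [] := hg l (seg t ht).
  by move=> l m; rewrite line; have [_] := hg l (seg t ht); exact.
have cl (t : R) : z + s *: kk @[s --> t] --> z + t *: kk.
  have [h _] := is_derive_line z kk t.
  have cc : {for t, continuous (fun s : R => z + s *: kk)}.
    by apply: differentiable_continuous; apply/derivable1_diffP.
  exact: cc.
have cp'' : {within `[0, 1], continuous p''}.
  apply: pointwise_within => t; rewrite /= in_itv/= => ht.
  exact: (cvg_comp (fun s : R => z + s *: kk) (fun a => pull_hess K g H a kk kk) (cl t)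
    (pull_hess_continuous (nb t ht))).
have cG : {within `[0, 1], continuous (fun t : R => density (z + t *: kk))}.
  apply: pointwise_within => t; rewrite /= in_itv/= => ht.
  exact: (cvg_comp (fun s : R => z + s *: kk) density (cl t) (density_continuous (nb t ht))).
have c1 : {within `[0, 1], continuous (fun t : R => 1 - t)}.
  by apply: continuous_subspaceT => s; apply: cvgB; [exact: cvg_cst|exact: cvg_id].
have csq (f : R -> R) : {within `[0, 1], continuous f} ->
    measurable_fun (`[0, 1]%classic : set R) (fun t : R => (((1 - t) * f t) ^+ 2)%:E).
  move=> cf; apply/measurable_EFinP; apply: measurable_funX; apply: within_cc_measurable.
  by move=> t; exact: (cvgM (c1 t) (cf t)).
have -> : v (psi K (th *: q + c)) - v (psi K (th *: y + c)) -
    pull_grad K g (th *: y + c) (th *: (q - y)) = p 1 - p 0 - p' 0.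
  rewrite /p /p' !line !subrr !scale0r !subr0 !scale1r add0r addr0.
  by [].
apply: le_trans (taylor2_sqr dp dp' cp'') _.
have m1 := csq _ cp''.
have m2 : measurable_fun (`[0, 1]%classic : set R) (fun t : R =>
    (((1 - t) * density (th *: ((1 - t) *: y + t *: q) + c)) ^+ 2)%:E).
  have := csq _ cG; apply: eq_measurable_fun => t _ /=.
  by rewrite line.
have h0 : forall t : R, `[0, 1]%classic t -> (0 <= (((1 - t) * p'' t) ^+ 2)%:E)%E.
  by move=> t _; rewrite lee_fin sqr_ge0.
apply: (@ge0_le_integral _ _ _ mu _ (measurable_cc 0 1) _ _ h0 m1 m2).
move=> t; rewrite /= in_itv/= => /andP[t0 t1]; rewrite lee_fin -line.
rewrite -real_normK ?num_real// -[leRHS]real_normK ?num_real//.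
rewrite ler_sqr ?nnegrE// !normrM ler_wpM2l// (ger0_norm (density_ge0 _)).
have -> : p'' t = pull_hess K g H (z + t *: kk)
   (\sum_(i < 2) (th * (edge_coef (core K) i q - edge_coef (core K) i y)) *: edge_dir (core K) i)
   (\sum_(i < 2) (th * (edge_coef (core K) i q - edge_coef (core K) i y)) *: edge_dir (core K) i).
  rewrite /p''; congr (pull_hess _ _ _ _ _ _);
  by rewrite /kk {1}(edge_decomp (core K) y q) scaler_sumr; apply: eq_bigr => i _; rewrite scalerA.
apply: pull_hess_le => i; rewrite normrM ger0_norm//.
by rewrite -[leRHS]mulr1; apply: ler_pM => //; exact: edge_coef_diff.
Qed.

(** Convexity of the square, with the weights then bounded by 1 to remove the dependence on the
    evaluation point. *)
Lemma convex_sqr (a b x y z : R) : 0 <= a -> 0 <= b -> a + b <= 1 ->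
  ((1 - a - b) * x + a * y + b * z) ^+ 2 <= x ^+ 2 + y ^+ 2 + z ^+ 2.
Proof.
move=> a0 b0 ab.
have p0 : 0 <= 1 - a - b by lra.
have p1 : 0 <= 1 - a by lra.
have p2 : 0 <= 1 - b by lra.
have h1 : 0 <= (1 - a - b) * a * (x - y) ^+ 2 by apply: mulr_ge0 (sqr_ge0 _); exact: mulr_ge0.
have h2 : 0 <= (1 - a - b) * b * (x - z) ^+ 2 by apply: mulr_ge0 (sqr_ge0 _); exact: mulr_ge0.
have h3 : 0 <= a * b * (y - z) ^+ 2 by apply: mulr_ge0 (sqr_ge0 _); exact: mulr_ge0.
have k1 : 0 <= (a + b) * x ^+ 2 by apply: mulr_ge0 (sqr_ge0 _); exact: addr_ge0.
have k2 : 0 <= (1 - a) * y ^+ 2 by exact: mulr_ge0 (sqr_ge0 _).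
have k3 : 0 <= (1 - b) * z ^+ 2 by exact: mulr_ge0 (sqr_ge0 _).
rewrite -subr_ge0.
have -> : x ^+ 2 + y ^+ 2 + z ^+ 2 - ((1 - a - b) * x + a * y + b * z) ^+ 2 =
  (1 - a - b) * a * (x - y) ^+ 2 + (1 - a - b) * b * (x - z) ^+ 2 + a * b * (y - z) ^+ 2 +
  ((a + b) * x ^+ 2 + (1 - a) * y ^+ 2 + (1 - b) * z ^+ 2) by ring.
lra.
Qed.

(* The first-order terms of the three Taylor expansions cancel because the
   barycentric combination of the vectors vert k - y vanishes. *)
Lemma interp_error (y : plane R) : T y ->
  (((\sum_(k < 3) bary (core K) k y * v (psi K (th *: vert (core K) k + c)) -
     v (psi K (th *: y + c))) ^+ 2)%:E <=
   \sum_(k < 3) \int[mu]_(t in `[0%R, 1%R])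
     (((1 - t) * density (th *: ((1 - t) *: y + t *: vert (core K) k) + c)) ^+ 2)%:E)%E.
Proof.
move=> Ty.
pose X k := v (psi K (th *: vert (core K) k + c)) - v (psi K (th *: y + c)) -
     pull_grad K g (th *: y + c) (th *: (vert (core K) k - y)).
apply: (@le_trans _ _ (\sum_(k < 3) ((X k) ^+ 2)%:E)%E); last first.
  by apply: lee_sum => k _; exact: edge_error.
rewrite sumEFin lee_fin.
have b0 := (core_setP _ _).1 Ty.
have s1 := bary_sum (core K) y; have sy := bary_point (core K) y.
rewrite sum3 in s1; rewrite sum3 in sy.
have -> : \sum_(k < 3) bary (core K) k y * v (psi K (th *: vert (core K) k + c)) -
     v (psi K (th *: y + c)) = \sum_(k < 3) bary (core K) k y * X k.
  have [A [B hAB]] : exists A B : R, forall d, pull_grad K g (th *: y + c) d = d.1 * A + d.2 * B.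
    exists (gradv g (psi K (th *: y + c)) (partial ord0 (psi K) (th *: y + c))).
    exists (gradv g (psi K (th *: y + c)) (partial ord_max (psi K) (th *: y + c))) => d.
    by rewrite /pull_grad D1E gradv_comb.
  rewrite /X !sum3 !hAB /=.
  have e1 : (vert (core K) i30).1 * bary (core K) i30 y + (vert (core K) i31).1 * bary (core K) i31 y
    + (vert (core K) i32).1 * bary (core K) i32 y = y.1.
    by rewrite -[in RHS]sy /= /GRing.scale/=; ring.
  have e2 : (vert (core K) i30).2 * bary (core K) i30 y + (vert (core K) i31).2 * bary (core K) i31 y
    + (vert (core K) i32).2 * bary (core K) i32 y = y.2.
    by rewrite -[in RHS]sy /= /GRing.scale/=; ring.
  move: s1 e1 e2.
  move: (bary _ i30 y) (bary _ i31 y) (bary _ i32 y) => l0 l1 l2.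
  move: (v _) (v _) (v _) (v _) => v0 v1 v2 vy.
  case: (vert _ i30) (vert _ i31) (vert _ i32) => [a b] [a' b'] [a'' b''] /= s1 <- <-.
  have -> : l0 = 1 - l1 - l2 by rewrite -s1; ring.
  by rewrite /GRing.scale/=; ring.
rewrite !sum3.
have -> : bary (core K) i30 y = 1 - bary (core K) i31 y - bary (core K) i32 y by rewrite -s1; ring.
apply: convex_sqr; [exact: b0|exact: b0|].
by have := b0 i30; lra.
Qed.

End PointwiseError.

(** * The integrated interpolation error *)

Section SegmentTonelli.
Context {R : realType}.
Let mu := @lebesgue_measure R.

(** After exchanging the integrals, a bound uniform in t survives unchanged because [0, 1] has
    measure 1. Measurability of the inner integral comes from the same theorem and is returned for
    later comparisons. *)
Lemma tonelli_segment (V : set (mplane R)) (F : mplane R * measurableTypeR R -> R) (C : \bar R) :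
  measurable V -> measurable_fun setT F -> (forall z, 0 <= F z) ->
  (forall t : R, 0 <= t <= 1 -> (\int[mu2]_(x in V) (F (x, t))%:E <= C)%E) ->
  measurable_fun V (fun x => \int[mu]_(t in `[0%R, 1%R]) (F (x, t))%:E)%E /\
  (\int[mu2]_(x in V) \int[mu]_(t in `[0%R, 1%R]) (F (x, t))%:E <= C)%E.
Proof.
move=> mV mF F0 hF.
pose I : set (measurableTypeR R) := `[0, 1]%classic.
have mI : measurable I by exact: measurable_cc.
have mVI : measurable (V `*` I) by exact: measurableX.
pose f z := ((F \_ (V `*` I)) z)%:E.
have f0 z : (0 <= f z)%E by rewrite /f lee_fin patchE; case: ifP.
have mf : measurable_fun setT f.
  by apply/measurable_EFinP; apply/(measurable_restrictT _ mVI); exact: measurable_funTS.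
pose l : {sigma_finite_measure set (measurableTypeR R) -> \bar R} := @lebesgue_measure R.
have mf1 := @measurable_fun_fubini_tonelli_F _ _ _ _ _ l f mf f0.
have mf2 := @measurable_fun_fubini_tonelli_G _ _ _ _ _ (@mu2_sf R) f mf f0.
have ton := @fubini_tonelli _ _ _ _ _ (@mu2_sf R) l f mf f0.
have e1 x : V x -> fubini_F l f x = (\int[mu]_(t in `[0%R, 1%R]) (F (x, t))%:E)%E.
  move=> Vx; rewrite /fubini_F [RHS]integral_mkcond; apply: eq_integral => t _.
  rewrite /f !patchE; have [tI|tI] := boolP (t \in `[0, 1]%classic).
    by rewrite mem_set//; split => //; rewrite inE in tI.
  rewrite memNset// => -[_ /= h]; move: tI; rewrite notin_setE; exact.
have e1' x : ~ V x -> fubini_F l f x = 0%E.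
  move=> nV; rewrite /fubini_F; apply: integral0_eq => t _.
  by rewrite /f patchE memNset// => -[].
have mV1 : measurable_fun V (fubini_F l f) by exact: measurable_funTS mf1.
split.
  by apply: eq_measurable_fun mV1 => x; rewrite inE => Vx; exact: e1.
have -> : (\int[mu2]_(x in V) \int[mu]_(t in `[0%R, 1%R]) (F (x, t))%:E =
    \int[mu2]_x fubini_F l f x)%E.
  rewrite integral_mkcond; apply: eq_integral => x _; rewrite patchE.
  have [xV|xV] := boolP (x \in V); first by rewrite e1//; rewrite inE in xV.
  by rewrite e1'//; rewrite notin_setE in xV.
apply: (@le_trans _ _ (\int[mu]_t fubini_G (@mu2_sf R) f t)%E).
  by rewrite le_eqVlt; apply/orP; left; apply/eqP; exact: ton.
have e2 t : I t -> fubini_G (@mu2_sf R) f t = (\int[mu2]_(x in V) (F (x, t))%:E)%E.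
  move=> It; rewrite /fubini_G [RHS]integral_mkcond; apply: eq_integral => x _.
  rewrite /f !patchE; have [xV|xV] := boolP (x \in V).
    by rewrite mem_set//; split => //; rewrite inE in xV.
  rewrite memNset// => -[/= h _]; move: xV; rewrite notin_setE; exact.
have e2' t : ~ I t -> fubini_G (@mu2_sf R) f t = 0%E.
  move=> nI; rewrite /fubini_G; apply: integral0_eq => x _.
  by rewrite /f patchE memNset// => -[].
have C0 : (0 <= C)%E.
  have h01 : 0 <= (0 : R) <= 1 by rewrite lexx ler01.
  by apply: le_trans (hF 0 h01); apply: integral_ge0 => x _; rewrite lee_fin.
have g0 t : (0 <= fubini_G (@mu2_sf R) f t)%E by apply: integral_ge0.
apply: (@le_trans _ _ (\int[mu]_(t in I) fubini_G (@mu2_sf R) f t)%E).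
  rewrite [leRHS]integral_mkcond le_eqVlt; apply/orP; left; apply/eqP.
  apply: eq_integral => t _; rewrite patchE.
  have [//|tI] := boolP (t \in I); by rewrite e2'//; rewrite notin_setE in tI.
apply: (@le_trans _ _ (\int[mu]_(t in I) cst C t)%E).
  apply: (@ge0_le_integral _ _ _ mu I mI _ _ (fun t _ => g0 t)).
  - exact: measurable_funTS mf2.
  - exact: measurable_cst.
  - by move=> t It; rewrite e2//; apply: hF; move: It; rewrite /I /= in_itv.
have muI : mu I = 1%E by rewrite /mu /I mu_cc// subr0.
have e3 : (\int[mu]_(t in I) cst C t = C)%E.
  apply: (etrans (integral_cst mu mI C)).
  by apply: (etrans (congr1 (fun z => (C * z)%E) muI)); rewrite mule1.
by rewrite le_eqVlt; apply/orP; left; apply/eqP.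
Qed.

End SegmentTonelli.

Section IntegratedError.
Context {R : realType}.
Let mu := @lebesgue_measure R.
Variables (K : curved_triangle R) (C1 : R).
Hypothesis hC : (Lp_norm +oo (core_set (core K)) (D1_norm (psi K)) +
  Lp_norm +oo (elt_set K) (D1_norm (psi_inv K)) <= C1%:E)%E.
Hypothesis C10 : 0 < C1.

Local Notation T := (core_set (core K)).
Local Notation W := (elt_int K).

Lemma measurable_core : measurable (T : set (mplane R)).
Proof. by apply: closed_measurable2; exact: core_closed. Qed.

Lemma psi_inv_within : {within elt_set K, continuous (psi_inv K)}.
Proof. by apply: pointwise_within => _ [y /core_nbhd Uy <-]; exact: psi_inv_continuous. Qed.

Lemma measurable_psi_inv_coord l : measurable_fun (elt_set K : set (mplane R))
  (fun x => coord l (psi_inv K x)).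
Proof.
apply: within_continuous_measurable_fun2; first exact: measurable_elt.
by move=> x; apply: coord_cvg; exact: psi_inv_within.
Qed.

(* The factor (1 - t)^2 of the Taylor remainder absorbs the (1 - t)^-2 of the
   substitution, hence a bound uniform in t. *)
Lemma segment_change_of_variables (th : R) (c q : plane R) (gT : mplane R -> R) :
  2^-1 <= th -> th <= 1 -> T q ->
  (forall y, T y -> core_int (core K) (th *: y + c)) ->
  measurable_fun setT gT -> (forall y, 0 <= gT y) ->
  forall t : R, 0 <= t <= 1 ->
  (\int[mu2]_(x in elt_set K)
     ((1 - t) ^+ 2 * gT (th *: ((1 - t) *: psi_inv K x + t *: q) + c))%:E <=
   ((4 * C1) ^+ 4)%:E * \int[mu2]_(x in W) (gT (psi_inv K x))%:E)%E.
Proof.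
move=> th2 th1 Tq hD mg g0 t /andP[t0 t1].
have C40 : 0 <= (4 * C1) ^+ 4 by rewrite exprn_ge0// mulr_ge0// ltW.
have J0 : (0 <= \int[mu2]_(x in W) (gT (psi_inv K x))%:E)%E.
  by apply: integral_ge0 => x _; rewrite lee_fin.
(* At t = 1 the dilation factor vanishes and no substitution is possible, but the integrand is 0. *)
have [te|tn] := eqVneq t 1.
  rewrite integral0_eq; first by rewrite mule_ge0.
  by move=> x _; rewrite te subrr expr0n mul0r.
have s0 : 0 < 1 - t by rewrite subr_gt0 lt_neqAle tn.
have th0 : 0 < th by apply: lt_le_trans th2; rewrite invr_gt0.
pose G (x : mplane R) := gT (psi_inv K x).
have mW := measurable_elt_int K.
pose g := G \_ W.
have mG : measurable_fun (W : set (mplane R)) G.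
  have mK := measurable_elt K.
  pose S (x : mplane R) : mplane R := (((fun x => coord ord0 (psi_inv K x)) \_ (elt_set K)) x,
     ((fun x => coord ord_max (psi_inv K x)) \_ (elt_set K)) x).
  have mS : measurable_fun setT S.
    by apply: measurable_fun_pair; apply/(measurable_restrictT _ mK);
      exact: measurable_psi_inv_coord.
  have h : measurable_fun (W : set (mplane R)) (gT \o S).
    by apply: measurable_funTS; exact: measurableT_comp.
  apply: eq_measurable_fun h => x; rewrite inE => /elt_int_sub Kx.
  by rewrite /G /S /= !patchE !mem_set//= coord0 coord1 -surjective_pairing.
have mg' : measurable_fun setT g by apply/(measurable_restrictT _ mW).
have g0' x : 0 <= g x by rewrite /g patchE; case: ifP => _; [exact: g0|exact: lexx].
have ths0 : 0 < th * (1 - t) by rewrite mulr_gt0.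
have hD' y : T y -> core_int (core K) ((th * (1 - t)) *: y + ((th * t) *: q + c)).
  move=> Ty; have -> : (th * (1 - t)) *: y + ((th * t) *: q + c) =
      th *: ((1 - t) *: y + t *: q) + c.
    by apply: plane_eq; rewrite /= /GRing.scale/=; ring.
  by apply: hD; apply: core_convex => //; [exact: ltW|rewrite subrK].
have cov := elt_affine_change_of_variables hC C10 ths0 hD' mg' g0'.
have e1 : (\int[mu2]_(x in elt_set K) (g (psi K ((th * (1 - t)) *: psi_inv K x + ((th * t) *: q + c))))%:E =
   \int[mu2]_(x in elt_set K) (gT (th *: ((1 - t) *: psi_inv K x + t *: q) + c))%:E)%E.
  apply: eq_integral => x; rewrite inE => Kx; congr EFin.
  have hi := hD' _ (psi_inv_core Kx).
  rewrite /g patchE mem_set; last by exists ((th * (1 - t)) *: psi_inv K x + ((th * t) *: q + c)).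
  rewrite /G psiK; last by apply/core_nbhd/core_int_core.
  by congr gT; apply: plane_eq; rewrite /= /GRing.scale/=; ring.
have e2 : (\int[mu2]_(x in W) (g x)%:E = \int[mu2]_(x in W) (gT (psi_inv K x))%:E)%E.
  by apply: eq_integral => x xW; rewrite /g patchE xW.
rewrite e1 e2 in cov.
have mK : measurable_fun (elt_set K : set (mplane R))
    (fun x => (gT (th *: ((1 - t) *: psi_inv K x + t *: q) + c))%:E).
  have mE := measurable_elt K.
  pose A l (x : mplane R) := th * ((1 - t) * ((fun x => coord l (psi_inv K x)) \_ (elt_set K)) x
     + t * coord l q) + coord l c.
  have mA l : measurable_fun setT (A l).
    apply: measurable_funD => //; apply: measurable_funM => //.
    apply: measurable_funD => //; apply: measurable_funM => //.
    by apply/(measurable_restrictT _ mE); exact: measurable_psi_inv_coord.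
  have h : measurable_fun (elt_set K : set (mplane R)) (gT \o (fun x => (A ord0 x, A ord_max x))).
    have hp := measurable_fun_pair (mA ord0) (mA ord_max).
    by apply: measurable_funTS; exact: (measurableT_comp mg hp).
  apply/measurable_EFinP; apply: eq_measurable_fun h => x; rewrite inE => Kx.
  rewrite /A /= !patchE !mem_set// !coord0 !coord1; congr gT.
apply: (@le_trans _ _ (((1 - t) ^+ 2)%:E * \int[mu2]_(x in elt_set K)
    (gT (th *: ((1 - t) *: psi_inv K x + t *: q) + c))%:E)%E).
  rewrite le_eqVlt; apply/orP; left; apply/eqP.
  exact: (@ge0_integralZl_EFin _ _ _ mu2 (elt_set K) (measurable_elt K)
    (fun x => (gT (th *: ((1 - t) *: psi_inv K x + t *: q) + c))%:E) (fun x _ => g0 _) mK _ (sqr_ge0 (1 - t))).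
have s20 : (0 <= ((1 - t) ^+ 2)%:E)%E by rewrite lee_fin sqr_ge0.
apply: (le_trans (lee_wpmul2l s20 cov)).
rewrite muleA -EFinM; apply: lee_wpmul2r => //; rewrite lee_fin.
have sn : 1 - t != 0 by rewrite gt_eqF.
have tn0 : th != 0 by rewrite gt_eqF.
(* The powers of 1 - t cancel and leave 64 C1^4 / th^2; th >= 1/2 bounds this by 256 C1^4 = (4
   C1)^4. *)
have -> : (1 - t) ^+ 2 * (4 * (2 * C1 / (th * (1 - t)) * (2 * C1)) ^+ 2) =
    (2 * (2 * C1) ^+ 2) ^+ 2 * (th ^- 2).
  by field; rewrite sn tn0.
have -> : (4 * C1) ^+ 4 = (2 * (2 * C1) ^+ 2) ^+ 2 * 4 by ring.
apply: ler_wpM2l; first exact: sqr_ge0.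
rewrite -[X in _ <= X]invrK lef_pV2 ?posrE ?exprn_gt0 ?invr_gt0//.
have -> : (4^-1 : R) = 2^-1 ^+ 2 by field.
by rewrite ler_sqr ?nnegrE ?invr_ge0// ltW.
Qed.

End IntegratedError.

Section UniformEstimates.
Context {R : realType}.
Let mu := @lebesgue_measure R.
Variables (K : curved_triangle R) (C1 : R).
Hypothesis hC : (Lp_norm +oo (core_set (core K)) (D1_norm (psi K)) +
  Lp_norm +oo (elt_set K) (D1_norm (psi_inv K)) <= C1%:E)%E.
Hypothesis C10 : 0 < C1.

Local Notation T := (core_set (core K)).
Local Notation W := (elt_int K).
Local Notation vert := (vert (core K)).
Local Notation bary := (bary (core K)).

(** Models the contraction D_n. The lower bound 1/2 on its ratio keeps all substitution constants
    uniform in n. *)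
Definition shrinks (th : R) (c : plane R) :=
  [/\ 2^-1 <= th, th <= 1 & forall y, T y -> core_int (core K) (th *: y + c)].

(** What mollification provides: [g] and [H] continuous everywhere, but derivatives of v and of [g]
    only on the image of the contracted core, where mollifying commutes with weak
    differentiation. *)
Definition pulled_C2 (th : R) (c : plane R) (v : plane R -> R)
    (g : 'I_2 -> plane R -> R) (H : 'I_2 -> 'I_2 -> plane R -> R) :=
  [/\ forall l, continuous (g l), forall l m, continuous (H l m),
      forall y, T y -> differentiable (v : plane R -> R^o) (psi K (th *: y + c)) /\
        forall l, partial l (v : plane R -> R^o) (psi K (th *: y + c)) = g l (psi K (th *: y + c)) &
      forall l y, T y -> differentiable (g l : plane R -> R^o) (psi K (th *: y + c)) /\
        forall m, partial m (g l : plane R -> R^o) (psi K (th *: y + c)) =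
          H l m (psi K (th *: y + c))].

Lemma pulled_continuous th c v g H y : shrinks th c -> pulled_C2 th c v g H -> T y ->
  v (psi K (th *: z + c)) @[z --> y] --> v (psi K (th *: y + c)).
Proof.
move=> [_ _ hD] [_ _ hv _] Ty.
have cv : {for psi K (th *: y + c), continuous v}.
  by have [/differentiable_continuous] := hv y Ty.
have cp : {for th *: y + c, continuous (psi K)}.
  by apply: psi_continuous; apply: core_nbhd; apply: core_int_core; exact: hD.
have ca : {for y, continuous (fun z : plane R => th *: z + c)}.
  by apply: cvgD; [exact: (cvgZ (cvg_cst th) cvg_id)|exact: cvg_cst].
exact: (cvg_comp _ _ (cvg_comp _ _ ca cp) cv).
Qed.

(** The pointwise error is integrated over the element; each of the three vertices contributes one
    factor (4 C1)^4. *)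
Lemma integrated_error th c v g H : shrinks th c -> pulled_C2 th c v g H ->
  (\int[mu2]_(x in elt_set K) (((\sum_(k < 3) bary k (psi_inv K x) *
       v (psi K (th *: vert k + c)) - v (psi K (th *: psi_inv K x + c))) ^+ 2)%R)%:E <=
   (3 * (4 * C1) ^+ 4)%:E * \int[mu2]_(x in W) ((density K g H (psi_inv K x)) ^+ 2)%:E)%E.
Proof.
move=> hs hp; have [th2 th1 hD] := hs; have [cg cH hv hg] := hp.
have th0 : 0 <= th by apply: le_trans th2; rewrite invr_ge0.
have mK := measurable_elt K; have mT := measurable_core K.
pose J := (\int[mu2]_(x in W) ((density K g H (psi_inv K x)) ^+ 2)%:E)%E.
pose gT : mplane R -> R := (fun y => density K g H y ^+ 2) \_ T.
have mgT : measurable_fun setT gT.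
  apply/(measurable_restrictT _ mT); apply: measurable_funX.
  apply: within_continuous_measurable_fun2 => //; apply: pointwise_within => y /core_nbhd.
  exact: density_continuous.
have gT0 y : 0 <= gT y by rewrite /gT patchE; case: ifP => // _; exact: sqr_ge0.
have gTE y : T y -> gT y = density K g H y ^+ 2 by move=> Ty; rewrite /gT patchE mem_set.
have eJ : (\int[mu2]_(x in W) (gT (psi_inv K x))%:E = J)%E.
  apply: eq_integral => x; rewrite inE => Wx; rewrite gTE//.
  exact/psi_inv_core/elt_int_sub.
pose A k l (z : mplane R * measurableTypeR R) :=
  th * ((1 - z.2) * ((fun x => coord l (psi_inv K x)) \_ (elt_set K)) z.1 + z.2 * coord l (vert k))
    + coord l c.
have mA k l : measurable_fun setT (A k l).
  have m2 : measurable_fun setT (fun z : mplane R * measurableTypeR R => z.2 : R) by exact: measurable_snd.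
  have mp : measurable_fun setT (fun z : mplane R * measurableTypeR R =>
      ((fun x => coord l (psi_inv K x)) \_ (elt_set K)) z.1).
    have m := (measurable_restrictT _ mK).1 (measurable_psi_inv_coord l).
    exact: (measurableT_comp m measurable_fst).
  apply: measurable_funD => //; apply: measurable_funM => //.
  apply: measurable_funD; apply: measurable_funM => //.
  exact: measurable_funB.
pose F k (z : mplane R * measurableTypeR R) := (1 - z.2) ^+ 2 * gT (A k ord0 z, A k ord_max z).
have mF k : measurable_fun setT (F k).
  have m2 : measurable_fun setT (fun z : mplane R * measurableTypeR R => z.2 : R) by exact: measurable_snd.
  have hp' := measurable_fun_pair (mA k ord0) (mA k ord_max).
  apply: measurable_funM; last exact: (measurableT_comp mgT hp').
  by apply: measurable_funX; exact: measurable_funB.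
have F0 k z : 0 <= F k z by rewrite mulr_ge0 ?sqr_ge0.
have FE k x t : elt_set K x -> F k (x, t) =
    (1 - t) ^+ 2 * gT (th *: ((1 - t) *: psi_inv K x + t *: vert k) + c).
  move=> Kx; rewrite /F /A /= !patchE !mem_set// !coord0 !coord1; congr (_ * gT _).
have seg k x (t : R) : elt_set K x -> 0 <= t <= 1 ->
    T (th *: ((1 - t) *: psi_inv K x + t *: vert k) + c).
  move=> Kx /andP[t0 t1]; apply: core_int_core; apply: hD; apply: core_convex => //.
  - by rewrite subr_ge0.
  - by rewrite subrK.
  - exact: psi_inv_core.
  - exact: core_vert.
have ton k := tonelli_segment mK (mF k) (F0 k).
have bound k : measurable_fun (elt_set K : set (mplane R))
      (fun x => \int[mu]_(t in `[0%R, 1%R]) (F k (x, t))%:E)%E /\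
    (\int[mu2]_(x in elt_set K) \int[mu]_(t in `[0%R, 1%R]) (F k (x, t))%:E <=
      ((4 * C1) ^+ 4)%:E * J)%E.
  apply: ton => t ht; rewrite -eJ.
  have h := segment_change_of_variables hC C10 th2 th1 (core_vert (core K) k) hD mgT gT0 ht.
  apply: le_trans h; rewrite le_eqVlt; apply/orP; left; apply/eqP.
  by apply: eq_integral => x; rewrite inE => Kx; rewrite FE.
have I0 k x : (0 <= \int[mu]_(t in `[0%R, 1%R]) (F k (x, t))%:E)%E.
  by apply: integral_ge0 => t _; rewrite lee_fin.
pose E (x : mplane R) := \sum_(k < 3) bary k (psi_inv K x) *
       v (psi K (th *: vert k + c)) - v (psi K (th *: psi_inv K x + c)).
have mE : measurable_fun (elt_set K : set (mplane R)) E.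
  apply: within_continuous_measurable_fun2 => //; apply: pointwise_within => _ [y Ty <-].
  have Uy := core_nbhd Ty.
  have ci : psi_inv K z @[z --> psi K y] --> y.
    by rewrite -[X in _ --> X](psiK Uy); exact: psi_inv_continuous Uy.
  have cb k : bary k (psi_inv K z) * v (psi K (th *: vert k + c)) @[z --> psi K y] -->
      bary k y * v (psi K (th *: vert k + c)).
    apply: cvgM; last exact: cvg_cst.
    exact: (cvg_comp _ _ ci (@bary_continuous _ (core K) k y)).
  have cu := cvg_comp _ _ ci (pulled_continuous hs hp Ty).
  have cE : E z @[z --> psi K y] --> (bary i30 y * v (psi K (th *: vert i30 + c)) +
      bary i31 y * v (psi K (th *: vert i31 + c)) + bary i32 y * v (psi K (th *: vert i32 + c))) -
      v (psi K (th *: y + c)).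
    rewrite (_ : E = fun x => (bary i30 (psi_inv K x) * v (psi K (th *: vert i30 + c)) +
      bary i31 (psi_inv K x) * v (psi K (th *: vert i31 + c)) +
      bary i32 (psi_inv K x) * v (psi K (th *: vert i32 + c))) -
      v (psi K (th *: psi_inv K x + c))); last by apply/funext => x; rewrite /E sum3.
    exact: (cvgB (cvgD (cvgD (cb _) (cb _)) (cb _)) cu).
  have e : E (psi K y) = (bary i30 y * v (psi K (th *: vert i30 + c)) +
      bary i31 y * v (psi K (th *: vert i31 + c)) + bary i32 y * v (psi K (th *: vert i32 + c))) -
      v (psi K (th *: y + c)) by rewrite /E sum3 psiK.
  by rewrite -e in cE.
pose Phi k (x : mplane R) := (\int[mu]_(t in `[0%R, 1%R]) (F k (x, t))%:E)%E.
have mPhi k : measurable_fun (elt_set K : set (mplane R)) (Phi k) by have [] := bound k.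
have mE2 : measurable_fun (elt_set K : set (mplane R)) (fun x => (E x ^+ 2)%:E).
  by apply/measurable_EFinP; exact: measurable_funX.
have mS : measurable_fun (elt_set K : set (mplane R)) (fun x => \sum_(k < 3) Phi k x)%E.
  exact: emeasurable_sum.
have E20 x : elt_set K x -> (0 <= (E x ^+ 2)%:E)%E by rewrite lee_fin sqr_ge0.
have EPhi x : elt_set K x -> ((E x ^+ 2)%:E <= \sum_(k < 3) Phi k x)%E.
  move=> Kx; have := interp_error cg cH th0 th1 hD hv hg (psi_inv_core Kx).
  move=> h; apply: (le_trans h); apply: lee_sum => k _.
  rewrite le_eqVlt; apply/orP; left; apply/eqP; apply: eq_integral => t.
  rewrite inE /= in_itv/= => ht; rewrite FE// gTE ?exprMn//; exact: seg.
apply: (le_trans (@ge0_le_integral _ _ _ mu2 (elt_set K) mK _ _ E20 mE2 mS EPhi)).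
have sumE := @ge0_integral_sum _ _ _ mu2 (elt_set K) mK _ Phi mPhi (fun k x _ => I0 k x) (index_enum 'I_3).
rewrite sumE sum3.
apply: (le_trans (leeD (leeD (bound i30).2 (bound i31).2) (bound i32).2)).
have J0 : (0 <= J)%E by apply: integral_ge0 => x _; rewrite lee_fin sqr_ge0.
have C40 : (0 <= ((4 * C1) ^+ 4)%:E)%E.
  by rewrite lee_fin exprn_ge0// mulr_ge0// ltW.
rewrite -(ge0_muleDl _ C40 C40) -ge0_muleDl ?adde_ge0// -!EFinD.
apply: lee_wpmul2r => //; rewrite lee_fin le_eqVlt; apply/orP; left; apply/eqP; ring.
Qed.

End UniformEstimates.

(** * Equicontinuity and the continuous representative *)

Lemma bary_affine3 (R : realType) (c : affine_core R) j (s t : R) (p q r : plane R) :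
  bary c j (p + s *: (q - p) + t *: (r - p)) =
  (1 - s - t) * bary c j p + s * bary c j q + t * bary c j r.
Proof.
have d0 : core_det c != 0 by exact: core_nondegenerate.
move: d0; case: (I3P j) => ->; rewrite /bary /core_det /det2 /=;
case: (p1 c) (p2 c) (p3 c) p q r => [a b] [d e] [f g] [y z'] [y' z''] [m n] /= h;
by rewrite /GRing.scale/=; field.
Qed.

Section Parallelograms.
Context {R : realType}.
Variables (K : curved_triangle R) (C1 : R).
Hypothesis hC : (Lp_norm +oo (core_set (core K)) (D1_norm (psi K)) +
  Lp_norm +oo (elt_set K) (D1_norm (psi_inv K)) <= C1%:E)%E.
Hypothesis C10 : 0 < C1.

Local Notation T := (core_set (core K)).
Local Notation W := (elt_int K).
Local Notation vert := (vert (core K)).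
Local Notation bary := (bary (core K)).

Lemma core_bounded_map (X : plane R -> plane R) :
  (forall a, T a -> {for a, continuous X}) -> exists2 B : R, 0 < B & forall a, T a -> `|X a| <= B.
Proof.
move=> cX.
have cT : compact (X @` T).
  apply: continuous_compact; last exact: core_compact.
  exact: pointwise_within.
have [N [_ hN]] := compact_bounded cT.
exists (`|N| + 1); first by rewrite ltr_wpDl.
move=> a Ta; apply: hN; last by exists a.
by rewrite (le_lt_trans (ler_norm _))// ltrDl.
Qed.

(** The integral of this quantity over W is the bound that all mollifications share, from which
    equicontinuity follows. *)
Definition normsq (g : 'I_2 -> plane R -> R) (H : 'I_2 -> 'I_2 -> plane R -> R)
  (x : plane R) : R := \sum_(l < 2) g l x ^+ 2 + \sum_(l < 2) \sum_(m < 2) H l m x ^+ 2.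

Lemma normsq_ge0 g H x : 0 <= normsq g H x.
Proof.
apply: addr_ge0; apply: sumr_ge0 => l _; first exact: sqr_ge0.
by apply: sumr_ge0 => m _; exact: sqr_ge0.
Qed.

Lemma normsq_continuous g H : (forall l, continuous (g l)) ->
  (forall l m, continuous (H l m)) -> continuous (normsq g H).
Proof.
move=> cg cH x.
have h1 l : g l z ^+ 2 @[z --> x] --> g l x ^+ 2 by apply: cvg_sqr; exact: cg.
have h2 l m : H l m z ^+ 2 @[z --> x] --> H l m x ^+ 2 by apply: cvg_sqr; exact: cH.
have e z : normsq g H z = (g ord0 z ^+ 2 + g ord_max z ^+ 2) +
  ((H ord0 ord0 z ^+ 2 + H ord0 ord_max z ^+ 2) +
   (H ord_max ord0 z ^+ 2 + H ord_max ord_max z ^+ 2)) by rewrite /normsq !sum2.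
have h : normsq g H z @[z --> x] --> normsq g H x.
  rewrite e (_ : normsq g H = fun z => (g ord0 z ^+ 2 + g ord_max z ^+ 2) +
  ((H ord0 ord0 z ^+ 2 + H ord0 ord_max z ^+ 2) +
   (H ord_max ord0 z ^+ 2 + H ord_max ord_max z ^+ 2))); last exact/funext.
  exact: (cvgD (cvgD (h1 _) (h1 _)) (cvgD (cvgD (h2 _ _) (h2 _ _)) (cvgD (h2 _ _) (h2 _ _)))).
exact: h.
Qed.

Lemma sqrD_le (a b : R) : (a + b) ^+ 2 <= 2 * (a ^+ 2 + b ^+ 2).
Proof. by have := sqr_ge0 (a - b); nra. Qed.

Lemma coord_sqr_le l (p : plane R) (B : R) : `|p| <= B -> coord l p ^+ 2 <= B ^+ 2.
Proof.
move=> pB; rewrite -real_normK ?num_real// ler_sqr ?nnegrE//; last exact: le_trans pB.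
apply: le_trans pB; rewrite prod_normE le_max /coord.
by case: ifP => _; rewrite lexx ?orbT.
Qed.

Lemma gradv_sqr_le g x (p : plane R) (B : R) : `|p| <= B ->
  gradv g x p ^+ 2 <= 2 * B ^+ 2 * (\sum_(l < 2) g l x ^+ 2).
Proof.
move=> pB; rewrite /gradv !sum2; apply: le_trans (sqrD_le _ _) _; rewrite !exprMn -mulrA.
apply: ler_wpM2l => //; rewrite mulrDr; apply: lerD; rewrite mulrC;
  by apply: ler_wpM2r; [exact: sqr_ge0|exact: coord_sqr_le].
Qed.

Lemma hessv_sqr_le H x (p q : plane R) (B : R) : `|p| <= B -> `|q| <= B ->
  hessv H x p q ^+ 2 <= 4 * B ^+ 4 * (\sum_(l < 2) \sum_(m < 2) H l m x ^+ 2).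
Proof.
move=> pB qB.
have -> : hessv H x p q = coord ord0 p * gradv (H ord0) x q + coord ord_max p * gradv (H ord_max) x q.
  by rewrite /hessv /gradv !sum2; ring.
rewrite sum2; apply: le_trans (sqrD_le _ _) _; rewrite !exprMn.
have -> : 4 * B ^+ 4 * (\sum_(m < 2) H ord0 m x ^+ 2 + \sum_(m < 2) H ord_max m x ^+ 2) =
  2 * (B ^+ 2 * (2 * B ^+ 2 * (\sum_(m < 2) H ord0 m x ^+ 2)) +
       B ^+ 2 * (2 * B ^+ 2 * (\sum_(m < 2) H ord_max m x ^+ 2))).
  by move: (\sum_(m < 2) _) (\sum_(m < 2) _) => S1 S2; ring.
apply: ler_wpM2l => //; apply: lerD; apply: ler_pM; rewrite ?sqr_ge0//;
  by [exact: coord_sqr_le|exact: gradv_sqr_le].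
Qed.

(** B depends on K through the maxima of the derivatives of [psi] over the compact core, but not on
    [g], [H] or [th]. Uniformity along the sequence is all that equicontinuity needs. *)
Lemma pull_sqr_le (f1 f2 : plane R) : exists2 B : R, 0 < B &
  forall g H th a, 0 <= th -> th <= 1 -> T a ->
  pull_grad K g a (th *: f1) ^+ 2 + pull_hess K g H a (th *: f1) (th *: f2) ^+ 2 <=
    B * normsq g H (psi K a).
Proof.
have cD1 f a : T a -> {for a, continuous (fun a => D1 (psi K) a f)}.
  by move=> /core_nbhd Ua; apply: D1_continuous => l; exact: psi_partial_continuous.
have cD2 f f' a : T a -> {for a, continuous (fun a => D2 (psi K) a f f')}.
  by move=> /core_nbhd Ua; apply: D2_continuous => l m; exact: psi_partial2_continuous.
have [B1 B10 hB1] := core_bounded_map (cD1 f1).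
have [B2 B20 hB2] := core_bounded_map (cD1 f2).
have [B3 B30 hB3] := core_bounded_map (cD2 f2 f1).
pose B := B1 + B2 + B3.
have B0 : 0 < B by rewrite !addr_gt0.
exists (6 * B ^+ 2 + 8 * B ^+ 4); first by rewrite addr_gt0 ?mulr_gt0 ?exprn_gt0.
move=> g H th a th0 th1 Ta.
have scale (p : plane R) (b : R) : `|p| <= b -> `|th *: p| <= b.
  by move=> h; rewrite normrZ ger0_norm//; apply: le_trans h; rewrite ler_piMl.
have z0 (p : plane R) : th *: p = th *: p + 0 *: p by rewrite scale0r addr0.
have hp1 : `|D1 (psi K) a (th *: f1)| <= B.
  rewrite z0 D1_comb scale0r addr0; apply: scale; apply: le_trans (hB1 _ Ta) _.
  by rewrite /B; lra.
have hp2 : `|D1 (psi K) a (th *: f2)| <= B.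
  rewrite z0 D1_comb scale0r addr0; apply: scale; apply: le_trans (hB2 _ Ta) _.
  by rewrite /B; lra.
have hp3 : `|D2 (psi K) a (th *: f2) (th *: f1)| <= B.
  rewrite (z0 f2) (z0 f1) D2_comb !scale0r !addr0; apply/scale/scale.
  by apply: le_trans (hB3 _ Ta) _; rewrite /B; lra.
have k1 := gradv_sqr_le g (psi K a) hp1.
have k2 := hessv_sqr_le H (psi K a) hp1 hp2.
have k3 := gradv_sqr_le g (psi K a) hp3.
have k4 := sqrD_le (hessv H (psi K a) (D1 (psi K) a (th *: f1)) (D1 (psi K) a (th *: f2)))
  (gradv g (psi K a) (D2 (psi K) a (th *: f2) (th *: f1))).
rewrite /normsq /pull_grad /pull_hess.
have Sg0 : 0 <= \sum_(l < 2) g l (psi K a) ^+ 2 by apply: sumr_ge0 => l _; exact: sqr_ge0.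
have SH0 : 0 <= \sum_(l < 2) \sum_(m < 2) H l m (psi K a) ^+ 2.
  by apply: sumr_ge0 => l _; apply: sumr_ge0 => m _; exact: sqr_ge0.
have b2 : 0 <= B ^+ 2 by exact: sqr_ge0.
have b4 : 0 <= B ^+ 4 by rewrite exprn_ge0// ltW.
move: Sg0 SH0 k1 k2 k3 k4 b2 b4.
move: (\sum_(l < 2) g l _ ^+ 2) (\sum_(l < 2) \sum_(m < 2) _) => S S'.
move: (gradv _ _ _ ^+ 2) (gradv _ _ _ ^+ 2) (hessv _ _ _ _ ^+ 2) ((hessv _ _ _ _ + _) ^+ 2).
move: (B ^+ 2) (B ^+ 4) => b b' x y z w S0 S0' k1 k2 k3 k4 b0 b0'.
have m1 := mulr_ge0 b0 S0; have m2 := mulr_ge0 b0 S0'.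
have m3 := mulr_ge0 b0' S0; have m4 := mulr_ge0 b0' S0'.
have -> : (6 * b + 8 * b') * (S + S') = 6 * (b * S) + 6 * (b * S') + 8 * (b' * S) + 8 * (b' * S').
  by ring.
rewrite -!mulrA in k1 k2 k3; lra.
Qed.

(** Affine coordinates at the vertex k along two edges; they are the barycentric coordinates j1 and
    j2. With both at most 1/2 the parallelogram stays inside the core, since the remaining
    coordinate is nonnegative. *)
Definition param (k j1 j2 : 'I_3) (z : plane R) : plane R :=
  vert k + z.1 *: (vert j1 - vert k) + z.2 *: (vert j2 - vert k).

Lemma bary_param k j1 j2 j z : bary j (param k j1 j2 z) =
  (1 - z.1 - z.2) * (j == k)%:R + z.1 * (j == j1)%:R + z.2 * (j == j2)%:R.
Proof.
by rewrite /param bary_affine3 !bary_vert.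
Qed.

Lemma param_core k j1 j2 z : k != j1 -> k != j2 -> j1 != j2 -> square 2^-1 z ->
  T (param k j1 j2 z).
Proof.
move=> kj1 kj2 j12; case: z => s t [/=]; rewrite !in_itv/= => /andP[s0 s1] /andP[t0 t1].
apply/core_setP => j; rewrite bary_param /=.
by rewrite !addr_ge0// mulr_ge0//; lra.
Qed.

Lemma sum3_perm (V : nmodType) (F : 'I_3 -> V) k j1 j2 : k != j1 -> k != j2 -> j1 != j2 ->
  \sum_(i < 3) F i = F k + F j1 + F j2.
Proof.
move=> kj1 kj2 j12.
have e : forall i, (i == k) || (i == j1) || (i == j2).
  by move: kj1 kj2 j12; case: (I3P k) => ->; case: (I3P j1) => ->; case: (I3P j2) => -> //;
    move=> _ _ _ i; case: (I3P i) => ->.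
rewrite (bigD1 k)//= (bigD1 j1) 1?eq_sym//= (bigD1 j2)/=; last first.
  by rewrite ![j2 == _]eq_sym kj2 j12.
rewrite big1 ?addr0 ?addrA// => i /andP[/andP[ik i1] i2].
by move: (e i); rewrite (negbTE ik) (negbTE i1) (negbTE i2).
Qed.

Lemma param_bary k j1 j2 y : k != j1 -> k != j2 -> j1 != j2 ->
  param k j1 j2 (bary j1 y, bary j2 y) = y.
Proof.
move=> kj1 kj2 j12; rewrite -[RHS](bary_point (core K)) (sum3_perm _ kj1 kj2 j12).
have := bary_sum (core K) y; rewrite (sum3_perm _ kj1 kj2 j12) => s1.
have -> : bary k y = 1 - bary j1 y - bary j2 y by rewrite -s1; ring.
by apply: plane_eq; rewrite /param /= /GRing.scale/=; ring.
Qed.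

(** The slab estimate with side 1/2 for the pulled-back function, whose first and mixed second
    derivatives are [pull_grad] and [pull_hess]. The constant 2 L of the substitution comes from
    recovering the parameters as barycentric coordinates and from th >= 1/2. Exchanging j1 and j2
    gives the variation in the other parameter. *)
Lemma holder_bound k j1 j2 : k != j1 -> k != j2 -> j1 != j2 ->
  exists2 B : R, 0 < B & forall th c v g H M, shrinks K th c -> pulled_C2 K th c v g H ->
  (\int[mu2]_(x in W) (normsq g H x)%:E <= M%:E)%E ->
  forall (lam s s' t : R), 0 < lam -> 0 <= s <= 2^-1 -> 0 <= s' <= 2^-1 -> 0 <= t <= 2^-1 ->
  `|v (psi K (th *: param k j1 j2 (s, t) + c)) - v (psi K (th *: param k j1 j2 (s', t) + c))| <=
  lam * `|s - s'| + lam^-1 * (B * M).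
Proof.
move=> kj1 kj2 j12.
pose f1 := vert j1 - vert k; pose f2 := vert j2 - vert k.
have [B1 B10 hB1] := pull_sqr_le f1 f2.
have [L L0 hL] := bary_lip (core K).
pose Cc := 4 * (2 * L * (2 * C1)) ^+ 2.
have Cc0 : 0 < Cc by rewrite mulr_gt0// exprn_gt0// !mulr_gt0.
exists (B1 * Cc); first exact: mulr_gt0.
move=> th c v g H M hs hp hM lam s s' t lam0 hs1 hs2 ht.
have [th2 th1 hD] := hs; have [cg cH hv hg] := hp.
have thp : 0 < th by apply: lt_le_trans th2; rewrite invr_gt0.
pose Phi := param k j1 j2.
have inT z : square 2^-1 z -> T (Phi z) by exact: param_core.
pose S0 (z : plane R) := th *: Phi z + c.
have inU z : square 2^-1 z -> nbhd K (S0 z).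
  by move=> hz; apply: core_nbhd; apply: core_int_core; apply: hD; exact: inT.
have sq (a b : R) : 0 <= a <= 2^-1 -> 0 <= b <= 2^-1 -> square 2^-1 (a, b).
  by move=> ha hb; split; rewrite /= in_itv.
have S0c : continuous S0.
  move=> z; have h1 : z'.1 *: f1 @[z' --> z] --> z.1 *: f1.
    by apply: cvgZr_tmp; exact: cvg_fst.
  have h2 : z'.2 *: f2 @[z' --> z] --> z.2 *: f2.
    by apply: cvgZr_tmp; exact: cvg_snd.
  exact: (cvgD (cvgZ (cvg_cst th) (cvgD (cvgD (cvg_cst (vert k)) h1) h2)) (cvg_cst c)).
pose U z := v (psi K (S0 z)).
pose P z := pull_grad K g (S0 z) (th *: f1).
pose Q z := pull_hess K g H (S0 z) (th *: f1) (th *: f2).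
have e1 (a b : R) : S0 (a, b) = S0 (0, b) + a *: (th *: f1).
  by apply: plane_eq; rewrite /S0 /Phi /param /f1 /= /GRing.scale/=; ring.
have e2 (a b : R) : S0 (a, b) = S0 (a, 0) + b *: (th *: f2).
  by apply: plane_eq; rewrite /S0 /Phi /param /f2 /= /GRing.scale/=; ring.
have dU (a b : R) : 0 <= a <= 2^-1 -> 0 <= b <= 2^-1 ->
    is_derive a (1 : R) (fun a => U (a, b)) (P (a, b)).
  move=> ha hb.
  have -> : (fun a => U (a, b)) = (fun a => v (psi K (S0 (0, b) + a *: (th *: f1)))).
    by apply/funext => x; rewrite /U e1.
  have hT := inT _ (sq a b ha hb).
  rewrite /P e1; apply: pull_derive; rewrite -e1.
  - exact: inU (sq a b ha hb).
  - by have [] := hv _ hT.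
  - by have [_] := hv _ hT.
have dP (a b : R) : 0 <= a <= 2^-1 -> 0 <= b <= 2^-1 ->
    is_derive b (1 : R) (fun b => P (a, b)) (Q (a, b)).
  move=> ha hb.
  have -> : (fun b => P (a, b)) = (fun b => pull_grad K g (S0 (a, 0) + b *: (th *: f2)) (th *: f1)).
    by apply/funext => x; rewrite /P e2.
  have hT := inT _ (sq a b ha hb).
  rewrite /Q e2; apply: pull_grad_derive; rewrite -e2.
  - exact: inU (sq a b ha hb).
  - by move=> l; have [] := hg l _ hT.
  - by move=> l m; have [_] := hg l _ hT.
have cP z : square 2^-1 z -> {for z, continuous P}.
  move=> hz; exact: (cvg_comp _ _ (S0c z) (pull_grad_continuous cg (inU z hz))).
have cQ z : square 2^-1 z -> {for z, continuous Q}.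
  move=> hz; exact: (cvg_comp _ _ (S0c z) (pull_hess_continuous cg cH (inU z hz))).
have cN z : square 2^-1 z -> {for z, continuous (fun z => normsq g H (psi K (S0 z)))}.
  move=> hz; have cp := psi_continuous (inU z hz).
  have cn : {for psi K (S0 z), continuous (normsq g H)} by exact: normsq_continuous.
  exact: (cvg_comp _ _ (cvg_comp _ _ (S0c z) cp) cn).
have mSq := measurable_square (2^-1 : R).
have hint : (\int[mu2]_(z in square 2^-1) (P z ^+ 2 + Q z ^+ 2)%:E <= (B1 * Cc * M)%:E)%E.
  have f0 (z : mplane R) : square 2^-1 z -> (0 <= (P z ^+ 2 + Q z ^+ 2)%:E)%E.
    by move=> _; rewrite lee_fin addr_ge0 ?sqr_ge0.
  have mf : measurable_fun (square 2^-1) (fun z : mplane R => (P z ^+ 2 + Q z ^+ 2)%:E).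
    apply/measurable_EFinP; apply: measurable_funD; apply: measurable_funX;
    by apply: within_continuous_measurable_fun2 => //; exact: pointwise_within.
  have mn : measurable_fun (square 2^-1) (fun z : mplane R => normsq g H (psi K (S0 z))).
    by apply: within_continuous_measurable_fun2 => //; exact: pointwise_within.
  have mn1 : measurable_fun (square 2^-1) (fun z : mplane R => (normsq g H (psi K (S0 z)))%:E).
    exact/measurable_EFinP.
  have mn2 : measurable_fun (square 2^-1) (fun z : mplane R => (B1%:E * (normsq g H (psi K (S0 z)))%:E)%E).
    exact: measurable_funeM.
  have hle (z : mplane R) : square 2^-1 z ->
      ((P z ^+ 2 + Q z ^+ 2)%:E <= B1%:E * (normsq g H (psi K (S0 z)))%:E)%E.
    move=> hz; rewrite -EFinM lee_fin; apply: hB1 => //; first exact: ltW.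
    by apply: core_int_core; apply: hD; exact: inT.
  apply: (le_trans (@ge0_le_integral _ _ _ mu2 _ mSq _ _ f0 mf mn2 hle)).
  have n0 (z : mplane R) : square 2^-1 z -> (0 <= (normsq g H (psi K (S0 z)))%:E)%E.
    by move=> _; rewrite lee_fin normsq_ge0.
  have eZ := @ge0_integralZl_EFin _ _ _ mu2 (square 2^-1) mSq _ n0 mn1 _ (ltW B10).
  apply: (@le_trans _ _ (B1%:E * (Cc%:E * M%:E))%E); last by rewrite -!EFinM mulrA.
  apply: (@le_trans _ _ (B1%:E * \int[mu2]_(z in square 2^-1) (normsq g H (psi K (S0 z)))%:E)%E).
    by rewrite le_eqVlt; apply/orP; left; apply/eqP.
  apply: lee_wpmul2l; first by rewrite lee_fin ltW.
  have L20 : 0 < 2 * L by rewrite mulr_gt0.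
  apply: (@le_trans _ _ (Cc%:E * \int[mu2]_(x in W) (normsq g H x)%:E)%E); last first.
    by apply: lee_wpmul2l => //; rewrite lee_fin ltW.
  apply: (@elt_change_of_variables _ K C1 hC C10 (square 2^-1) S0 (2 * L) (normsq g H)) => //.
  - by rewrite mu2_box ?mu_cc ?invr_ge0 ?ltry//; exact: measurable_cc.
  - apply: continuous_measurable_fun2 => z.
    exact: (cvg_comp _ _ (S0c z) (@cvg_fst _ _ _ _ _)).
  - apply: continuous_measurable_fun2 => z.
    exact: (cvg_comp _ _ (S0c z) (@cvg_snd _ _ _ _ _)).
  - move=> a b ha hb.
    have eS : S0 a - S0 b = th *: (Phi a - Phi b).
      by rewrite /S0 opprD addrACA subrr addr0 scalerBr.
    rewrite eS normrZ (gtr0_norm thp).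
    have coor : `|a - b| <= L * `|Phi a - Phi b|.
      rewrite prod_normE ge_max; apply/andP; split.
        apply: le_trans (hL j1 _ _); rewrite !bary_param /= eqxx (negbTE j12) eq_sym (negbTE kj1).
        by rewrite !mulr0 !mulr1 !addr0 !add0r.
      apply: le_trans (hL j2 _ _); rewrite !bary_param /= eqxx ![j2 == _]eq_sym (negbTE j12) (negbTE kj2).
      by rewrite !mulr0 !mulr1 !add0r.
    apply: (le_trans coor).
    rewrite mulrA ler_wpM2r//.
    have h2 : 1 <= 2 * th by move: th2; lra.
    have -> : 2 * L * th = L * (2 * th) by ring.
    by rewrite ler_peMr// ltW.
  - by move=> a ha; apply: hD; exact: inT.
  - by apply: continuous_measurable_fun2; exact: normsq_continuous.
  - exact: normsq_ge0.
have h20 : 0 < (2^-1 : R) by rewrite invr_gt0.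
have h21 : (2^-1 : R) <= 1 by lra.
have := slab_holder h20 h21 lam0 dU dP cP cQ hint hs1 hs2 ht.
rewrite /U /S0 /Phi => h; apply: (le_trans h); rewrite lerD2l.
by rewrite (_ : (2 * lam * 2^-1) = lam)//; field.
Qed.

End Parallelograms.

Section Equicontinuity.
Context {R : realType}.
Variables (K : curved_triangle R) (C1 : R).
Hypothesis hC : (Lp_norm +oo (core_set (core K)) (D1_norm (psi K)) +
  Lp_norm +oo (elt_set K) (D1_norm (psi_inv K)) <= C1%:E)%E.
Hypothesis C10 : 0 < C1.

Local Notation T := (core_set (core K)).
Local Notation W := (elt_int K).

(* The core is covered by the three parallelograms on which two barycentric
   coordinates are at most 1/2; the point y need not lie in the one considered. *)
Lemma equicontinuous_piece k j1 j2 (y : plane R) (M eta : R) :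
  k != j1 -> k != j2 -> j1 != j2 -> T y -> 0 <= M -> 0 < eta ->
  exists2 d : R, 0 < d & forall th c v g H, shrinks K th c -> pulled_C2 K th c v g H ->
  (\int[mu2]_(x in W) (normsq g H x)%:E <= M%:E)%E ->
  forall y', T y' -> bary (core K) j1 y' <= 2^-1 -> bary (core K) j2 y' <= 2^-1 ->
  `|y' - y| < d ->
  `|v (psi K (th *: y' + c)) - v (psi K (th *: y + c))| <= eta.
Proof.
move=> kj1 kj2 j12 Ty M0 eta0.
have [L L0 hL] := bary_lip (core K).
(* If the coordinate j of y exceeds 1/2, so does that of all points near y, and the claim about y'
   becomes vacuous for a small d. *)
have outside j : 2^-1 < bary (core K) j y -> exists2 d : R, 0 < d &
    forall y', bary (core K) j y' <= 2^-1 -> d <= `|y' - y|.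
  move=> hj; exists ((bary (core K) j y - 2^-1) / L).
    by rewrite divr_gt0// subr_gt0.
  move=> y' hy'; rewrite ler_pdivrMr// mulrC.
  apply: le_trans (hL j y' y); rewrite distrC; apply: le_trans (ler_norm _).
  by rewrite lerB.
have [b1|b1] := leP (bary (core K) j1 y) 2^-1; last first.
  have [d d0 hd] := outside _ b1; exists d => // th c v g H _ _ _ y' _ h1 _.
  by rewrite ltNge hd.
have [b2|b2] := leP (bary (core K) j2 y) 2^-1; last first.
  have [d d0 hd] := outside _ b2; exists d => // th c v g H _ _ _ y' _ _ h2.
  by rewrite ltNge hd.
have kj1' : k != j1 by []. have j21 : j2 != j1 by rewrite eq_sym.
have [B B0 hB] := holder_bound hC C10 kj1 kj2 j12.
have [B' B'0 hB'] := holder_bound hC C10 kj2 kj1 j21.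
(* First [lam] is taken large enough for the term of order 1/lam to be at most eta/4, then d small
   enough for the linear term. Two moves with two terms each add up to eta. *)
pose lam := 4 * ((B + B') * M) / eta + 1.
have BM : 0 <= (B + B') * M by rewrite mulr_ge0// ltW// addr_gt0.
have lam0 : 0 < lam by rewrite ltr_wpDl//; apply: divr_ge0; [exact: mulr_ge0|exact: ltW].
have tail b : 0 < b -> b <= B + B' -> lam^-1 * (b * M) <= eta / 4.
  move=> b0 hb; rewrite mulrC ler_pdivrMr//.
  have h1 : b * M <= (B + B') * M by apply: ler_wpM2r.
  have -> : eta / 4 * lam = (B + B') * M + eta / 4.
    by rewrite /lam; field; rewrite gt_eqF.
  by apply: (le_trans h1); rewrite lerDl divr_ge0// ltW.
exists (eta / 4 / (lam * L)); first by rewrite !divr_gt0// mulr_gt0.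
move=> th c v g H hs hp hM y' Ty' b1' b2' hy.
have head j : lam * `|bary (core K) j y' - bary (core K) j y| <= eta / 4.
  have h := hL j y' y; rewrite ltr_pdivlMr ?mulr_gt0// in hy.
  apply: le_trans (ltW hy); rewrite mulrC [leRHS]mulrA [leRHS]mulrAC [leRHS]mulrC.
  rewrite [leRHS]mulrA; move: h; rewrite -(ler_pM2l lam0); lra.
have b0 := (core_setP _ _).1 Ty; have b0' := (core_setP _ _).1 Ty'.
have itv j z : (forall k, 0 <= bary (core K) k z) -> bary (core K) j z <= 2^-1 ->
    0 <= bary (core K) j z <= 2^-1 by move=> h ->; rewrite h.
have s1 := hB th c v g H M hs hp hM lam _ _ _ lam0 (itv j1 _ b0' b1') (itv j1 _ b0 b1) (itv j2 _ b0' b2').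
have s2 := hB' th c v g H M hs hp hM lam _ _ _ lam0 (itv j2 _ b0' b2') (itv j2 _ b0 b2) (itv j1 _ b0 b1).
have sw (a b : R) : param K k j2 j1 (b, a) = param K k j1 j2 (a, b).
  by rewrite /param /= addrAC.
rewrite !sw in s2; rewrite !param_bary// in s1 s2.
have t1 : lam^-1 * (B * M) <= eta / 4 by apply: tail => //; rewrite lerDl ltW.
have t2 : lam^-1 * (B' * M) <= eta / 4 by apply: tail => //; rewrite lerDr ltW.
have h1 := head j1; have h2 := head j2.
(* The intermediate point has the coordinate j1 of y and the coordinate j2 of y', so that each move
   changes one parameter only. *)
rewrite -(subrK (v (psi K (th *: param K k j1 j2 (bary (core K) j1 y, bary (core K) j2 y') + c)))
  (v (psi K (th *: y' + c)))) -addrA; apply: le_trans (ler_normD _ _) _.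
lra.
Qed.

Lemma equicontinuous (y : plane R) (M eta : R) : T y -> 0 <= M -> 0 < eta ->
  exists2 d : R, 0 < d & forall th c v g H, shrinks K th c -> pulled_C2 K th c v g H ->
  (\int[mu2]_(x in W) (normsq g H x)%:E <= M%:E)%E ->
  forall y', T y' -> `|y' - y| < d ->
  `|v (psi K (th *: y' + c)) - v (psi K (th *: y + c))| <= eta.
Proof.
move=> Ty M0 eta0.
have [d0 d00 h0] := @equicontinuous_piece i30 i31 i32 y M eta isT isT isT Ty M0 eta0.
have [d1 d10 h1] := @equicontinuous_piece i31 i30 i32 y M eta isT isT isT Ty M0 eta0.
have [d2 d20 h2] := @equicontinuous_piece i32 i30 i31 y M eta isT isT isT Ty M0 eta0.
exists (Num.min d0 (Num.min d1 d2)); first by rewrite !lt_min d00 d10.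
move=> th c v g H hs hp hM y' Ty'; rewrite !lt_min => /andP[l0 /andP[l1 l2]].
have b0 := (core_setP _ _).1 Ty'.
have := bary_sum (core K) y'; rewrite sum3 => s1.
have := b0 i30; have := b0 i31; have := b0 i32 => q2 q1 q0.
have [a0|a0] := leP (bary (core K) i30 y') 2^-1; last first.
  by apply: (h0 th c v g H) => //; lra.
have [a1|a1] := leP (bary (core K) i31 y') 2^-1; last first.
  by apply: (h1 th c v g H) => //; lra.
by apply: (h2 th c v g H).
Qed.

Variables (v_ : nat -> plane R -> R) (g_ : nat -> 'I_2 -> plane R -> R)
  (H_ : nat -> 'I_2 -> 'I_2 -> plane R -> R) (M : R) (v : plane R -> R).

(** The offset 2 gives del n <= 1/2 already at n = 0, so every contraction ratio is at least 1/2. *)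
Let del (n : nat) : R := n.+2%:R^-1.
Let th_ n := 1 - del n.
Let c_ n := del n *: barycenter (core K).

Let del0 n : 0 < del n. Proof. by rewrite invr_gt0. Qed.

Let del12 n : del n <= 2^-1.
Proof. by rewrite lef_pV2 ?posrE// ler_nat. Qed.

Lemma shrinks_contract n : shrinks K (th_ n) (c_ n).
Proof.
have := del0 n; have := del12 n => h1 h2.
split; rewrite /th_; [lra|lra|].
by move=> y Ty; apply: (contract_int _ _ Ty) => //; lra.
Qed.

Lemma del_small (e : R) : 0 < e -> exists n0, forall n, (n0 <= n)%N -> del n < e.
Proof.
move=> e0; exists (Num.bound e^-1) => n hn.
rewrite /del -(invrK e) ltf_pV2 ?posrE ?invr_gt0//.
apply: lt_le_trans (_ : (Num.bound e^-1)%:R <= _).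
  by apply: archi_boundP; rewrite invr_ge0 ltW.
by rewrite ler_nat; apply: (leq_trans hn); rewrite -addn2 leq_addr.
Qed.

Hypothesis M0 : 0 <= M.
Hypothesis hp : forall n, pulled_C2 K (th_ n) (c_ n) (v_ n) (g_ n) (H_ n).
Hypothesis hM : forall n, (\int[mu2]_(x in W) (normsq (g_ n) (H_ n) x)%:E <= M%:E)%E.
Hypothesis v_ae : {ae mu2, forall x : mplane R, v_ n x @[n --> \oo] --> (v \_ (elt_set K)) x}.

Let u_ n y := v_ n (psi K (th_ n *: y + c_ n)).

(* v_n (psi y) is the value of u_n at the preimage of y under the n-th
   contraction, a point which tends to y. *)
Lemma shrink_defect y (eta : R) : core_int (core K) y -> 0 < eta ->
  exists n0, forall n, (n0 <= n)%N -> `|v_ n (psi K y) - u_ n y| <= eta.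
Proof.
move=> Ty eta0.
have [d d0 hd] := equicontinuous (core_int_core Ty) M0 eta0.
have [r /= r0 hr] : nbhs_ball y (core_int (core K)).
  by apply/nbhs_ballP; apply: open_nbhs_nbhs; split => //; exact: core_int_open.
pose A := 2 * `|y - barycenter (core K)| + 1.
have A0 : 0 < A by rewrite ltr_wpDl// mulr_ge0.
have rdA : 0 < Num.min r d / A by rewrite divr_gt0// lt_min r0.
have [n0 hn0] := del_small rdA.
exists n0 => n /hn0; rewrite ltr_pdivlMr// => hn.
have dn := del0 n; have dn2 := del12 n.
have thn : 0 < th_ n by rewrite /th_; lra.
(* Solves th_n y'' + c_n = y. Since th_n >= 1/2, its distance to y is at most 2 del_n times the
   distance from y to the barycenter, which explains [A]. *)
pose y'' := y + (del n / th_ n) *: (y - barycenter (core K)).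
have ey : th_ n *: y'' + c_ n = y.
  have th0 : th_ n != 0 by rewrite gt_eqF.
  have -> : th_ n *: y'' + c_ n = (th_ n + del n) *: y.
    rewrite /y'' scalerDr scalerA mulrCA mulfV// mulr1 /c_ scalerBr -addrA subrK.
    by rewrite scalerDl.
  by rewrite /th_ subrK scale1r.
have hy : `|y'' - y| < Num.min r d.
  apply: le_lt_trans hn; rewrite /y'' addrC addKr normrZ ger0_norm; last by rewrite divr_ge0// ltW.
  rewrite /A mulrDr mulr1; apply: le_trans (_ : del n * (2 * `|y - barycenter (core K)|) <= _).
    rewrite -mulrA ler_pM2l// ler_wpM2r//.
    by rewrite -[leRHS]invrK lef_pV2 ?posrE ?invr_gt0// /th_; lra.
  by rewrite lerDl ltW.
move: hy; rewrite lt_min => /andP[hy1 hy2].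
have Ty'' : T y''.
  by apply: core_int_core; apply: hr; rewrite -ball_normE /= distrC.
have := hd _ _ _ _ _ (shrinks_contract n) (hp n) (hM n) y'' Ty'' hy2.
by rewrite ey.
Qed.

(** Near y there is a point y' of the open core at whose image v_n converges. The six errors are,
    for both indices, the move from y to y' by equicontinuity, the shrinking defect at y', and the
    distance of v_n to its limit there. *)
Lemma u_near_cauchy y (eta : R) : T y -> 0 < eta ->
  exists n0, forall n m, (n0 <= n)%N -> (n0 <= m)%N -> `|u_ n y - u_ m y| <= eta.
Proof.
move=> Ty eta0.
have e6 : 0 < eta / 6 by rewrite divr_gt0.
have [d d0 hd] := equicontinuous Ty M0 e6.
have oB : open (ball y d `&` core_int (core K)).
  by apply: openI; [exact: ball_open|exact: core_int_open].
have oO : open (psi K @` (ball y d `&` core_int (core K))).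
  by apply: psi_open => // z [_ /core_int_core/core_nbhd].
have [z [zd zi]] : exists z, (ball y d `&` core_int (core K)) z.
  have c := cvg_at_right_filter (@contract_cvg _ K y).
  have nb : nbhs y (ball y d) by exact: nbhsx_ballx.
  have : \forall s \near (0 : R)^'+, [/\ 0 < s, s <= 1 & ball y d (contract K s y)].
    near=> s; split.
    - by near: s; exact: nbhs_right_gt.
    - by apply/ltW; near: s; exact: nbhs_right_lt.
    - by near: s; exact: c nb.
  by move=> /filter_ex[s [s0 s1 hb]]; exists (contract K s y); split => //; exact: contract_int.
have Oz : (psi K @` (ball y d `&` core_int (core K))) (psi K z) by exists z.
have [_ [y' [yd yi] <-] cv] := ae_open_exists oO Oz v_ae.
have Ky : elt_set K (psi K y') by exists y' => //; exact: core_int_core.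
rewrite patchE mem_set// in cv.
have [n1 hn1] := shrink_defect yi e6.
move/cvgrPdist_lt : cv => /(_ _ e6) [n2 _ hn2].
exists (maxn n1 n2) => n m; rewrite !geq_max => /andP[a1 a2] /andP[b1 b2].
have hy : `|y' - y| < d by move: yd; rewrite -ball_normE /= distrC.
have k1 := hd _ _ _ _ _ (shrinks_contract n) (hp n) (hM n) y' (core_int_core yi) hy.
have k2 := hd _ _ _ _ _ (shrinks_contract m) (hp m) (hM m) y' (core_int_core yi) hy.
have k3 := hn1 n a1; have k4 := hn1 m b1.
have k5 := ltW (hn2 n a2); have k6 := ltW (hn2 m b2).
move: k1 k2 k3 k4 k5 k6; rewrite -/(u_ n y') -/(u_ n y) -/(u_ m y') -/(u_ m y).
move: (u_ n y') (u_ n y) (u_ m y') (u_ m y) (v_ n _) (v_ m _) (v _) => a b a' b' p q w.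
rewrite !ler_norml => /andP[? ?] /andP[? ?] /andP[? ?] /andP[? ?] /andP[? ?] /andP[? ?].
by apply/andP; split; lra.
Unshelve. all: by end_near. Qed.

(** The limit of u_n exists at every point of the closed core, vertices included, and inherits
    continuity from the uniform modulus. The vanishing defect identifies it with v almost everywhere
    on W, and the boundary is null. *)
Lemma limit_continuous_rep : mu2 (elt_set K `\` W : set (mplane R)) = 0%E ->
  exists2 w : plane R -> R, is_continuous_rep (elt_set K) v w &
    forall y, T y -> u_ n y @[n --> \oo] --> w (psi K y).
Proof.
move=> null.
have /choice[w0 hw0] : forall y, exists l : R, T y -> u_ n y @[n --> \oo] --> l.
  move=> y; have [Ty|nTy] := pselect (T y); last by exists 0.
  have : cvgn (fun n => u_ n y).
    apply: cauchy_cvg; apply/cauchyP => e e0.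
    have e20 : 0 < e / 2 by rewrite divr_gt0.
    have [n0 hn0] := u_near_cauchy Ty e20.
    exists (u_ n0 y); exists n0 => // n /= hn.
    rewrite -ball_normE /=; apply: le_lt_trans (hn0 _ _ (leqnn _) hn) _.
    by rewrite ltr_pdivrMr// ltr_pMr// ltr1n.
  by move=> /cvg_ex[l hl]; exists l.
have w0_close y (eta : R) : T y -> 0 < eta -> exists2 d : R, 0 < d &
    forall y', T y' -> `|y' - y| < d -> `|w0 y' - w0 y| <= eta.
  move=> Ty eta0; have [d d0 hd] := equicontinuous Ty M0 eta0.
  exists d => // y' Ty' hy.
  have c : `|u_ n y' - u_ n y| @[n --> \oo] --> `|w0 y' - w0 y|.
    exact: (cvg_norm (cvgB (hw0 _ Ty') (hw0 _ Ty))).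
  apply: (@closed_cvg _ _ _ eventually_filter _ [set z : R | z <= eta] _ _ _ c).
    exact: closed_le.
  apply: nearW => n; exact: hd (shrinks_contract n) (hp n) (hM n) y' Ty' hy.
exists (w0 \o psi_inv K); last first.
  by move=> y Ty; rewrite /= psiK; [exact: hw0|exact: core_nbhd].
split.
  apply/subspace_continuousP => _ [y Ty <-].
  have ew : (w0 \o psi_inv K) (psi K y) = w0 y by rewrite /= (psiK (core_nbhd Ty)).
  rewrite [X in _ --> X]ew.
  apply/cvgrPdist_le => eta eta0.
  have [d d0 hd] := w0_close y eta Ty eta0.
  have ci : psi_inv K z @[z --> psi K y] --> y.
    by rewrite -[X in _ --> X](psiK (core_nbhd Ty)); exact: psi_inv_continuous (core_nbhd Ty).
  have : \forall z \near psi K y, `|y - psi_inv K z| < d.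
    by move/cvgrPdist_lt : ci => /(_ _ d0).
  rewrite /within /=; apply: filterS => z hz Kz; rewrite /= distrC.
  by apply: hd; [exact: psi_inv_core|rewrite distrC].
have nneg : mu2.-negligible (elt_set K `\` W : set (mplane R)).
  apply/negligibleP => //; apply: measurableD; [exact: measurable_elt|exact: measurable_elt_int].
apply: (negligibleS _ (negligibleU v_ae nneg)) => x /= hx.
apply: contrapT => /not_orP[/contrapT h1 h2]; apply: hx => Kx.
have [y yi exy] : W x by apply: contrapT => nW; apply: h2.
have Ty := core_int_core yi.
rewrite patchE mem_set// in h1.
rewrite -exy psiK; last exact: core_nbhd.
apply: (cvg_unique _ (hw0 y Ty)) => //.
apply/cvgrPdist_le => e e0; have e20 : 0 < e / 2 by rewrite divr_gt0.
have [n1 hn1] := shrink_defect yi e20.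
move/cvgrPdist_le : h1 => /(_ _ e20) [n2 _ hn2].
exists (maxn n1 n2) => // n /=; rewrite geq_max => /andP[a1 a2].
have := hn1 n a1; have := hn2 n a2; rewrite exy.
move: (v_ n x) (v x) (u_ n y) => a b p k1 k2.
have -> : b - p = (b - a) + (a - p) by ring.
apply: le_trans (ler_normD _ _) _; lra.
Qed.

End Equicontinuity.

(** * The interpolation estimate *)

Section L2Tools.
Context {R : realType}.
Local Notation half n := ((2^-1 : R) ^+ n).

Lemma sum_half_le n : \sum_(0 <= k < n) half k <= 2.
Proof.
suff -> : \sum_(0 <= k < n) half k = 2 - 2 * half n.
  by rewrite lerBlDr lerDl mulr_ge0// exprn_ge0// invr_ge0.
elim: n => [|n ih]; first by rewrite big_geq// expr0 mulr1 subrr.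
by rewrite big_nat_recr//= ih exprS; field.
Qed.

(** The rate 2^-n avoids extracting a subsequence: the sum of the squared errors is integrable,
    hence finite almost everywhere, and its terms tend to 0. *)
Lemma ae_cvg_of_sqint (f_ : nat -> mplane R -> R) (f : mplane R -> R) :
  (forall n, measurable_fun setT (f_ n)) -> measurable_fun setT f ->
  (forall n, (sqint setT (fun x => (f_ n x - f x)%R) <= (half n)%:E)%E) ->
  {ae mu2, forall x : mplane R, f_ n x @[n --> \oo] --> f x}.
Proof.
move=> mf_ mf hf.
pose a n (x : mplane R) := (f_ n x - f x) ^+ 2.
have a0 n x : 0 <= a n x by exact: sqr_ge0.
have a0E n x : (0 <= (a n x)%:E)%E by rewrite lee_fin.
have ma n : measurable_fun setT (fun x => (a n x)%:E).
  by apply: measurable_sqr; exact: measurable_funB.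
have eS := @integral_nneseries _ _ _ mu2 setT measurableT (fun n x => (a n x)%:E) ma (fun n x _ => a0E n x).
pose S x := (\sum_(0 <= n <oo) (a n x)%:E)%E.
have S0 x : (0 <= S x)%E by apply: nneseries_ge0 => n _ _; exact: a0E.
have mS : measurable_fun setT S by apply: ge0_emeasurable_sum => n *; [exact: a0E|exact: ma].
have hS : (\int[mu2]_x S x <= 2%:E)%E.
  rewrite /S eS; apply: lime_le.
    by apply: is_cvg_nneseries => n _ _; exact: sqint_ge0.
  apply: nearW => n; apply: (@le_trans _ _ (\sum_(0 <= k < n) (half k)%:E)%E).
    by apply: lee_sum => k _; exact: hf.
  by rewrite sumEFin lee_fin; exact: sum_half_le.
have iS : mu2.-integrable setT S.
  apply/integrableP; split => //.
  have -> : (\int[mu2]_x `|S x| = \int[mu2]_x S x)%E.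
    by apply: eq_integral => x _; rewrite gee0_abs.
  by apply: le_lt_trans hS _; exact: ltry.
have [N [mN N0 hN]] := integrable_ae measurableT iS.
exists N; split => // x hx; apply: hN => /= hfin; apply: hx => /=.
have {}hfin := hfin Logic.I.
have c : a n x @[n --> \oo] --> (0 : R).
  apply: cvg_series_cvg_0; apply: nondecreasing_is_cvgn.
    apply/nondecreasing_seqP => n; rewrite /series /= big_nat_recr//= lerDl.
    exact: a0.
  exists (fine (S x)) => _ [n _ <-]; rewrite -lee_fin fineK// /series /= -sumEFin.
  by apply: nneseries_lim_ge => k _ _; exact: a0E.
apply/cvgrPdist_lt => e e0.
have e2 : 0 < e ^+ 2 by rewrite exprn_gt0.
move/cvgrPdist_lt : c => /(_ _ e2) [n0 _ hn]; exists n0 => // n /hn /=.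
rewrite sub0r normrN (ger0_norm (a0 n x)) => h.
have e0' := ltW e0.
by rewrite distrC -ltr_sqr ?nnegrE// real_normK ?num_real.
Qed.

Lemma sqr_poweR (a : R) : (`|a%:E| `^ 2 = (a ^+ 2)%:E)%E.
Proof. by rewrite abse_EFin poweR_EFin powR_mulrn// real_normK ?num_real. Qed.

Lemma Lp_norm2E (A : set (plane R)) (f : plane R -> R) :
  Lp_norm 2%:E A f = ((sqint A f) `^ 2^-1)%E.
Proof.
rewrite /Lp_norm unlock /=; congr (_ `^ _)%E.
rewrite /sqint [RHS]integral_mkcond; apply: eq_integral => x _.
by apply: (etrans (sqr_poweR ((f \_ A) x))); rewrite !patchE; case: ifP => //; rewrite expr0n.
Qed.

Lemma L2_onE (A : set (plane R)) (f : plane R -> R) : L2_on A f ->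
  measurable_fun setT (f \_ A : mplane R -> R) /\ (sqint setT (f \_ A) < +oo)%E.
Proof.
move=> h; have mf : measurable_fun setT (f \_ A : mplane R -> R).
  by have := sub_Lfun_mfun h; rewrite inE.
split => //; have : finite_norm mu2 2%:E (f \_ A : mplane R -> R).
  by have := sub_Lfun_finLfun h; rewrite inE.
rewrite /finite_norm unlock /= => /lty_poweRy.
rewrite invr_eq0 pnatr_eq0 /= => /(_ isT).
move=> h2; apply: le_lt_trans h2; rewrite le_eqVlt; apply/orP; left; apply/eqP.
by apply: eq_integral => x _; exact: (esym (sqr_poweR ((f \_ A) x))).
Qed.

Section Triangle.
Variable A : set (plane R).
Hypothesis mA : measurable (A : set (mplane R)).

Lemma Lp_normD_le (f g : plane R -> R) :
  measurable_fun (A : set (mplane R)) f -> measurable_fun (A : set (mplane R)) g ->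
  (Lp_norm 2%:E A (fun x => f x + g x)%R <= Lp_norm 2%:E A f + Lp_norm 2%:E A g)%E.
Proof.
move=> mf mg; rewrite /Lp_norm.
have -> : (fun x => f x + g x) \_ A = (f \_ A \+ g \_ A)%R.
  by apply/funext => x; rewrite /= !patchE; case: ifP => // _; rewrite addr0.
apply: minkowski_EFin.
- exact/(measurable_restrictT _ mA).
- exact/(measurable_restrictT _ mA).
- by rewrite ler1n.
Qed.

Lemma Lp_normZ (k : R) (f : plane R -> R) : 0 <= k ->
  measurable_fun (A : set (mplane R)) f ->
  Lp_norm 2%:E A (fun x => k * f x)%R = (k%:E * Lp_norm 2%:E A f)%E.
Proof.
move=> k0 mf; rewrite !Lp_norm2E sqintZ// poweRM ?sqint_ge0 ?lee_fin ?sqr_ge0//.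
congr (_ * _)%E; rewrite poweR_EFin; congr EFin.
by rewrite -powR_mulrn// -powRrM mulfV ?pnatr_eq0// powRr1.
Qed.

Lemma Lp_norm_abs (f : plane R -> R) : Lp_norm 2%:E A (fun x => `|f x|) = Lp_norm 2%:E A f.
Proof.
rewrite !Lp_norm2E; congr (_ `^ _)%E; apply: eq_integral => x _.
by rewrite real_normK ?num_real.
Qed.

Lemma Lp_norm_le_of_sqint (k : R) (f g : plane R -> R) : 0 <= k ->
  measurable_fun (A : set (mplane R)) g ->
  (sqint A f <= (k ^+ 2)%:E * sqint A g)%E ->
  (Lp_norm 2%:E A f <= k%:E * Lp_norm 2%:E A g)%E.
Proof.
move=> k0 mg h; rewrite -Lp_normZ// !Lp_norm2E sqintZ//.
have s0 := sqint_ge0 A f.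
have s1 : (0 <= (k ^+ 2)%:E * sqint A g)%E by rewrite mule_ge0 ?sqint_ge0// lee_fin sqr_ge0.
have k2 : 0 <= (2^-1 : R) by rewrite invr_ge0.
by apply: (gt0_ler_poweR k2); rewrite ?in_itv/= ?leey ?s0 ?s1.
Qed.

End Triangle.
End L2Tools.

Section DensityTools.
Context {R : realType}.
Variable K : curved_triangle R.

Local Notation T := (core_set (core K)).
Local Notation W := (elt_int K).
Local Notation h_ := (h_dir (core K)).

(** The constant B depends on K. It only serves to show that the density of the mollification error
    tends to 0 in L2. *)
Lemma density_sqr_le : exists2 B : R, 0 < B & forall g H a, T a ->
  density K g H a ^+ 2 <= B * normsq g H (psi K a).
Proof.
pose r_ := r_dir (core K).
have cD1 f a : T a -> {for a, continuous (fun a => D1 (psi K) a f)}.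
  by move=> /core_nbhd Ua; apply: D1_continuous => l; exact: psi_partial_continuous.
have cD2 f f' a : T a -> {for a, continuous (fun a => D2 (psi K) a f f')}.
  by move=> /core_nbhd Ua; apply: D2_continuous => l m; exact: psi_partial2_continuous.
have /choice[B1 hB1] i : exists B, 0 < B /\ forall a, T a -> `|D1 (psi K) a (r_ i)| <= B.
  by have [B ? ?] := core_bounded_map (cD1 (r_ i)); exists B.
have /choice[B2 hB2] (p : 'I_2 * 'I_2) : exists B, 0 < B /\
    forall a, T a -> `|D2 (psi K) a (r_ p.1) (r_ p.2)| <= B.
  by have [B ? ?] := core_bounded_map (cD2 (r_ p.1) (r_ p.2)); exists B.
pose B := \sum_i B1 i + \sum_p B2 p.
have s1 : 0 <= \sum_i B1 i by apply: sumr_ge0 => i _; have [/ltW] := hB1 i.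
have s2 : 0 <= \sum_p B2 p by apply: sumr_ge0 => i _; have [/ltW] := hB2 i.
have B0 : 0 <= B by exact: addr_ge0.
have b1 i a : T a -> `|D1 (psi K) a (r_ i)| <= B.
  move=> Ta; apply: le_trans ((hB1 i).2 _ Ta) _; rewrite /B (bigD1 i)//= -addrA lerDl addr_ge0//.
  by apply: sumr_ge0 => j _; have [/ltW] := hB1 j.
have b2 i j a : T a -> `|D2 (psi K) a (r_ i) (r_ j)| <= B.
  move=> Ta; apply: le_trans ((hB2 (i, j)).2 _ Ta) _; rewrite /B (bigD1 (i, j))//= addrCA lerDl addr_ge0//.
  by apply: sumr_ge0 => p _; have [/ltW] := hB2 p.
pose S := \sum_(i < 2) \sum_(j < 2) h_ i * h_ j * (2 * B ^+ 2 + 2 * B).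
exists (S ^+ 2 + 1); first by rewrite ltr_wpDl// sqr_ge0.
move=> g H a Ta; pose n := normsq g H (psi K a); pose q := Num.sqrt n.
have n0 : 0 <= n := normsq_ge0 g H (psi K a).
have q0 : 0 <= q by exact: sqrtr_ge0.
have qq : q ^+ 2 = n by exact: sqr_sqrtr.
have Sg0 : 0 <= \sum_(l < 2) g l (psi K a) ^+ 2 by apply: sumr_ge0 => l _; exact: sqr_ge0.
have SH0 : 0 <= \sum_(l < 2) \sum_(m < 2) H l m (psi K a) ^+ 2.
  by apply: sumr_ge0 => l _; apply: sumr_ge0 => m _; exact: sqr_ge0.
have root x c : 0 <= c -> x ^+ 2 <= c ^+ 2 * n -> `|x| <= c * q.
  move=> c0 h; rewrite -ler_sqr ?nnegrE ?mulr_ge0// real_normK ?num_real//.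
  by rewrite exprMn qq.
have dle : density K g H a <= S * q.
  rewrite /density /S mulr_suml; apply: ler_sum => i _; rewrite mulr_suml; apply: ler_sum => j _.
  rewrite -[leRHS]mulrA; apply: ler_wpM2l; first by rewrite mulr_ge0// h_dir_ge0.
  rewrite mulrDl; apply: lerD; apply: root; rewrite ?mulr_ge0 ?sqr_ge0//.
    apply: le_trans (hessv_sqr_le H (psi K a) (b1 i a Ta) (b1 j a Ta)) _.
    have -> : (2 * B ^+ 2) ^+ 2 = 4 * B ^+ 4 by ring.
    by apply: ler_wpM2l; [rewrite mulr_ge0// exprn_ge0|rewrite lerDr].
  apply: le_trans (gradv_sqr_le g (psi K a) (b2 i j a Ta)) _.
  have -> : (2 * B) ^+ 2 = 4 * B ^+ 2 by ring.
  apply: ler_pM => //; rewrite ?lerDl//; first by rewrite mulr_ge0// sqr_ge0.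
  by apply: ler_wpM2r; [exact: sqr_ge0|lra].
apply: le_trans (_ : (S * q) ^+ 2 <= _).
  have dg0 := density_ge0 K g H a; have Sq0 := le_trans dg0 dle.
  by rewrite ler_sqr ?nnegrE.
by rewrite exprMn qq; apply: ler_wpM2r => //; rewrite lerDl.
Qed.

Lemma density_triangle g H g' H' a : density K g H a <= density K g' H' a +
  density K (fun l x => g l x - g' l x) (fun l m x => H l m x - H' l m x) a.
Proof.
rewrite /density -big_split /=; apply: ler_sum => i _.
rewrite -big_split /=; apply: ler_sum => j _; rewrite -mulrDr.
apply: ler_wpM2l; first by rewrite mulr_ge0// h_dir_ge0.
have eh p q : hessv H (psi K a) p q = hessv H' (psi K a) p q +
    hessv (fun l m x => H l m x - H' l m x) (psi K a) p q.
  by rewrite /hessv !sum2; ring.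
have eg p : gradv g (psi K a) p = gradv g' (psi K a) p +
    gradv (fun l x => g l x - g' l x) (psi K a) p.
  by rewrite /gradv !sum2; ring.
rewrite [leRHS]addrACA {1}eh {1}eg; apply: lerD; exact: ler_normD.
Qed.

Lemma measurable_comp_psi_inv (F : plane R -> R) :
  (forall y, T y -> {for y, continuous F}) ->
  measurable_fun (elt_set K : set (mplane R)) (fun x => F (psi_inv K x)).
Proof.
move=> cF; apply: within_continuous_measurable_fun2; first exact: measurable_elt.
apply: pointwise_within => _ [y Ty <-]; have Uy := core_nbhd Ty.
have ci : psi_inv K z @[z --> psi K y] --> y.
  by rewrite -[X in _ --> X](psiK Uy); exact: psi_inv_continuous Uy.
have c : F (psi_inv K z) @[z --> psi K y] --> F (psi_inv K (psi K y)).
  by rewrite (psiK Uy); exact: (cvg_comp _ _ ci (cF y Ty)).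
exact: c.
Qed.

Lemma measurable_hess_apply H i j :
  (forall l m, measurable_fun (elt_set K : set (mplane R)) (H l m)) ->
  measurable_fun (elt_set K : set (mplane R)) (hess_apply H (tau K i) (tau K j)).
Proof.
move=> mH; have mt l k : measurable_fun (elt_set K : set (mplane R)) (fun x => coord l (tau K k x)).
  apply: (@measurable_comp_psi_inv (fun a => coord l (D1 (psi K) a (r_dir (core K) k)))) => y Ty.
  have c : D1 (psi K) z (r_dir (core K) k) @[z --> y] --> D1 (psi K) y (r_dir (core K) k).
    by apply: D1_continuous => l'; apply: psi_partial_continuous; exact: core_nbhd.
  exact: (coord_cvg c).
have -> : hess_apply H (tau K i) (tau K j) = (fun x =>
   (H ord0 ord0 x * coord ord0 (tau K i x) * coord ord0 (tau K j x) +
    H ord0 ord_max x * coord ord0 (tau K i x) * coord ord_max (tau K j x)) +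
   (H ord_max ord0 x * coord ord_max (tau K i x) * coord ord0 (tau K j x) +
    H ord_max ord_max x * coord ord_max (tau K i x) * coord ord_max (tau K j x))).
  by apply/funext => x; rewrite /hess_apply !sum2.
by do ?apply: measurable_funD; do ?apply: measurable_funM.
Qed.

Lemma measurable_grad_dot g i j :
  (forall l, measurable_fun (elt_set K : set (mplane R)) (g l)) ->
  measurable_fun (elt_set K : set (mplane R)) (grad_dot g (bfield K i j)).
Proof.
move=> mg; have mt l : measurable_fun (elt_set K : set (mplane R)) (fun x => coord l (bfield K i j x)).
  apply: (@measurable_comp_psi_inv (fun a => coord l
    (D2 (psi K) a (r_dir (core K) i) (r_dir (core K) j)))) => y Ty.
  have c : D2 (psi K) z (r_dir (core K) i) (r_dir (core K) j) @[z --> y] -->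
      D2 (psi K) y (r_dir (core K) i) (r_dir (core K) j).
    by apply: D2_continuous => l' m; apply: psi_partial2_continuous; exact: core_nbhd.
  exact: (coord_cvg c).
have -> : grad_dot g (bfield K i j) = (fun x =>
   g ord0 x * coord ord0 (bfield K i j x) + g ord_max x * coord ord_max (bfield K i j x)).
  by apply/funext => x; rewrite /grad_dot !sum2.
by apply: measurable_funD; apply: measurable_funM.
Qed.

Lemma measurable_density_inv g H :
  (forall l, measurable_fun (elt_set K : set (mplane R)) (g l)) ->
  (forall l m, measurable_fun (elt_set K : set (mplane R)) (H l m)) ->
  measurable_fun (elt_set K : set (mplane R)) (fun x => density K g H (psi_inv K x)).
Proof.
move=> mg mH.
pose s i j x := h_ i * h_ j * (`|hess_apply H (tau K i) (tau K j) x| +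
  `|grad_dot g (bfield K i j) x|).
have ms i j : measurable_fun (elt_set K : set (mplane R)) (s i j).
  apply: measurable_funM => //; apply: measurable_funD; apply: measurableT_comp => //.
    exact: measurable_hess_apply.
  exact: measurable_grad_dot.
have h : measurable_fun (elt_set K : set (mplane R))
    (fun x => (s ord0 ord0 x + s ord0 ord_max x) + (s ord_max ord0 x + s ord_max ord_max x)).
  by apply: measurable_funD; apply: measurable_funD.
apply: eq_measurable_fun h => x; rewrite inE => Kx.
by rewrite density_psi_inv// !sum2.
Qed.

End DensityTools.

Section MollifiedSequence.
Context {R : realType}.
Local Notation half n := ((2^-1 : R) ^+ n).

(** The factor 6 counts two first and four second derivatives. *)
Lemma normsq_integral_le (D : set (mplane R)) (g : 'I_2 -> plane R -> R)
    (H : 'I_2 -> 'I_2 -> plane R -> R) (b : R) : measurable D ->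
  (forall l, measurable_fun D (g l)) -> (forall l m, measurable_fun D (H l m)) ->
  (forall l, (sqint D (g l) <= b%:E)%E) -> (forall l m, (sqint D (H l m) <= b%:E)%E) ->
  (\int[mu2]_(x in D) (normsq g H x)%:E <= (6 * b)%:E)%E.
Proof.
move=> mD mg mH bg bH.
pose good (f : mplane R -> R) (c : R) := [/\ measurable_fun D f, forall x, 0 <= f x &
  (\int[mu2]_(x in D) (f x)%:E <= c%:E)%E].
have goodD f1 f2 c1 c2 : good f1 c1 -> good f2 c2 -> good (fun x => f1 x + f2 x) (c1 + c2).
  move=> [m1 p1 h1] [m2 p2 h2]; split; first exact: measurable_funD.
    by move=> x; rewrite addr_ge0.
  have e := @ge0_integralD _ _ _ mu2 D mD (fun x => (f1 x)%:E) (fun x => (f2 x)%:E)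
    (fun x _ => p1 x) ((measurable_EFinP _ _).2 m1) (fun x _ => p2 x) ((measurable_EFinP _ _).2 m2).
  apply: (le_trans _ (leeD h1 h2)); rewrite le_eqVlt; apply/orP; left; apply/eqP; exact: e.
have gsq f : measurable_fun D f -> (sqint D f <= b%:E)%E -> good (fun x => f x ^+ 2) b.
  by move=> mf hf; split => //; [exact: measurable_funX|move=> x; exact: sqr_ge0].
have [_ _ h] := goodD _ _ _ _ (goodD _ _ _ _ (gsq _ (mg ord0) (bg ord0)) (gsq _ (mg ord_max) (bg ord_max)))
  (goodD _ _ _ _ (goodD _ _ _ _ (gsq _ (mH ord0 ord0) (bH ord0 ord0)) (gsq _ (mH ord0 ord_max) (bH ord0 ord_max)))
   (goodD _ _ _ _ (gsq _ (mH ord_max ord0) (bH ord_max ord0)) (gsq _ (mH ord_max ord_max) (bH ord_max ord_max)))).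
rewrite (_ : 6 * b = b + b + (b + b + (b + b))); last by ring.
apply: le_trans h; rewrite le_eqVlt; apply/orP; left; apply/eqP.
by apply: eq_integral => x _; rewrite /normsq !sum2.
Qed.

Lemma sum3_cvg {U : Type} (F : set_system U) {FF : Filter F} (f : 'I_3 -> U -> R) (l : 'I_3 -> R) :
  (forall k, f k z @[z --> F] --> l k) ->
  \sum_(k < 3) f k z @[z --> F] --> \sum_(k < 3) l k.
Proof.
move=> h; rewrite sum3 (_ : (fun z => \sum_(k < 3) f k z) =
    (fun z => f i30 z + f i31 z + f i32 z)); last by apply/funext => z; exact: sum3.
exact: (cvgD (cvgD (h _) (h _)) (h _)).
Qed.

Lemma common_radius (P : 'I_2 -> R -> Prop) :
  (forall l, exists2 d : R, 0 < d & forall e, 0 < e -> e < d -> P l e) ->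
  exists2 d : R, 0 < d & forall e, 0 < e -> e < d -> forall l, P l e.
Proof.
move=> h; have [d0 d00 h0] := h ord0; have [d1 d10 h1] := h ord_max.
exists (Num.min d0 d1); first by rewrite lt_min d00.
move=> e e0; rewrite lt_min => /andP[l0 l1] l.
by case: (I2P l) => ->; [exact: h0|exact: h1].
Qed.

Variables (K : curved_triangle R) (C1 : R).
Hypothesis hC : (Lp_norm +oo (core_set (core K)) (D1_norm (psi K)) +
  Lp_norm +oo (elt_set K) (D1_norm (psi_inv K)) <= C1%:E)%E.
Hypothesis C10 : 0 < C1.

Local Notation T := (core_set (core K)).
Local Notation W := (elt_int K).
Local Notation A := (elt_set K).

Variables (v : plane R -> R) (g : 'I_2 -> plane R -> R) (H : 'I_2 -> 'I_2 -> plane R -> R).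
Hypothesis hv : in_H2 A v g H.

(** Two demands on the n-th radius: kernels centred on the image of the contracted core are
    supported in W, and all L2 errors are at most 2^-n, which makes them summable. *)
Definition smoothing_radius (n : nat) (e : R) := [/\ 0 < e,
  forall y x, T y -> `|x - psi K (contract K n.+2%:R^-1 y)| <= e -> W x,
  (sqint setT (fun x => (convol (v \_ A) (kernel e) x - (v \_ A) x)%R) <= (half n)%:E)%E,
  forall l, (sqint setT (fun x => (convol (g l \_ A) (kernel e) x - (g l \_ A) x)%R) <=
    (half n)%:E)%E &
  forall l m, (sqint setT (fun x => (convol (H l m \_ A) (kernel e) x - (H l m \_ A) x)%R) <=
    (half n)%:E)%E].

Lemma in_H2_bounded : exists N, [/\ bounded_L2 N (v \_ A),
  forall l, bounded_L2 N (g l \_ A) & forall l m, bounded_L2 N (H l m \_ A)].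
Proof.
have [N N0 hN] := elt_bounded K; exists N.
have key f : L2_on A f -> bounded_L2 N (f \_ A).
  move=> /L2_onE[mf ff]; split => // x nb; rewrite patchE memNset// => Kx.
  exact/nb/hN.
have [h1 h2 h3] := hv; split; first exact: key.
  by move=> l; apply: key; have [] := h2 l.
by move=> l m; apply: key; have [] := h3 l m.
Qed.

Lemma smoothing_radius_exists n : exists e, smoothing_radius n e.
Proof.
have [N [vb gb Hb]] := in_H2_bounded.
have hn0 : 0 < half n by rewrite exprn_gt0// invr_gt0.
have d0 : 0 < (n.+2%:R^-1 : R) by rewrite invr_gt0.
have d1 : (n.+2%:R^-1 : R) <= 1 by rewrite invf_le1// ler1n.
have cT : compact (psi K @` (contract K n.+2%:R^-1 @` T)).
  apply: continuous_compact.
    apply: pointwise_within => _ [y Ty <-]; apply: psi_continuous.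
    exact/core_nbhd/core_int_core/contract_int.
  apply: continuous_compact; last exact: core_compact.
  apply: pointwise_within => y _; move: (n.+2%:R^-1) => d.
  have c : {for y, continuous (fun z : plane R => (1 - d) *: z + d *: barycenter (core K))}.
    by apply: cvgD; [exact: (cvgZ (cvg_cst (1 - d)) cvg_id)|exact: cvg_cst].
  exact: c.
have sub : psi K @` (contract K n.+2%:R^-1 @` T) `<=` W.
  move=> _ [_ [y Ty <-] <-]; exists (contract K n.+2%:R^-1 y) => //; exact: contract_int.
have [em em0 hm] := compact_open_margin cT (@elt_int_open _ K) sub.
have [ev ev0 hev] := mollify_cvg vb hn0.
have [eg eg0 heg] := common_radius (fun l => mollify_cvg (gb l) hn0).
have [eH eH0 heH] := common_radius (fun l => common_radius (fun m => mollify_cvg (Hb l m) hn0)).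
pose e := Num.min (Num.min em ev) (Num.min eg eH) / 2.
have m0 : 0 < Num.min (Num.min em ev) (Num.min eg eH) by rewrite !lt_min em0 ev0 eg0.
have e0 : 0 < e by rewrite divr_gt0.
have : e < Num.min (Num.min em ev) (Num.min eg eH) by rewrite ltr_pdivrMr// ltr_pMr// ltr1n.
rewrite !lt_min => /andP[/andP[l1 l2] /andP[l3 l4]].
exists e; split => //.
- move=> y x Ty h; apply: (hm (psi K (contract K n.+2%:R^-1 y))).
    by exists (contract K n.+2%:R^-1 y) => //; exists y.
  exact: le_trans (ltW l1).
- exact: hev.
- by move=> l; exact: (heg e e0 l3 l).
- by move=> l m; exact: (heH e e0 l4 l m).
Qed.

Lemma elt_error : exists2 w : plane R -> R, is_continuous_rep A v w &
  (sqint A (fun x => (\sum_(k < 3) bary (core K) k (psi_inv K x) *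
      w (psi K (vert (core K) k)) - w x)%R) <=
   (9 * (4 * C1) ^+ 4)%:E * sqint A (fun x => density K g H (psi_inv K x)))%E.
Proof.
have [N [vb gb Hb]] := in_H2_bounded.
have /choice[e he] := smoothing_radius_exists.
have mA := measurable_elt K; have mW := measurable_elt_int K.
have [[v2 gH1 HH1] [hvv hgg hHH]] := (hv, hv).
pose d n : R := n.+2%:R^-1.
pose v_ n := convol (v \_ A) (kernel (e n)).
pose g_ n l := convol (g l \_ A) (kernel (e n)).
pose H_ n l m := convol (H l m \_ A) (kernel (e n)).
have e0 n : 0 < e n by have [] := he n.
have mg_ n l : measurable_fun setT (g_ n l : mplane R -> R) by exact: measurable_mollify (gb l).
have mH_ n l m : measurable_fun setT (H_ n l m : mplane R -> R) by exact: measurable_mollify (Hb l m).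
have mg l : measurable_fun (A : set (mplane R)) (g l).
  by have [m _ _] := gb l; exact/(measurable_restrictT _ mA).
have mH l m : measurable_fun (A : set (mplane R)) (H l m).
  by have [m' _ _] := Hb l m; exact/(measurable_restrictT _ mA).
have hs n : shrinks K (1 - d n) (d n *: barycenter (core K)) by exact: shrinks_contract.
have marg n y x : T y -> `|x - psi K ((1 - d n) *: y + d n *: barycenter (core K))| <= e n ->
    interior A x.
  by move=> Ty h; apply: elt_int_interior; have [_ hm _ _ _] := he n; exact: hm Ty h.
have hp n : pulled_C2 K (1 - d n) (d n *: barycenter (core K)) (v_ n) (g_ n) (H_ n).
  split.
  - by move=> l; exact: mollify_continuous (e0 n) (gb l).
  - by move=> l m; exact: mollify_continuous (e0 n) (Hb l m).
  - move=> y Ty; have h l := weak_partial_mollify (e0 n) mA vb (hgg l).2 (marg n y ^~ Ty).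
    by split; [have [] := h ord0|move=> l; have [] := h l].
  - move=> l y Ty; have h m := weak_partial_mollify (e0 n) mA (gb l) (hHH l m).2 (marg n y ^~ Ty).
    by split; [have [] := h ord0|move=> m; have [] := h m].
pose M0 : R := \sum_(l < 2) fine (sqint setT (g l \_ A)) +
  \sum_(l < 2) \sum_(m < 2) fine (sqint setT (H l m \_ A)).
have fin f : bounded_L2 N f -> sqint setT f = (fine (sqint setT f))%:E.
  by move=> [_ _ hf]; rewrite fineK// ge0_fin_numE// sqint_ge0.
have f0 f : 0 <= fine (sqint setT f) by rewrite fine_ge0// sqint_ge0.
have s1 : 0 <= \sum_(l < 2) fine (sqint setT (g l \_ A)).
  by apply: sumr_ge0 => l _; exact: f0.
have s2' l : 0 <= \sum_(m < 2) fine (sqint setT (H l m \_ A)).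
  by apply: sumr_ge0 => m _; exact: f0.
have s2 : 0 <= \sum_(l < 2) \sum_(m < 2) fine (sqint setT (H l m \_ A)).
  by apply: sumr_ge0 => l _; exact: s2'.
have le1 (F : 'I_2 -> R) l : (forall i, 0 <= F i) -> F l <= \sum_(i < 2) F i.
  by move=> F0; rewrite (bigD1 l)//= lerDl; apply: sumr_ge0 => i _; exact: F0.
have sg l : (sqint setT (g l \_ A) <= M0%:E)%E.
  rewrite fin// lee_fin; apply: le_trans (le1 (fun l => fine (sqint setT (g l \_ A))) l _) _ => //.
  by rewrite lerDl.
have sH l m : (sqint setT (H l m \_ A) <= M0%:E)%E.
  rewrite fin// lee_fin; apply: le_trans (le1 (fun m => fine (sqint setT (H l m \_ A))) m _) _ => //.
  apply: le_trans (le1 (fun l => \sum_(m < 2) fine (sqint setT (H l m \_ A))) l _) _ => //.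
  by rewrite lerDr.
have subW f (b : R) : measurable_fun setT (f : mplane R -> R) ->
    (sqint setT f <= b%:E)%E -> (sqint W f <= b%:E)%E.
  move=> mf; apply: le_trans; apply: ge0_subset_integral => //.
  - exact: measurable_sqr.
  - by move=> x _; rewrite lee_fin sqr_ge0.
have hM n : (\int[mu2]_(x in W) (normsq (g_ n) (H_ n) x)%:E <= (6 * M0)%:E)%E.
  apply: normsq_integral_le => //.
  - by move=> l; exact: measurable_funTS (mg_ n l).
  - by move=> l m; exact: measurable_funTS (mH_ n l m).
  - by move=> l; apply: subW => //; apply: le_trans (sg l); exact: mollify_sqint_le (gb l).
  - by move=> l m; apply: subW => //; apply: le_trans (sH l m); exact: mollify_sqint_le (Hb l m).
have M00 : 0 <= 6 * M0 by rewrite mulr_ge0// addr_ge0.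
have v_ae : {ae mu2, forall x : mplane R, v_ n x @[n --> \oo] --> (v \_ A) x}.
  apply: ae_cvg_of_sqint.
  - by move=> n; exact: measurable_mollify vb.
  - by have [] := vb.
  - by move=> n; have [_ _ h _ _] := he n.
have [w wrep wlim] := limit_continuous_rep hC C10 M00 hp hM v_ae (elt_boundary_null C10 hC).
exists w => //.
pose E n (x : mplane R) := \sum_(k < 3) bary (core K) k (psi_inv K x) *
       v_ n (psi K ((1 - d n) *: vert (core K) k + d n *: barycenter (core K))) -
       v_ n (psi K ((1 - d n) *: psi_inv K x + d n *: barycenter (core K))).
pose J := sqint A (fun x => density K g H (psi_inv K x)).
have [B B0 hB] := density_sqr_le K.
(* Collects the factor of the integrated error, the 2 of the squared triangle inequality, the
   comparison constant B and the six derivatives. *)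
pose kap := 3 * (4 * C1) ^+ 4 * (2 * (B * 6)).
have C14 : 0 < (4 * C1) ^+ 4 by rewrite exprn_gt0// mulr_gt0.
have C40' : 0 < 3 * (4 * C1) ^+ 4 by rewrite mulr_gt0.
have C40 := ltW C40'.
have kap0 : 0 < kap by apply: mulr_gt0 C40' _; rewrite mulr_gt0// mulr_gt0.
have mden g' H' : (forall l, measurable_fun (A : set (mplane R)) (g' l)) ->
    (forall l m, measurable_fun (A : set (mplane R)) (H' l m)) ->
    measurable_fun (W : set (mplane R)) (fun x => density K g' H' (psi_inv K x)).
  move=> h1 h2; apply: measurable_funS (measurable_density_inv h1 h2) => //.
  exact: elt_int_sub.
(* The density is sublinear in the pair of derivatives: that of v_n is at most that of v plus that
   of the mollification error, which is of order 2^-n in squared L2 norm. *)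
have bound n : (sqint A (E n) <= (3 * (4 * C1) ^+ 4)%:E * (2%:E * J) + (kap * half n)%:E)%E.
  apply: (le_trans (integrated_error hC C10 (hs n) (hp n))).
  pose g' l x := g_ n l x - g l x; pose H' l m x := H_ n l m x - H l m x.
  have mgn l : measurable_fun (A : set (mplane R)) (g_ n l) by exact: measurable_funTS (mg_ n l).
  have mHn l m : measurable_fun (A : set (mplane R)) (H_ n l m) by exact: measurable_funTS (mH_ n l m).
  have mg' l : measurable_fun (A : set (mplane R)) (g' l) by exact: measurable_funB.
  have mH' l m : measurable_fun (A : set (mplane R)) (H' l m) by exact: measurable_funB.
  have h := @sqintD_le _ W (fun x => density K (g_ n) (H_ n) (psi_inv K x))
    (fun x => density K g H (psi_inv K x)) (fun x => density K g' H' (psi_inv K x)) mW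
    (mden _ _ mgn mHn) (mden _ _ mg mH) (mden _ _ mg' mH').
  have tri x : W x -> `|density K (g_ n) (H_ n) (psi_inv K x)| <=
      `|density K g H (psi_inv K x)| + `|density K g' H' (psi_inv K x)|.
    by move=> _; rewrite !ger0_norm ?density_ge0//; exact: density_triangle.
  have hJ : (sqint W (fun x => density K g H (psi_inv K x)) <= J)%E.
    apply: ge0_subset_integral => //.
    - by apply: measurable_sqr; exact: measurable_density_inv.
    - by move=> x _; rewrite lee_fin sqr_ge0.
    - exact: elt_int_sub.
  have hD : (sqint W (fun x => density K g' H' (psi_inv K x)) <= (B * (6 * half n))%:E)%E.
    have small f (b : R) F : measurable_fun setT (F : mplane R -> R) ->
        measurable_fun setT (f \_ A : mplane R -> R) ->
        (sqint setT (fun x => (F x - (f \_ A) x)%R) <= b%:E)%E ->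
        (sqint W (fun x => (F x - f x)%R) <= b%:E)%E.
      move=> mF mf hb; have h1 := subW _ _ (measurable_funB mF mf) hb.
      apply: le_trans h1; rewrite le_eqVlt; apply/orP; left; apply/eqP.
      by apply: eq_integral => x; rewrite inE => /elt_int_sub Kx /=; rewrite patchE mem_set.
    have mgA l : measurable_fun setT (g l \_ A : mplane R -> R) by have [] := gb l.
    have mHA l m : measurable_fun setT (H l m \_ A : mplane R -> R) by have [] := Hb l m.
    have [_ _ _ sgn sHn] := he n.
    have mgW l : measurable_fun (W : set (mplane R)) (g' l).
      by apply: measurable_funS (mg' l) => //; exact: elt_int_sub.
    have mHW l m : measurable_fun (W : set (mplane R)) (H' l m).
      by apply: measurable_funS (mH' l m) => //; exact: elt_int_sub.
    have hn := @normsq_integral_le W g' H' (half n) mW mgW mHW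
      (fun l => small _ _ _ (mg_ n l) (mgA l) (sgn l))
      (fun l m => small _ _ _ (mH_ n l m) (mHA l m) (sHn l m)).
    have mN : measurable_fun (W : set (mplane R)) (fun x => (normsq g' H' x)%:E).
      apply/measurable_EFinP.
      rewrite (_ : normsq g' H' = fun x => (g' ord0 x ^+ 2 + g' ord_max x ^+ 2) +
        ((H' ord0 ord0 x ^+ 2 + H' ord0 ord_max x ^+ 2) +
         (H' ord_max ord0 x ^+ 2 + H' ord_max ord_max x ^+ 2))).
        by do ?apply: measurable_funD; apply: measurable_funX.
      by apply/funext => x; rewrite /normsq !sum2.
    have N0 (x : mplane R) : W x -> (0 <= (normsq g' H' x)%:E)%E.
      by move=> _; rewrite lee_fin normsq_ge0.
    have eZ := @ge0_integralZl_EFin _ _ _ mu2 W mW _ N0 mN B (ltW B0).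
    have D0 (x : mplane R) : W x -> (0 <= (density K g' H' (psi_inv K x) ^+ 2)%:E)%E.
      by move=> _; rewrite lee_fin sqr_ge0.
    have Dle (x : mplane R) : W x -> ((density K g' H' (psi_inv K x) ^+ 2)%:E <=
        B%:E * (normsq g' H' x)%:E)%E.
      move=> Wx; rewrite -EFinM lee_fin -{2}(psi_invK (elt_int_sub Wx)); apply: hB.
      exact/psi_inv_core/elt_int_sub.
    apply: (le_trans (@ge0_le_integral _ _ _ mu2 W mW _ _ D0
      (measurable_sqr (mden _ _ mg' mH')) (measurable_funeM _ mN) Dle)).
    apply: (@le_trans _ _ (B%:E * \int[mu2]_(x in W) (normsq g' H' x)%:E)%E).
      by rewrite le_eqVlt; apply/orP; left; apply/eqP; exact: eZ.
    rewrite EFinM; apply: lee_wpmul2l; [by rewrite lee_fin ltW|exact: hn].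
  have p2 : (0 <= 2%:E :> \bar R)%E by rewrite lee_fin.
  have h' := le_trans (h tri) (leeD (lee_wpmul2l p2 hJ) (lee_wpmul2l p2 hD)).
  have C4E : (0 <= (3 * (4 * C1) ^+ 4)%:E)%E by rewrite lee_fin.
  apply: (le_trans (lee_wpmul2l C4E h')).
  have J0 : (0 <= 2%:E * J)%E by rewrite mule_ge0// sqint_ge0.
  have D0 : (0 <= 2%:E * (B * (6 * half n))%:E)%E.
    by rewrite mule_ge0// lee_fin !mulr_ge0 ?exprn_ge0// ltW.
  rewrite (ge0_muleDr _ J0 D0) -!EFinM; apply: leeD => //.
  rewrite lee_fin le_eqVlt; apply/orP; left; apply/eqP; rewrite /kap; ring.
have mE n : measurable_fun (A : set (mplane R)) (E n).
  apply: (@measurable_comp_psi_inv _ K (fun y => \sum_(k < 3) bary (core K) k y *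
       v_ n (psi K ((1 - d n) *: vert (core K) k + d n *: barycenter (core K))) -
       v_ n (psi K ((1 - d n) *: y + d n *: barycenter (core K))))) => y Ty.
  apply: cvgB; last exact: pulled_continuous (hs n) (hp n) Ty.
  apply: sum3_cvg => k; apply: cvgM; last exact: cvg_cst.
  exact: bary_continuous.
pose EE (x : mplane R) := \sum_(k < 3) bary (core K) k (psi_inv K x) *
      w (psi K (vert (core K) k)) - w x.
have cE x : A x -> (E n x ^+ 2)%:E @[n --> \oo] --> (EE x ^+ 2)%:E.
  move=> Kx; apply: cvg_EFin; first exact: nearW.
  apply: cvg_sqr; rewrite /EE -[in w x](psi_invK Kx); apply: cvgB.
    apply: sum3_cvg => k; apply: cvgM; first exact: cvg_cst.
    exact: wlim (core_vert _ _).
  exact: wlim (psi_inv_core Kx).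
have fat := @fatou _ _ _ mu2 A mA (fun n x => (E n x ^+ 2)%:E)
  (fun n => measurable_sqr (mE n)) (fun n x _ => sqr_ge0 (E n x)).
have e1 : (sqint A EE = \int[mu2]_(x in A) limn_einf (fun n => (E n x ^+ 2)%:E))%E.
  by apply: eq_integral => x; rewrite inE => Kx; rewrite (cvg_limn_einf_sup (cE x Kx)).1.
have J0 : (0 <= J)%E by exact: sqint_ge0.
apply: (@le_trans _ _ ((3 * (4 * C1) ^+ 4)%:E * (2%:E * J))%E); last first.
  (* The constant found is 3 times 2; it is rounded up to 9 so that its square root is exact. *)
  rewrite muleA -EFinM; apply: lee_wpmul2r => //; rewrite lee_fin.
  rewrite mulrAC; apply: ler_wpM2r; first exact: ltW.
  by rewrite -natrM ler_nat.
rewrite e1; apply: (le_trans fat); apply/lee_addgt0Pr => eps eps0.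
rewrite limn_einf_lim; apply: lime_le; first exact: is_cvg_einfs.
apply: nearW => n.
(* The lower limit is a limit of infima over tails, so one index of the tail with a small error term
   suffices for the bound. *)
have [m nm hm] : exists2 m, (n <= m)%N & kap * half m <= eps.
  have c : kap * half m @[m --> \oo] --> kap * (0 : R).
    by apply: cvgM; [exact: cvg_cst|apply: cvg_expr; rewrite ger0_norm ?invr_ge0// invf_lt1// ltr1n].
  rewrite mulr0 in c; move/cvgrPdist_le : c => /(_ _ eps0)[n0 _ hn0].
  exists (maxn n n0); first exact: leq_maxl.
  have := hn0 (maxn n n0) (leq_maxr _ _); rewrite /= sub0r normrN; apply: le_trans.
  exact: ler_norm.
apply: (@le_trans _ _ (sqint A (E m))).
  by apply: ereal_inf_lbound; exists m.
apply: (le_trans (bound m)); apply: leeD => //; by rewrite lee_fin.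
Qed.

End MollifiedSequence.

Section CurvedInterpolation.
Context {R : realType}.
Variables (K : curved_triangle R) (C1 : R).
Hypothesis hC : (Lp_norm +oo (core_set (core K)) (D1_norm (psi K)) +
  Lp_norm +oo (elt_set K) (D1_norm (psi_inv K)) <= C1%:E)%E.
Hypothesis C10 : 0 < C1.
Variables (v : plane R -> R) (g : 'I_2 -> plane R -> R) (H : 'I_2 -> 'I_2 -> plane R -> R).
Hypothesis hv : in_H2 (elt_set K) v g H.

Local Notation A := (elt_set K).

(** The constructed representative w replaces v almost everywhere under the integral, and it gives
    the nodal values exactly because the continuous representative is unique. *)
Lemma sqint_interp_le :
  (sqint A (fun x => (v x - lagrange_interp K v x)%R) <=
   (9 * (4 * C1) ^+ 4)%:E * sqint A (fun x => density K g H (psi_inv K x)))%E.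
Proof.
have [w wrep hw] := elt_error hC C10 hv; apply: le_trans hw.
have [N [vb gb Hb]] := in_H2_bounded hv.
have mA := measurable_elt K.
have mv : measurable_fun (A : set (mplane R)) v.
  by have [m _ _] := vb; exact/(measurable_restrictT _ mA).
pose I (x : mplane R) := \sum_(k < 3) bary (core K) k (psi_inv K x) * w (psi K (vert (core K) k)).
have mI : measurable_fun (A : set (mplane R)) I.
  apply: (@measurable_comp_psi_inv _ K (fun y => \sum_(k < 3) bary (core K) k y *
    w (psi K (vert (core K) k)))) => y Ty.
  apply: sum3_cvg => k; apply: cvgM; last exact: cvg_cst.
  exact: bary_continuous.
have eI x : A x -> lagrange_interp K v x = I x.
  move=> Kx; rewrite lagrange_interpE//; apply: eq_bigr => k _; congr (_ * _).
  apply: (continuous_rep_unique wrep); exists (vert (core K) k) => //; exact: core_vert.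
have [cw ew] := wrep.
have mw : measurable_fun (A : set (mplane R)) w by exact: within_continuous_measurable_fun2.
have e : (sqint A (fun x => (v x - lagrange_interp K v x)%R) = sqint A (fun x => (v x - I x)%R))%E.
  by apply: eq_integral => x; rewrite inE => Kx; rewrite eI.
rewrite e; apply: ae_ge0_le_integral => //.
- by move=> x _; rewrite lee_fin sqr_ge0.
- by apply: measurable_sqr; exact: measurable_funB.
- by move=> x _; rewrite lee_fin sqr_ge0.
- by apply: measurable_sqr; exact: measurable_funB.
apply: (negligibleS _ ew) => x /= hx hx'; apply: hx => Kx.
by rewrite lee_fin hx'// -[leLHS]sqrrN opprB.
Qed.

(** Here Minkowski's inequality is used rather than its squared substitute, so the sum over i and j
    carries no further factor. *)
Lemma Lp_norm_density_le :
  (Lp_norm 2%:E A (fun x => density K g H (psi_inv K x)) <=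
   \sum_(i < 2) \sum_(j < 2) (h_dir (core K) i * h_dir (core K) j)%:E *
     (Lp_norm 2%:E A (hess_apply H (tau K i) (tau K j)) +
      Lp_norm 2%:E A (grad_dot g (bfield K i j))))%E.
Proof.
have [N [_ gb Hb]] := in_H2_bounded hv.
have mA := measurable_elt K.
have mg l : measurable_fun (A : set (mplane R)) (g l).
  by have [m _ _] := gb l; exact/(measurable_restrictT _ mA).
have mH l m : measurable_fun (A : set (mplane R)) (H l m).
  by have [m' _ _] := Hb l m; exact/(measurable_restrictT _ mA).
pose s i j x := h_dir (core K) i * h_dir (core K) j *
  (`|hess_apply H (tau K i) (tau K j) x| + `|grad_dot g (bfield K i j) x|).
have mh i j : measurable_fun (A : set (mplane R)) (fun x => `|hess_apply H (tau K i) (tau K j) x|).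
  by apply: measurableT_comp => //; exact: measurable_hess_apply.
have mb i j : measurable_fun (A : set (mplane R)) (fun x => `|grad_dot g (bfield K i j) x|).
  by apply: measurableT_comp => //; exact: measurable_grad_dot.
have ms i j : measurable_fun (A : set (mplane R)) (s i j).
  by apply: measurable_funM => //; exact: measurable_funD.
have hs i j : (Lp_norm 2%:E A (s i j) <= (h_dir (core K) i * h_dir (core K) j)%:E *
     (Lp_norm 2%:E A (hess_apply H (tau K i) (tau K j)) +
      Lp_norm 2%:E A (grad_dot g (bfield K i j))))%E.
  have hh : 0 <= h_dir (core K) i * h_dir (core K) j by apply: mulr_ge0; exact: h_dir_ge0.
  rewrite (@Lp_normZ _ A mA _ (fun x => `|hess_apply H (tau K i) (tau K j) x| +
    `|grad_dot g (bfield K i j) x|) hh (measurable_funD (mh i j) (mb i j))).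
  apply: lee_wpmul2l; first by rewrite lee_fin.
  by apply: le_trans (Lp_normD_le mA (mh i j) (mb i j)) _; rewrite !Lp_norm_abs.
have e : Lp_norm 2%:E A (fun x => density K g H (psi_inv K x)) =
    Lp_norm 2%:E A (fun x => (s ord0 ord0 x + s ord0 ord_max x) +
      (s ord_max ord0 x + s ord_max ord_max x)).
  rewrite !Lp_norm2E; congr (_ `^ _)%E; apply: eq_integral => x; rewrite inE => Kx.
  by rewrite density_psi_inv// !sum2.
rewrite e.
have d0 := Lp_normD_le mA (ms ord0 ord0) (ms ord0 ord_max).
have d1 := Lp_normD_le mA (ms ord_max ord0) (ms ord_max ord_max).
have d := Lp_normD_le mA (measurable_funD (ms ord0 ord0) (ms ord0 ord_max))
  (measurable_funD (ms ord_max ord0) (ms ord_max ord_max)).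
apply: (le_trans d); apply: (le_trans (leeD d0 d1)).
by rewrite !sum2; apply: leeD; apply: leeD; exact: hs.
Qed.

Theorem curved_interpolation_error :
  (Lp_norm 2%:E A (fun x => (v x - lagrange_interp K v x)%R) <=
   (3 * (4 * C1) ^+ 2)%:E * \sum_(i < 2) \sum_(j < 2)
     (h_dir (core K) i * h_dir (core K) j)%:E *
     (Lp_norm 2%:E A (hess_apply H (tau K i) (tau K j)) +
      Lp_norm 2%:E A (grad_dot g (bfield K i j))))%E.
Proof.
have [N [_ gb Hb]] := in_H2_bounded hv.
have mA := measurable_elt K.
have mg l : measurable_fun (A : set (mplane R)) (g l).
  by have [m _ _] := gb l; exact/(measurable_restrictT _ mA).
have mH l m : measurable_fun (A : set (mplane R)) (H l m).
  by have [m' _ _] := Hb l m; exact/(measurable_restrictT _ mA).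
have c0 : 0 <= 3 * (4 * C1) ^+ 2 by rewrite mulr_ge0// sqr_ge0.
have sq : (sqint A (fun x => (v x - lagrange_interp K v x)%R) <=
    ((3 * (4 * C1) ^+ 2) ^+ 2)%:E * sqint A (fun x => density K g H (psi_inv K x)))%E.
  have -> : (3 * (4 * C1) ^+ 2) ^+ 2 = 9 * (4 * C1) ^+ 4 by ring.
  exact: sqint_interp_le.
apply: (le_trans (Lp_norm_le_of_sqint mA c0 (measurable_density_inv mg mH) sq)).
by apply: lee_wpmul2l; [rewrite lee_fin|exact: Lp_norm_density_le].
Qed.

End CurvedInterpolation.
Theorem theorem3p6 (R : realType) (C1 C2 : R) (hC1 : 0 < C1) (hC2 : 0 < C2) :
  exists CI : R, 0 < CI /\
    forall (gamma0 : R) (Omega : set (plane R))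
      (I : Type) (Kh : I -> triangulation Omega),
      0 < gamma0 ->
      bounded_domain Omega ->
      piecewise_smooth_boundary Omega ->
      (forall h k, semi_regular gamma0 (elt (Kh h) k)) ->
      (forall h k, curvature_control C1 C2 (elt (Kh h) k)) ->
      forall (h : I) (k : 'I_(nb_elts (Kh h))),
        let K := elt (Kh h) k in
        forall (v : plane R -> R) (g : 'I_2 -> plane R -> R)
          (H : 'I_2 -> 'I_2 -> plane R -> R),
          in_H2 (elt_set K) v g H ->
          (Lp_norm 2%:E (elt_set K) (fun x => (v x - lagrange_interp K v x)%R) <=
           CI%:E * \sum_(i < 2) \sum_(j < 2)
             (h_dir (core K) i * h_dir (core K) j)%:E *
             (Lp_norm 2%:E (elt_set K) (hess_apply H (tau K i) (tau K j)) +
              Lp_norm 2%:E (elt_set K) (grad_dot g (bfield K i j))))%E.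
Proof.
(* The square root of 9 (4 C1)^4. *)
exists (3 * (4 * C1) ^+ 2); split.
  by rewrite mulr_gt0// exprn_gt0// mulr_gt0.
move=> gamma0 Omega I Kh _ _ _ _ ctrl h k K v g H hv.
have [hC _] := ctrl h k.
have res := @curved_interpolation_error R K C1 hC hC1 v g H hv.
exact: res.
Qed.
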